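(* For every single-sorted monoidal signature $\Sigma$, the poset-enriched category $\mathsf T_{\mathsf{CB}_\Sigma}$ is an fb-cb rig category.
   Context: $\Sigma$ has one sort $A$. $\Gamma=\Sigma\cup\{\mathsf c_A:A\to AA,\mathsf d_A:A\to1,\mathsf c^\circ_A:AA\to A,\mathsf d^\circ_A:1\to A\}$; $\mathsf C_\Gamma$ the free strict symmetric monoidal category. A cartesian bicategory is a poset-enriched symmetric monoidal category $(\mathsf C,\otimes,1)$ with, for each $X$, a commutative monoid $\mathsf c^\circ_X:X\otimes X\to X$, $\mathsf d^\circ_X:1\to X$ and cocommutative comonoid $\mathsf c_X:X\to X\otimes X$, $\mathsf d_X:X\to1$, coherent with $\otimes$, such that every $f:X\to Y$ satisfies $f;\mathsf c_Y\le\mathsf c_X;(f\otimes f)$ and $f;\mathsf d_Y\le\mathsf d_X$; $\mathsf c_X;\mathsf c^\circ_X=\mathrm{id}_X$, $(\mathsf c_X\otimes\mathrm{id}_X);(\mathrm{id}_X\otimes\mathsf c^\circ_X)=\mathsf c^\circ_X;\mathsf c_X$; $\mathsf d^\circ_X;\mathsf d_X\le\mathrm{id}_1$, $\mathsf c^\circ_X;\mathsf c_X\le\mathrm{id}_{X\otimes X}$, $\mathrm{id}_X\le\mathsf d_X;\mathsf d^\circ_X$, $\mathrm{id}_X\le\mathsf c_X;\mathsf c^\circ_X$. $\mathsf{CB}_\Sigma$: $\mathsf C_\Gamma$ with the smallest precongruence generated by these axioms (at all arrows), quotiented by $\le\cap\ge$. A finite biproduct (fb) category: symmetric monoidal $(\mathsf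 C,\oplus,0)$ with natural commutative monoids $\nabla_X:X\oplus X\to X$, $\mathsf i_X:0\to X$ and cocommutative comonoids $\Delta_X:X\to X\oplus X$, $!_X:X\to0$, coherent with $\oplus$. $\mathsf T_\Gamma$: the free strict fb category on the underlying category of $\mathsf C_\Gamma$ (objects polynomials $U_1\oplus\cdots\oplus U_n$; arrows terms in $\mathrm{id}$, $\lceil c\rceil$, $\sigma^\oplus$, $\Delta,!,\nabla,\mathsf i$, $;$, $\oplus$ modulo fb laws, naturality w.r.t. $\lceil c\rceil$, $\lceil\mathrm{id}\rceil=\mathrm{id}$, $\lceil c;d\rceil=\lceil c\rceil;\lceil d\rceil$), with the rig structure: $(\bigoplus_iU_i)\otimes(\bigoplus_jV_j)=\bigoplus_i\bigoplus_jU_iV_j$; for monomial $U$, $L_U,R_U$ preserve $;$, $\oplus$, $\mathrm{id}_0$, $L_U(\lceil c\rceil)=\lceil\mathrm{id}_U\otimes c\rceil$, $R_U(\lceil c\rceil)=\lceil c\otimes\mathrm{id}_U\rceil$, $L_U(\sigma^\oplus_{V,W})=\sigma^\oplus_{UV,UW}$, $R_U(\sigma^\oplus_{V,W})=\sigma^\oplus_{VU,WU}$, $L_U(\Delta_V)=\Delta_{UV}$, $R_U(\Delta_V)=\Delta_{VU}$ etc.; $\delta^l_{0,Q,R}=\mathrm{id}_0$, $\delta^l_{U\oplus P',Q,R}=(\mathrm{id}\oplus\delta^l_{P',Q,R});(\mathrm{id}_{UQ}\oplus\sigma^\oplus_{UR,P'Q}\oplus\mathrm{id}_{P'R})$; $L_0=R_0=\mathrm{id}_0$,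 $L_{W\oplus S'}(t)=L_W(t)\oplus L_{S'}(t)$, $R_{W\oplus S'}(t)=\delta^l_{P,W,S'};(R_W(t)\oplus R_{S'}(t));(\delta^l_{Q,W,S'})^{-1}$; $t_1\otimes t_2=L_{P_1}(t_2);R_{Q_2}(t_1)$; $\sigma^\otimes_{P,0}=\mathrm{id}_0$, $\sigma^\otimes_{P,V\oplus Q'}=\delta^l_{P,V,Q'};(\bigoplus_i\lceil\sigma_{U_i,V}\rceil\oplus\sigma^\otimes_{P,Q'})$; right distributors and annihilators identities. $\mathsf T_{\mathsf{CB}_\Sigma}$: $\mathsf T_\Gamma$ ordered by the smallest reflexive transitive relation closed under $;$, $\oplus$, $\otimes$ containing $\lceil c\rceil\le\lceil d\rceil$ for $c\le d$ in $\mathsf{CB}_\Sigma$ and, for each monomial $U$, $\mathrm{id}_0\le\mathsf i_U;!_U$, $!_U;\mathsf i_U\le\mathrm{id}_U$, $\mathrm{id}_U\oplus\mathrm{id}_U\le\nabla_U;\Delta_U$, $\Delta_U;\nabla_U\le\mathrm{id}_U$; quotiented by $\le\cap\ge$. An fb-cb rig category is a poset-enriched rig category (two symmetric monoidal structures $(\otimes,1)$, $(\oplus,0)$ with distributors $\delta^l,\delta^r$ and annihilators satisfying Laplaza's coherence, operations monotone) such that $(\oplus,0)$ is fb, $(\otimes,1)$ is a cartesian bicategory, $\mathrm{id}_0\le\mathsf i_X;!_X$, $\mathrm{id}_X\oplus\mathrm{id}_X\le\nabla_X;\Delta_X$, $!_X;\mathsf i_X\le\mathrm{id}_X$, $\Delta_X;\nabla_X\le\mathrm{id}_X$,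 and $\mathsf c_{X\oplus Y}=(\mathsf c_X\oplus\mathsf i_{XY}\oplus\mathsf i_{YX}\oplus\mathsf c_Y);((\delta^l_{X,X,Y})^{-1}\oplus(\delta^l_{Y,X,Y})^{-1});(\delta^r_{X,Y,X\oplus Y})^{-1}$, $\mathsf d_{X\oplus Y}=(\mathsf d_X\oplus\mathsf d_Y);\nabla_1$, $\mathsf c^\circ_{X\oplus Y}=\delta^r_{X,Y,X\oplus Y};(\delta^l_{X,X,Y}\oplus\delta^l_{Y,X,Y});(\mathsf c^\circ_X\oplus!_{XY}\oplus!_{YX}\oplus\mathsf c^\circ_Y)$, $\mathsf d^\circ_{X\oplus Y}=\Delta_1;(\mathsf d^\circ_X\oplus\mathsf d^\circ_Y)$ (here $XY$ means $X\otimes Y$). *)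

(* Defs.v *)
From mathcomp Require Import all_boot.
Set Implicit Arguments.
Unset Strict Implicit.
Unset Printing Implicit Defensive.

(** * Poset-enriched categories with algebraic structure

   Hom-posets are posets relative to a given equality [heq] (Bishop style), so
   that a quotient of a hom-set is formed by choosing [heq].  Composition is in
   diagrammatic order.  Every structure is split into its data and a [Prop]
   record of laws about these data. *)

Record poset_cat_data : Type := PosetCatData {
  ob :> Type;
  hom : ob -> ob -> Type;
  heq : forall X Y, hom X Y -> hom X Y -> Prop;
  hle : forall X Y, hom X Y -> hom X Y -> Prop;
  idm : forall X, hom X X;
  hcomp : forall X Y Z, hom X Y -> hom Y Z -> hom X Z
}.

Arguments idm {p} X.

Notation "f ≈ g" := (heq f g) (at level 70, no associativity).
Notation "f ⊑ g" := (hle f g) (at level 70, no associativity).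
Notation "f ;; g" := (hcomp f g) (at level 50, left associativity).

Record is_poset_cat (C : poset_cat_data) : Prop := IsPosetCat {
  heq_refl : forall (X Y : C) (f : hom X Y), f ≈ f;
  heq_sym : forall (X Y : C) (f g : hom X Y), f ≈ g -> g ≈ f;
  heq_trans : forall (X Y : C) (f g h : hom X Y), f ≈ g -> g ≈ h -> f ≈ h;
  hle_refl : forall (X Y : C) (f g : hom X Y), f ≈ g -> f ⊑ g;
  hle_trans : forall (X Y : C) (f g h : hom X Y), f ⊑ g -> g ⊑ h -> f ⊑ h;
  hle_anti : forall (X Y : C) (f g : hom X Y), f ⊑ g -> g ⊑ f -> f ≈ g;
  hcomp_mono : forall (X Y Z : C) (f f' : hom X Y) (g g' : hom Y Z),
    f ⊑ f' -> g ⊑ g' -> f ;; g ⊑ f' ;; g';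
  hcompA : forall (X Y Z W : C) (f : hom X Y) (g : hom Y Z) (h : hom Z W),
    f ;; (g ;; h) ≈ (f ;; g) ;; h;
  hcomp_idl : forall (X Y : C) (f : hom X Y), idm X ;; f ≈ f;
  hcomp_idr : forall (X Y : C) (f : hom X Y), f ;; idm Y ≈ f
}.

Record monoidal_data (C : poset_cat_data) : Type := MonoidalData {
  mob : C -> C -> C;
  mun : C;
  marr : forall X Y X' Y' : C,
    hom X Y -> hom X' Y' -> hom (mob X X') (mob Y Y');
  massoc : forall X Y Z : C, hom (mob (mob X Y) Z) (mob X (mob Y Z));
  massoci : forall X Y Z : C, hom (mob X (mob Y Z)) (mob (mob X Y) Z);
  mlam : forall X : C, hom (mob mun X) X;
  mlami : forall X : C, hom X (mob mun X);
  mrho : forall X : C, hom (mob X mun) X;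
  mrhoi : forall X : C, hom X (mob X mun);
  msym : forall X Y : C, hom (mob X Y) (mob Y X)
}.

Section Monoidal.
Variables (C : poset_cat_data) (M : monoidal_data C).

Local Notation I := (mun M).
Local Notation "X ∙ Y" := (mob M X Y) (at level 40, left associativity).
Local Notation "f [∙] g" := (marr M f g) (at level 40, left associativity).
Local Notation α := (massoc M).
Local Notation α' := (massoci M).
Local Notation λ := (mlam M).
Local Notation λ' := (mlami M).
Local Notation ρ := (mrho M).
Local Notation ρ' := (mrhoi M).
Local Notation σ := (msym M).

Record is_symmetric_monoidal : Prop := IsSymmetricMonoidal {
  marr_mono : forall (X Y X' Y' : C) (f g : hom X Y) (f' g' : hom X' Y'),
    f ⊑ g -> f' ⊑ g' -> f [∙] f' ⊑ g [∙] g';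
  marr_id : forall X Y : C, idm X [∙] idm Y ≈ idm (X ∙ Y);
  marr_comp : forall (X Y Z X' Y' Z' : C) (f : hom X Y) (g : hom Y Z)
      (f' : hom X' Y') (g' : hom Y' Z'),
    (f ;; g) [∙] (f' ;; g') ≈ (f [∙] f') ;; (g [∙] g');
  massoc_nat : forall (X Y Z X' Y' Z' : C)
      (f : hom X X') (g : hom Y Y') (h : hom Z Z'),
    ((f [∙] g) [∙] h) ;; α X' Y' Z' ≈ α X Y Z ;; (f [∙] (g [∙] h));
  massocK : forall X Y Z : C, α X Y Z ;; α' X Y Z ≈ idm ((X ∙ Y) ∙ Z);
  massociK : forall X Y Z : C, α' X Y Z ;; α X Y Z ≈ idm (X ∙ (Y ∙ Z));
  mlam_nat : forall (X Y : C) (f : hom X Y), (idm I [∙] f) ;; λ Y ≈ λ X ;; f;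
  mlamK : forall X : C, λ X ;; λ' X ≈ idm (I ∙ X);
  mlamiK : forall X : C, λ' X ;; λ X ≈ idm X;
  mrho_nat : forall (X Y : C) (f : hom X Y), (f [∙] idm I) ;; ρ Y ≈ ρ X ;; f;
  mrhoK : forall X : C, ρ X ;; ρ' X ≈ idm (X ∙ I);
  mrhoiK : forall X : C, ρ' X ;; ρ X ≈ idm X;
  msym_nat : forall (X Y X' Y' : C) (f : hom X X') (g : hom Y Y'),
    (f [∙] g) ;; σ X' Y' ≈ σ X Y ;; (g [∙] f);
  msymK : forall X Y : C, σ X Y ;; σ Y X ≈ idm (X ∙ Y);
  mpentagon : forall X Y Z W : C,
    α (X ∙ Y) Z W ;; α X Y (Z ∙ W)
    ≈ (α X Y Z [∙] idm W) ;; α X (Y ∙ Z) W ;; (idm X [∙] α Y Z W);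
  mtriangle : forall X Y : C,
    α X I Y ;; (idm X [∙] λ Y) ≈ ρ X [∙] idm Y;
  mhexagon : forall X Y Z : C,
    α X Y Z ;; σ X (Y ∙ Z) ;; α Y Z X
    ≈ (σ X Y [∙] idm Z) ;; α Y X Z ;; (idm Y [∙] σ X Z)
}.

(* Exchange of the two middle factors of a fourfold product. *)
Definition mswap (X Y Z W : C) : hom ((X ∙ Y) ∙ (Z ∙ W)) ((X ∙ Z) ∙ (Y ∙ W)) :=
  α X Y (Z ∙ W)
  ;; (idm X [∙] (α' Y Z W ;; (σ Y Z [∙] idm W) ;; α Z Y W))
  ;; α' X Z (Y ∙ W).

(* Used both for (Δ, !, ∇, i) on ⊕ and for (c, d, c°, d°) on ⊗. *)
Record bimonoid_data : Type := BimonoidData {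
  copy : forall X : C, hom X (X ∙ X);
  disc : forall X : C, hom X I;
  merge : forall X : C, hom (X ∙ X) X;
  unit : forall X : C, hom I X
}.

Section Bimonoid.
Variable B : bimonoid_data.
Local Notation cp := (copy B).
Local Notation dc := (disc B).
Local Notation mg := (merge B).
Local Notation un := (unit B).

Record are_coherent_comonoids : Prop := AreCoherentComonoids {
  copyA : forall X : C,
    cp X ;; (cp X [∙] idm X) ;; α X X X ≈ cp X ;; (idm X [∙] cp X);
  copy_discl : forall X : C, cp X ;; (dc X [∙] idm X) ;; λ X ≈ idm X;
  copy_discr : forall X : C, cp X ;; (idm X [∙] dc X) ;; ρ X ≈ idm X;
  copyC : forall X : C, cp X ;; σ X X ≈ cp X;
  copy_un : cp I ≈ λ' I;
  disc_un : dc I ≈ idm I;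
  copy_mob : forall X Y : C,
    cp (X ∙ Y) ≈ (cp X [∙] cp Y) ;; mswap X X Y Y;
  disc_mob : forall X Y : C, dc (X ∙ Y) ≈ (dc X [∙] dc Y) ;; λ I
}.

Record are_coherent_monoids : Prop := AreCoherentMonoids {
  mergeA : forall X : C,
    (mg X [∙] idm X) ;; mg X ≈ α X X X ;; (idm X [∙] mg X) ;; mg X;
  merge_unitl : forall X : C, λ' X ;; (un X [∙] idm X) ;; mg X ≈ idm X;
  merge_unitr : forall X : C, ρ' X ;; (idm X [∙] un X) ;; mg X ≈ idm X;
  mergeC : forall X : C, σ X X ;; mg X ≈ mg X;
  merge_un : mg I ≈ λ I;
  unit_un : un I ≈ idm I;
  merge_mob : forall X Y : C,
    mg (X ∙ Y) ≈ mswap X Y X Y ;; (mg X [∙] mg Y);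
  unit_mob : forall X Y : C, un (X ∙ Y) ≈ λ' I ;; (un X [∙] un Y)
}.

Record is_fb : Prop := IsFb {
  fb_smc : is_symmetric_monoidal;
  fb_comonoids : are_coherent_comonoids;
  fb_monoids : are_coherent_monoids;
  fb_copy_nat : forall (X Y : C) (f : hom X Y), f ;; cp Y ≈ cp X ;; (f [∙] f);
  fb_disc_nat : forall (X Y : C) (f : hom X Y), f ;; dc Y ≈ dc X;
  fb_merge_nat : forall (X Y : C) (f : hom X Y),
    mg X ;; f ≈ (f [∙] f) ;; mg Y;
  fb_unit_nat : forall (X Y : C) (f : hom X Y), un X ;; f ≈ un Y
}.

Record is_cartesian_bicat : Prop := IsCartesianBicat {
  cb_smc : is_symmetric_monoidal;
  cb_comonoids : are_coherent_comonoids;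
  cb_monoids : are_coherent_monoids;
  cb_copy_lax : forall (X Y : C) (f : hom X Y), f ;; cp Y ⊑ cp X ;; (f [∙] f);
  cb_disc_lax : forall (X Y : C) (f : hom X Y), f ;; dc Y ⊑ dc X;
  cb_special : forall X : C, cp X ;; mg X ≈ idm X;
  cb_frobenius : forall X : C,
    (cp X [∙] idm X) ;; α X X X ;; (idm X [∙] mg X) ≈ mg X ;; cp X;
  cb_unit_disc : forall X : C, un X ;; dc X ⊑ idm I;
  cb_merge_copy : forall X : C, mg X ;; cp X ⊑ idm (X ∙ X);
  cb_disc_unit : forall X : C, idm X ⊑ dc X ;; un X;
  cb_copy_merge : forall X : C, idm X ⊑ cp X ;; mg X
}.

End Bimonoid.
End Monoidal.

Record rig_data : Type := RigData {
  rig_cat :> poset_cat_data;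
  add : monoidal_data rig_cat;
  mul : monoidal_data rig_cat;
  dl : forall X Y Z : rig_cat,
    hom (mob mul X (mob add Y Z)) (mob add (mob mul X Y) (mob mul X Z));
  dli : forall X Y Z : rig_cat,
    hom (mob add (mob mul X Y) (mob mul X Z)) (mob mul X (mob add Y Z));
  dr : forall X Y Z : rig_cat,
    hom (mob mul (mob add X Y) Z) (mob add (mob mul X Z) (mob mul Y Z));
  dri : forall X Y Z : rig_cat,
    hom (mob add (mob mul X Z) (mob mul Y Z)) (mob mul (mob add X Y) Z);
  annl : forall X : rig_cat, hom (mob mul (mun add) X) (mun add);
  annli : forall X : rig_cat, hom (mun add) (mob mul (mun add) X);
  annr : forall X : rig_cat, hom (mob mul X (mun add)) (mun add);
  annri : forall X : rig_cat, hom (mun add) (mob mul X (mun add))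
}.

Section Rig.
Variable R : rig_data.

Local Notation "X ⊕ Y" := (mob (add R) X Y) (at level 43, left associativity).
Local Notation "X ⊗ Y" := (mob (mul R) X Y) (at level 40, left associativity).
Local Notation "f [⊕] g" :=
  (marr (add R) f g) (at level 43, left associativity).
Local Notation "f [⊗] g" :=
  (marr (mul R) f g) (at level 40, left associativity).
Local Notation O := (mun (add R)).
Local Notation I := (mun (mul R)).
Local Notation αp := (massoc (add R)).
Local Notation λp := (mlam (add R)).
Local Notation ρp := (mrho (add R)).
Local Notation σp := (msym (add R)).
Local Notation αt := (massoc (mul R)).
Local Notation λt := (mlam (mul R)).
Local Notation ρt := (mrho (mul R)).
Local Notation σt := (msym (mul R)).
Local Notation δl := (@dl R).
Local Notation δl' := (@dli R).
Local Notation δr := (@dr R).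
Local Notation δr' := (@dri R).
Local Notation "λ•" := (@annl R).
Local Notation "λ•'" := (@annli R).
Local Notation "ρ•" := (@annr R).
Local Notation "ρ•'" := (@annri R).

(* Laplaza's 24 conditions, in his order ("Coherence for distributivity"). *)
Record laplaza_coherence : Prop := LaplazaCoherence {
  lap1 : forall A B D : R,
    δl A B D ;; σp (A ⊗ B) (A ⊗ D) ≈ (idm A [⊗] σp B D) ;; δl A D B;
  lap2 : forall A B D : R,
    σt (A ⊕ B) D ;; δl D A B ≈ δr A B D ;; (σt A D [⊕] σt B D);
  lap3 : forall A B D : R,
    δr A B D ;; σp (A ⊗ D) (B ⊗ D) ≈ (σp A B [⊗] idm D) ;; δr B A D;
  lap4 : forall A B D E : R,
    δr (A ⊕ B) D E ;; (δr A B E [⊕] idm (D ⊗ E))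
      ;; αp (A ⊗ E) (B ⊗ E) (D ⊗ E)
    ≈ (αp A B D [⊗] idm E) ;; δr A (B ⊕ D) E ;; (idm (A ⊗ E) [⊕] δr B D E);
  lap5 : forall A B D E : R,
    δl A (B ⊕ D) E ;; (δl A B D [⊕] idm (A ⊗ E))
      ;; αp (A ⊗ B) (A ⊗ D) (A ⊗ E)
    ≈ (idm A [⊗] αp B D E) ;; δl A B (D ⊕ E) ;; (idm (A ⊗ B) [⊕] δl A D E);
  lap6 : forall A B D E : R,
    δl (A ⊗ B) D E ;; (αt A B D [⊕] αt A B E)
    ≈ αt A B (D ⊕ E) ;; (idm A [⊗] δl B D E) ;; δl A (B ⊗ D) (B ⊗ E);
  lap7 : forall A B D E : R,
    (δr A B D [⊗] idm E) ;; δr (A ⊗ D) (B ⊗ D) E ;; (αt A D E [⊕] αt B D E)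
    ≈ αt (A ⊕ B) D E ;; δr A B (D ⊗ E);
  lap8 : forall A B D E : R,
    (δl A B D [⊗] idm E) ;; δr (A ⊗ B) (A ⊗ D) E ;; (αt A B E [⊕] αt A D E)
    ≈ αt A (B ⊕ D) E ;; (idm A [⊗] δr B D E) ;; δl A (B ⊗ E) (D ⊗ E);
  lap9 : forall A B D E : R,
    δl (A ⊕ B) D E ;; (δr A B D [⊕] δr A B E)
      ;; mswap (add R) (A ⊗ D) (B ⊗ D) (A ⊗ E) (B ⊗ E)
    ≈ δr A B (D ⊕ E) ;; (δl A D E [⊕] δl B D E);
  lap10 : λ• O ≈ ρ• O;
  lap11 : forall A B : R,
    δl O A B ;; (λ• A [⊕] λ• B) ;; λp O ≈ λ• (A ⊕ B);
  lap12 : forall A B : R,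
    δr A B O ;; (ρ• A [⊕] ρ• B) ;; λp O ≈ ρ• (A ⊕ B);
  lap13 : ρ• I ≈ λt O;
  lap14 : λ• I ≈ ρt O;
  lap15 : forall A : R, σt A O ;; λ• A ≈ ρ• A;
  lap16 : forall A B : R, (λ• A [⊗] idm B) ;; λ• B ≈ αt O A B ;; λ• (A ⊗ B);
  lap17 : forall A B : R,
    (ρ• A [⊗] idm B) ;; λ• B ≈ αt A O B ;; (idm A [⊗] λ• B) ;; ρ• A;
  lap18 : forall A B : R, αt A B O ;; (idm A [⊗] ρ• B) ;; ρ• A ≈ ρ• (A ⊗ B);
  lap19 : forall A B : R,
    δl A O B ;; (ρ• A [⊕] idm (A ⊗ B)) ;; λp (A ⊗ B) ≈ idm A [⊗] λp B;
  lap20 : forall A B : R,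
    δr O B A ;; (λ• A [⊕] idm (B ⊗ A)) ;; λp (B ⊗ A) ≈ λp B [⊗] idm A;
  lap21 : forall A B : R,
    δl A B O ;; (idm (A ⊗ B) [⊕] ρ• A) ;; ρp (A ⊗ B) ≈ idm A [⊗] ρp B;
  lap22 : forall A B : R,
    δr A O B ;; (idm (A ⊗ B) [⊕] λ• B) ;; ρp (A ⊗ B) ≈ ρp A [⊗] idm B;
  lap23 : forall A B : R, δl I A B ;; (λt A [⊕] λt B) ≈ λt (A ⊕ B);
  lap24 : forall A B : R, δr A B I ;; (ρt A [⊕] ρt B) ≈ ρt (A ⊕ B)
}.

Record is_rig : Prop := IsRig {
  rig_poset_cat : is_poset_cat R;
  rig_add : is_symmetric_monoidal (add R);
  rig_mul : is_symmetric_monoidal (mul R);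
  dl_nat : forall (X Y Z X' Y' Z' : R)
      (f : hom X X') (g : hom Y Y') (h : hom Z Z'),
    (f [⊗] (g [⊕] h)) ;; δl X' Y' Z' ≈ δl X Y Z ;; ((f [⊗] g) [⊕] (f [⊗] h));
  dlK : forall X Y Z : R, δl X Y Z ;; δl' X Y Z ≈ idm (X ⊗ (Y ⊕ Z));
  dliK : forall X Y Z : R, δl' X Y Z ;; δl X Y Z ≈ idm (X ⊗ Y ⊕ X ⊗ Z);
  dr_nat : forall (X Y Z X' Y' Z' : R)
      (f : hom X X') (g : hom Y Y') (h : hom Z Z'),
    ((f [⊕] g) [⊗] h) ;; δr X' Y' Z' ≈ δr X Y Z ;; ((f [⊗] h) [⊕] (g [⊗] h));
  drK : forall X Y Z : R, δr X Y Z ;; δr' X Y Z ≈ idm ((X ⊕ Y) ⊗ Z);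
  driK : forall X Y Z : R, δr' X Y Z ;; δr X Y Z ≈ idm (X ⊗ Z ⊕ Y ⊗ Z);
  annl_nat : forall (X Y : R) (f : hom X Y), (idm O [⊗] f) ;; λ• Y ≈ λ• X;
  annlK : forall X : R, λ• X ;; λ•' X ≈ idm (O ⊗ X);
  annliK : forall X : R, λ•' X ;; λ• X ≈ idm O;
  annr_nat : forall (X Y : R) (f : hom X Y), (f [⊗] idm O) ;; ρ• Y ≈ ρ• X;
  annrK : forall X : R, ρ• X ;; ρ•' X ≈ idm (X ⊗ O);
  annriK : forall X : R, ρ•' X ;; ρ• X ≈ idm O;
  rig_coherence : laplaza_coherence
}.
End Rig.

Record fbcb_data : Type := FbcbData {
  fbcb_rig :> rig_data;
  fb_ops : bimonoid_data (add fbcb_rig);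
  cb_ops : bimonoid_data (mul fbcb_rig)
}.

Section FbCb.
Variable R : fbcb_data.

Local Notation "X ⊕ Y" := (mob (add R) X Y) (at level 43, left associativity).
Local Notation "X ⊗ Y" := (mob (mul R) X Y) (at level 40, left associativity).
Local Notation "f [⊕] g" :=
  (marr (add R) f g) (at level 43, left associativity).
Local Notation O := (mun (add R)).
Local Notation I := (mun (mul R)).
Local Notation Δ := (copy (fb_ops R)).
Local Notation bang := (disc (fb_ops R)).
Local Notation ᐁ := (merge (fb_ops R)).
Local Notation ini := (unit (fb_ops R)).
Local Notation c := (copy (cb_ops R)).
Local Notation d := (disc (cb_ops R)).
Local Notation c' := (merge (cb_ops R)).
Local Notation d' := (unit (cb_ops R)).
Local Notation λp := (mlam (add R)).
Local Notation λp' := (mlami (add R)).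
Local Notation ρp := (mrho (add R)).
Local Notation ρp' := (mrhoi (add R)).

(* The unitors of ⊕ in [copy_add] and [merge_add] identify (X⊕0)⊕(0⊕Y) with
   X⊕Y; they are left implicit when ⊕ is strict. *)
Record is_fbcb_rig : Prop := IsFbcbRig {
  fbcb_is_rig : is_rig R;
  fbcb_is_fb : is_fb (fb_ops R);
  fbcb_is_cb : is_cartesian_bicat (cb_ops R);
  fbcb_ini_bang : forall X : R, idm O ⊑ ini X ;; bang X;
  fbcb_merge_copy : forall X : R, idm X [⊕] idm X ⊑ ᐁ X ;; Δ X;
  fbcb_bang_ini : forall X : R, bang X ;; ini X ⊑ idm X;
  fbcb_copy_merge : forall X : R, Δ X ;; ᐁ X ⊑ idm X;
  copy_add : forall X Y : R,
    c (X ⊕ Y)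
    ≈ (ρp' X [⊕] λp' Y)
      ;; ((c X [⊕] ini (X ⊗ Y)) [⊕] (ini (Y ⊗ X) [⊕] c Y))
      ;; (dli X X Y [⊕] dli Y X Y)
      ;; dri X Y (X ⊕ Y);
  disc_add : forall X Y : R, d (X ⊕ Y) ≈ (d X [⊕] d Y) ;; ᐁ I;
  merge_add : forall X Y : R,
    c' (X ⊕ Y)
    ≈ dr X Y (X ⊕ Y)
      ;; (dl X X Y [⊕] dl Y X Y)
      ;; ((c' X [⊕] bang (X ⊗ Y)) [⊕] (bang (Y ⊗ X) [⊕] c' Y))
      ;; (ρp X [⊕] λp Y);
  unit_add : forall X Y : R, d' (X ⊕ Y) ≈ Δ I ;; (d' X [⊕] d' Y)
}.
End FbCb.

(** * Single-sorted circuits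

   With one sort A, the word A...A of length n is represented by [n : nat].
   Arrows are raw terms; source and target are computed, and a term is an arrow
   when it is well formed.  This keeps the strict laws homogeneous.  The
   relations below preserve source, target and well-formedness ([cle_same],
   [tle_same]), so a derivation between arrows only meets arrows. *)

Record signature : Type := Signature {
  sig_op :> Type;
  sig_ar : sig_op -> nat;
  sig_coar : sig_op -> nat
}.

Section Circuits.
Variable S : signature.

Inductive gamma : Type :=
  | GOp of S | GCopy | GDisc | GMerge | GUnit.

Definition gar (g : gamma) : nat :=
  match g with
  | GOp s => sig_ar s | GCopy => 1 | GDisc => 1 | GMerge => 2 | GUnit => 0
  end.

Definition gcoar (g : gamma) : nat :=
  match g with
  | GOp s => sig_coar s | GCopy => 2 | GDisc => 0 | GMerge => 1 | GUnit => 1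
  end.

Inductive circ : Type :=
  | CId of nat
  | CGen of gamma
  | CSym of nat & nat
  | CComp of circ & circ
  | CTens of circ & circ.

Fixpoint cdom (f : circ) : nat :=
  match f with
  | CId n => n
  | CGen g => gar g
  | CSym m n => m + n
  | CComp f _ => cdom f
  | CTens f g => cdom f + cdom g
  end.

Fixpoint ccod (f : circ) : nat :=
  match f with
  | CId n => n
  | CGen g => gcoar g
  | CSym m n => n + m
  | CComp _ g => ccod g
  | CTens f g => ccod f + ccod g
  end.

Fixpoint cwf (f : circ) : bool :=
  match f with
  | CId _ | CGen _ | CSym _ _ => true
  | CComp f g => [&& cwf f, cwf g & ccod f == cdom g]
  | CTens f g => cwf f && cwf g
  end.

Local Notation "f ;ᶜ g" := (CComp f g) (at level 50, left associativity).
Local Notation "f ⊗ᶜ g" := (CTens f g) (at level 40, left associativity).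

(* Equality in the free strict symmetric monoidal category C_Γ. *)
Inductive ceq : circ -> circ -> Prop :=
  | ceq_refl f : ceq f f
  | ceq_sym f g : ceq f g -> ceq g f
  | ceq_trans f g h : ceq f g -> ceq g h -> ceq f h
  | ceq_comp f f' g g' : ceq f f' -> ceq g g' -> ceq (f ;ᶜ g) (f' ;ᶜ g')
  | ceq_tens f f' g g' : ceq f f' -> ceq g g' -> ceq (f ⊗ᶜ g) (f' ⊗ᶜ g')
  | ceq_compA f g h : ceq (f ;ᶜ (g ;ᶜ h)) ((f ;ᶜ g) ;ᶜ h)
  | ceq_idl f : ceq (CId (cdom f) ;ᶜ f) f
  | ceq_idr f : ceq (f ;ᶜ CId (ccod f)) f
  | ceq_tensA f g h : ceq ((f ⊗ᶜ g) ⊗ᶜ h) (f ⊗ᶜ (g ⊗ᶜ h))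
  | ceq_tens1l f : ceq (CId 0 ⊗ᶜ f) f
  | ceq_tens1r f : ceq (f ⊗ᶜ CId 0) f
  | ceq_tens_id m n : ceq (CId m ⊗ᶜ CId n) (CId (m + n))
  | ceq_tens_comp f g f' g' : ccod f = cdom g -> ccod f' = cdom g' ->
      ceq ((f ;ᶜ g) ⊗ᶜ (f' ;ᶜ g')) ((f ⊗ᶜ f') ;ᶜ (g ⊗ᶜ g'))
  | ceq_sym_nat f g :
      ceq ((f ⊗ᶜ g) ;ᶜ CSym (ccod f) (ccod g))
          (CSym (cdom f) (cdom g) ;ᶜ (g ⊗ᶜ f))
  | ceq_symK m n : ceq (CSym m n ;ᶜ CSym n m) (CId (m + n))
  | ceq_hexagon m n p :
      ceq (CSym m (n + p))
          ((CSym m n ⊗ᶜ CId p) ;ᶜ (CId n ⊗ᶜ CSym m p)).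

(* The (co)monoids of the words, determined by those of A and coherence. *)
Fixpoint ccopy (n : nat) : circ :=
  if n is m.+1
  then (CGen GCopy ⊗ᶜ ccopy m) ;ᶜ (CId 1 ⊗ᶜ CSym 1 m ⊗ᶜ CId m)
  else CId 0.

Fixpoint cdisc (n : nat) : circ :=
  if n is m.+1 then CGen GDisc ⊗ᶜ cdisc m else CId 0.

Fixpoint cmerge (n : nat) : circ :=
  if n is m.+1
  then (CId 1 ⊗ᶜ CSym m 1 ⊗ᶜ CId m) ;ᶜ (CGen GMerge ⊗ᶜ cmerge m)
  else CId 0.

Fixpoint cunit (n : nat) : circ :=
  if n is m.+1 then CGen GUnit ⊗ᶜ cunit m else CId 0.

Inductive cb_ax_eq : circ -> circ -> Prop :=
  | cbe_copyA n :
      cb_ax_eq (ccopy n ;ᶜ (ccopy n ⊗ᶜ CId n)) (ccopy n ;ᶜ (CId n ⊗ᶜ ccopy n))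
  | cbe_copy_discl n : cb_ax_eq (ccopy n ;ᶜ (cdisc n ⊗ᶜ CId n)) (CId n)
  | cbe_copy_discr n : cb_ax_eq (ccopy n ;ᶜ (CId n ⊗ᶜ cdisc n)) (CId n)
  | cbe_copyC n : cb_ax_eq (ccopy n ;ᶜ CSym n n) (ccopy n)
  | cbe_mergeA n :
      cb_ax_eq ((cmerge n ⊗ᶜ CId n) ;ᶜ cmerge n)
               ((CId n ⊗ᶜ cmerge n) ;ᶜ cmerge n)
  | cbe_merge_unitl n : cb_ax_eq ((cunit n ⊗ᶜ CId n) ;ᶜ cmerge n) (CId n)
  | cbe_merge_unitr n : cb_ax_eq ((CId n ⊗ᶜ cunit n) ;ᶜ cmerge n) (CId n)
  | cbe_mergeC n : cb_ax_eq (CSym n n ;ᶜ cmerge n) (cmerge n)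
  | cbe_special n : cb_ax_eq (ccopy n ;ᶜ cmerge n) (CId n)
  | cbe_frobenius n :
      cb_ax_eq ((ccopy n ⊗ᶜ CId n) ;ᶜ (CId n ⊗ᶜ cmerge n))
               (cmerge n ;ᶜ ccopy n).

Inductive cb_ax_le : circ -> circ -> Prop :=
  | cbl_copy_lax f : cwf f ->
      cb_ax_le (f ;ᶜ ccopy (ccod f)) (ccopy (cdom f) ;ᶜ (f ⊗ᶜ f))
  | cbl_disc_lax f : cwf f -> cb_ax_le (f ;ᶜ cdisc (ccod f)) (cdisc (cdom f))
  | cbl_unit_disc n : cb_ax_le (cunit n ;ᶜ cdisc n) (CId 0)
  | cbl_merge_copy n : cb_ax_le (cmerge n ;ᶜ ccopy n) (CId (n + n))
  | cbl_disc_unit n : cb_ax_le (CId n) (cdisc n ;ᶜ cunit n)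
  | cbl_copy_merge n : cb_ax_le (CId n) (ccopy n ;ᶜ cmerge n).

(* The order of CB_Σ. *)
Inductive cle : circ -> circ -> Prop :=
  | cle_ceq f g : ceq f g -> cle f g
  | cle_trans f g h : cle f g -> cle g h -> cle f h
  | cle_comp f f' g g' : cle f f' -> cle g g' -> cle (f ;ᶜ g) (f' ;ᶜ g')
  | cle_tens f f' g g' : cle f f' -> cle g g' -> cle (f ⊗ᶜ g) (f' ⊗ᶜ g')
  | cle_ax_eql f g : cb_ax_eq f g -> cle f g
  | cle_ax_eqr f g : cb_ax_eq f g -> cle g f
  | cle_ax_le f g : cb_ax_le f g -> cle f g.

(** * Tapes

   The polynomial U_1 ⊕ ... ⊕ U_n is the sequence of its monomials. *)

Definition poly := seq nat.

Definition pmul (P Q : poly) : poly := [seq u + v | u <- P, v <- Q].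
Arguments pmul : simpl never.

Inductive tape : Type :=
  | TId of poly
  | TLift of circ
  | TSym of poly & poly
  | TCopy of poly
  | TDisc of poly
  | TMerge of poly
  | TUnit of poly
  | TComp of tape & tape
  | TSum of tape & tape.

Fixpoint tdom (t : tape) : poly :=
  match t with
  | TId P => P
  | TLift f => [:: cdom f]
  | TSym P Q => P ++ Q
  | TCopy P => P
  | TDisc P => P
  | TMerge P => P ++ P
  | TUnit _ => [::]
  | TComp t _ => tdom t
  | TSum t s => tdom t ++ tdom s
  end.

Fixpoint tcod (t : tape) : poly :=
  match t with
  | TId P => P
  | TLift f => [:: ccod f]
  | TSym P Q => Q ++ P
  | TCopy P => P ++ P
  | TDisc _ => [::]
  | TMerge P => P
  | TUnit P => P
  | TComp _ s => tcod s
  | TSum t s => tcod t ++ tcod s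
  end.

Fixpoint twf (t : tape) : bool :=
  match t with
  | TLift f => cwf f
  | TComp t s => [&& twf t, twf s & tcod t == tdom s]
  | TSum t s => twf t && twf s
  | _ => true
  end.

Local Notation "t ;ᵗ s" := (TComp t s) (at level 50, left associativity).
Local Notation "t ⊕ᵗ s" := (TSum t s) (at level 43, right associativity).

(* Equality in the free strict fb category T_Γ on the category C_Γ.  The
   structural arrows are available at every polynomial; those at non-monomials
   are determined by the coherence laws. *)
Inductive teq : tape -> tape -> Prop :=
  | teq_refl t : teq t t
  | teq_sym t s : teq t s -> teq s t
  | teq_trans t s r : teq t s -> teq s r -> teq t r
  | teq_comp t t' s s' : teq t t' -> teq s s' -> teq (t ;ᵗ s) (t' ;ᵗ s')
  | teq_sum t t' s s' : teq t t' -> teq s s' -> teq (t ⊕ᵗ s) (t' ⊕ᵗ s')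
  | teq_compA t s r : teq (t ;ᵗ (s ;ᵗ r)) ((t ;ᵗ s) ;ᵗ r)
  | teq_idl t : teq (TId (tdom t) ;ᵗ t) t
  | teq_idr t : teq (t ;ᵗ TId (tcod t)) t
  | teq_sumA t s r : teq ((t ⊕ᵗ s) ⊕ᵗ r) (t ⊕ᵗ (s ⊕ᵗ r))
  | teq_sum0l t : teq (TId [::] ⊕ᵗ t) t
  | teq_sum0r t : teq (t ⊕ᵗ TId [::]) t
  | teq_sum_id P Q : teq (TId P ⊕ᵗ TId Q) (TId (P ++ Q))
  | teq_sum_comp t s t' s' : tcod t = tdom s -> tcod t' = tdom s' ->
      teq ((t ;ᵗ s) ⊕ᵗ (t' ;ᵗ s')) ((t ⊕ᵗ t') ;ᵗ (s ⊕ᵗ s'))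
  | teq_sym_nat t s :
      teq ((t ⊕ᵗ s) ;ᵗ TSym (tcod t) (tcod s))
          (TSym (tdom t) (tdom s) ;ᵗ (s ⊕ᵗ t))
  | teq_symK P Q : teq (TSym P Q ;ᵗ TSym Q P) (TId (P ++ Q))
  | teq_hexagon P Q R :
      teq (TSym P (Q ++ R)) ((TSym P Q ⊕ᵗ TId R) ;ᵗ (TId Q ⊕ᵗ TSym P R))
  | teq_lift f g : ceq f g -> teq (TLift f) (TLift g)
  | teq_lift_id n : teq (TLift (CId n)) (TId [:: n])
  | teq_lift_comp f g : teq (TLift (f ;ᶜ g)) (TLift f ;ᵗ TLift g)
  | teq_copyA P :
      teq (TCopy P ;ᵗ (TCopy P ⊕ᵗ TId P)) (TCopy P ;ᵗ (TId P ⊕ᵗ TCopy P))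
  | teq_copy_discl P : teq (TCopy P ;ᵗ (TDisc P ⊕ᵗ TId P)) (TId P)
  | teq_copy_discr P : teq (TCopy P ;ᵗ (TId P ⊕ᵗ TDisc P)) (TId P)
  | teq_copyC P : teq (TCopy P ;ᵗ TSym P P) (TCopy P)
  | teq_mergeA P :
      teq ((TMerge P ⊕ᵗ TId P) ;ᵗ TMerge P) ((TId P ⊕ᵗ TMerge P) ;ᵗ TMerge P)
  | teq_merge_unitl P : teq ((TUnit P ⊕ᵗ TId P) ;ᵗ TMerge P) (TId P)
  | teq_merge_unitr P : teq ((TId P ⊕ᵗ TUnit P) ;ᵗ TMerge P) (TId P)
  | teq_mergeC P : teq (TSym P P ;ᵗ TMerge P) (TMerge P)
  | teq_copy0 : teq (TCopy [::]) (TId [::])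
  | teq_disc0 : teq (TDisc [::]) (TId [::])
  | teq_merge0 : teq (TMerge [::]) (TId [::])
  | teq_unit0 : teq (TUnit [::]) (TId [::])
  | teq_copyD P Q :
      teq (TCopy (P ++ Q))
          ((TCopy P ⊕ᵗ TCopy Q) ;ᵗ (TId P ⊕ᵗ TSym P Q ⊕ᵗ TId Q))
  | teq_discD P Q : teq (TDisc (P ++ Q)) (TDisc P ⊕ᵗ TDisc Q)
  | teq_mergeD P Q :
      teq (TMerge (P ++ Q))
          ((TId P ⊕ᵗ TSym Q P ⊕ᵗ TId Q) ;ᵗ (TMerge P ⊕ᵗ TMerge Q))
  | teq_unitD P Q : teq (TUnit (P ++ Q)) (TUnit P ⊕ᵗ TUnit Q)
  | teq_copy_nat t : twf t ->
      teq (t ;ᵗ TCopy (tcod t)) (TCopy (tdom t) ;ᵗ (t ⊕ᵗ t))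
  | teq_disc_nat t : twf t -> teq (t ;ᵗ TDisc (tcod t)) (TDisc (tdom t))
  | teq_merge_nat t : twf t ->
      teq (TMerge (tdom t) ;ᵗ t) ((t ⊕ᵗ t) ;ᵗ TMerge (tcod t))
  | teq_unit_nat t : twf t -> teq (TUnit (tdom t) ;ᵗ t) (TUnit (tcod t)).

(* Left distributor δ^l and its inverse. *)
Fixpoint tdl (P Q R : poly) : tape :=
  if P is U :: P'
  then (TId (pmul [:: U] (Q ++ R)) ⊕ᵗ tdl P' Q R)
       ;ᵗ (TId (pmul [:: U] Q) ⊕ᵗ TSym (pmul [:: U] R) (pmul P' Q)
           ⊕ᵗ TId (pmul P' R))
  else TId [::].

Fixpoint tdli (P Q R : poly) : tape :=
  if P is U :: P'
  then (TId (pmul [:: U] Q) ⊕ᵗ TSym (pmul P' Q) (pmul [:: U] R)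
        ⊕ᵗ TId (pmul P' R))
       ;ᵗ (TId (pmul [:: U] (Q ++ R)) ⊕ᵗ tdli P' Q R)
  else TId [::].

(* L_U and R_U for a monomial U; [tL] and [tR] below are L_S and R_S. *)
Fixpoint tLm (U : nat) (t : tape) : tape :=
  match t with
  | TId P => TId (pmul [:: U] P)
  | TLift f => TLift (CId U ⊗ᶜ f)
  | TSym P Q => TSym (pmul [:: U] P) (pmul [:: U] Q)
  | TCopy P => TCopy (pmul [:: U] P)
  | TDisc P => TDisc (pmul [:: U] P)
  | TMerge P => TMerge (pmul [:: U] P)
  | TUnit P => TUnit (pmul [:: U] P)
  | TComp t s => tLm U t ;ᵗ tLm U s
  | TSum t s => tLm U t ⊕ᵗ tLm U s
  end.

Fixpoint tRm (U : nat) (t : tape) : tape :=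
  match t with
  | TId P => TId (pmul P [:: U])
  | TLift f => TLift (f ⊗ᶜ CId U)
  | TSym P Q => TSym (pmul P [:: U]) (pmul Q [:: U])
  | TCopy P => TCopy (pmul P [:: U])
  | TDisc P => TDisc (pmul P [:: U])
  | TMerge P => TMerge (pmul P [:: U])
  | TUnit P => TUnit (pmul P [:: U])
  | TComp t s => tRm U t ;ᵗ tRm U s
  | TSum t s => tRm U t ⊕ᵗ tRm U s
  end.

Fixpoint tL (S : poly) (t : tape) : tape :=
  if S is W :: S' then tLm W t ⊕ᵗ tL S' t else TId [::].

Fixpoint tR (S : poly) (t : tape) : tape :=
  if S is W :: S'
  then tdl (tdom t) [:: W] S' ;ᵗ (tRm W t ⊕ᵗ tR S' t)
       ;ᵗ tdli (tcod t) [:: W] S'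
  else TId [::].

Definition tmul (t s : tape) : tape := tL (tdom t) s ;ᵗ tR (tcod s) t.

Local Notation "t ⊗ᵗ s" := (tmul t s) (at level 40, left associativity).

(* The sum of the lifted symmetries of U_i and V, for U_i ranging over P. *)
Definition tsyms (P : poly) (V : nat) : tape :=
  foldr (fun U t => TLift (CSym U V) ⊕ᵗ t) (TId [::]) P.

Fixpoint tsymt (P Q : poly) : tape :=
  if Q is V :: Q'
  then tdl P [:: V] Q' ;ᵗ (tsyms P V ⊕ᵗ tsymt P Q')
  else TId [::].

(* The order of T_{CB_Σ}. *)
Inductive tle : tape -> tape -> Prop :=
  | tle_teq t s : teq t s -> tle t s
  | tle_trans t s r : tle t s -> tle s r -> tle t r
  | tle_comp t t' s s' : tle t t' -> tle s s' -> tle (t ;ᵗ s) (t' ;ᵗ s')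
  | tle_sum t t' s s' : tle t t' -> tle s s' -> tle (t ⊕ᵗ s) (t' ⊕ᵗ s')
  | tle_mul t t' s s' : twf t -> twf s ->
      tle t t' -> tle s s' -> tle (t ⊗ᵗ s) (t' ⊗ᵗ s')
  | tle_lift f g : cle f g -> tle (TLift f) (TLift g)
  | tle_unit_disc (U : nat) : tle (TId [::]) (TUnit [:: U] ;ᵗ TDisc [:: U])
  | tle_disc_unit (U : nat) : tle (TDisc [:: U] ;ᵗ TUnit [:: U]) (TId [:: U])
  | tle_merge_copy (U : nat) :
      tle (TId [:: U] ⊕ᵗ TId [:: U]) (TMerge [:: U] ;ᵗ TCopy [:: U])
  | tle_copy_merge (U : nat) :
      tle (TCopy [:: U] ;ᵗ TMerge [:: U]) (TId [:: U]).

(* The ⊗-(co)monoids of a polynomial: those of CB_Σ on monomials, extended by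
   the coherence conditions of [is_fbcb_rig] with X a monomial (the right
   distributors are identities). *)
Fixpoint tccopy (P : poly) : tape :=
  if P is U :: Q
  then (TLift (ccopy U) ⊕ᵗ TUnit (pmul [:: U] Q) ⊕ᵗ TUnit (pmul Q [:: U])
        ⊕ᵗ tccopy Q)
       ;ᵗ (tdli [:: U] [:: U] Q ⊕ᵗ tdli Q [:: U] Q)
  else TId [::].

Fixpoint tcdisc (P : poly) : tape :=
  if P is U :: Q then (TLift (cdisc U) ⊕ᵗ tcdisc Q) ;ᵗ TMerge [:: 0]
  else TUnit [:: 0].

Fixpoint tcmerge (P : poly) : tape :=
  if P is U :: Q
  then (tdl [:: U] [:: U] Q ⊕ᵗ tdl Q [:: U] Q)
       ;ᵗ (TLift (cmerge U) ⊕ᵗ TDisc (pmul [:: U] Q)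
           ⊕ᵗ TDisc (pmul Q [:: U]) ⊕ᵗ tcmerge Q)
  else TId [::].

Fixpoint tcunit (P : poly) : tape :=
  if P is U :: Q then TCopy [:: 0] ;ᵗ (TLift (cunit U) ⊕ᵗ tcunit Q)
  else TDisc [:: 0].

Definition tty (P Q : poly) (t : tape) : bool :=
  [&& twf t, tdom t == P & tcod t == Q].

Lemma ttyP P Q t : reflect [/\ twf t, tdom t = P & tcod t = Q] (tty P Q t).
Proof.
by apply: (iffP and3P) => -[? /eqP ? /eqP ?]; split=> //; apply/eqP.
Qed.

Lemma pmul1l U P : pmul [:: U] P = map (addn U) P.
Proof. by rewrite /pmul /= cats0. Qed.

Lemma pmul1r P U : pmul P [:: U] = map (addn^~ U) P.
Proof. by rewrite /pmul; elim: P => //= u P ->. Qed.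

Lemma pmul_cons U P Q : pmul (U :: P) Q = pmul [:: U] Q ++ pmul P Q.
Proof. by rewrite pmul1l. Qed.

Lemma pmul0r P : pmul P [::] = [::].
Proof. by elim: P. Qed.

Lemma pmulDl P Q R : pmul (P ++ Q) R = pmul P R ++ pmul Q R.
Proof. by rewrite /pmul allpairs_cat. Qed.

Lemma pmul1Dr U P Q : pmul [:: U] (P ++ Q) = pmul [:: U] P ++ pmul [:: U] Q.
Proof. by rewrite !pmul1l map_cat. Qed.

Lemma pmulI1 P : pmul [:: 0] P = P.
Proof. by rewrite pmul1l map_id_in. Qed.

Lemma pmulI2 P : pmul P [:: 0] = P.
Proof. by rewrite pmul1r map_id_in // => u _; rewrite addn0. Qed.

Lemma pmulA P Q R : pmul (pmul P Q) R = pmul P (pmul Q R).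
Proof.
elim: P => [|U P IH] //.
rewrite (pmul_cons U P Q) pmulDl IH [RHS]pmul_cons; congr (_ ++ _).
elim: Q {IH} => [|V Q IH] //.
have -> : pmul [:: U] (V :: Q) = (U + V) :: pmul [:: U] Q by [].
rewrite (pmul_cons (U + V)) IH (pmul_cons V) pmul1Dr; congr (_ ++ _).
by rewrite !pmul1l -map_comp; apply: eq_map => W /=; rewrite addnA.
Qed.

Lemma tty_id P Q : P = Q -> tty P Q (TId P).
Proof. by move=> ->; apply/ttyP. Qed.

Lemma tty_comp P Q R t s : tty P Q t -> tty Q R s -> tty P R (t ;ᵗ s).
Proof.
move=> /ttyP[wt dt ct] /ttyP[ws ds cs]; apply/ttyP.
by rewrite /= wt ws dt cs ct ds eqxx.
Qed.

Lemma tty_sum P Q P' Q' t s :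
  tty P Q t -> tty P' Q' s -> tty (P ++ P') (Q ++ Q') (t ⊕ᵗ s).
Proof.
by move=> /ttyP[wt <- <-] /ttyP[ws <- <-]; apply/ttyP; rewrite /= wt ws.
Qed.

Lemma tty_dl P Q R : tty (pmul P (Q ++ R)) (pmul P Q ++ pmul P R) (tdl P Q R).
Proof.
elim: P => [|U P /ttyP[wt dt ct]] //.
apply/ttyP; rewrite /tdl -/tdl (pmul_cons U P (_ ++ _)) (pmul_cons U P Q).
rewrite (pmul_cons U P R) pmul1Dr /= wt dt ct.
by rewrite !catA eqxx.
Qed.

Lemma tty_dli P Q R : tty (pmul P Q ++ pmul P R) (pmul P (Q ++ R)) (tdli P Q R).
Proof.
elim: P => [|U P /ttyP[wt dt ct]] //.
apply/ttyP; rewrite /tdli -/tdli (pmul_cons U P (_ ++ _)) (pmul_cons U P Q).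
rewrite (pmul_cons U P R) pmul1Dr /= wt dt ct.
by rewrite !catA eqxx.
Qed.

Lemma tty_Lm U P Q t :
  tty P Q t -> tty (pmul [:: U] P) (pmul [:: U] Q) (tLm U t).
Proof.
elim: t P Q => [P'|f|P1 P2|P'|P'|P'|P'|t IHt s IHs|t IHt s IHs] P Q;
  try by move=> /ttyP[_ <- <-]; apply/ttyP; rewrite /= ?pmul1Dr.
- by move=> /ttyP[wf <- <-]; apply/ttyP; split; rewrite ?pmul1l.
- move=> /ttyP[/= /and3P[wt ws /eqP e] <- <-].
  by apply: tty_comp (IHt _ _ _) (IHs _ _ _); apply/ttyP => //; rewrite e.
- move=> /ttyP[/= /andP[wt ws] <- <-]; rewrite !pmul1Dr.
  by apply: tty_sum; [apply: IHt | apply: IHs]; apply/ttyP.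
Qed.

Lemma tty_Rm U P Q t :
  tty P Q t -> tty (pmul P [:: U]) (pmul Q [:: U]) (tRm U t).
Proof.
elim: t P Q => [P'|f|P1 P2|P'|P'|P'|P'|t IHt s IHs|t IHt s IHs] P Q;
  try by move=> /ttyP[_ <- <-]; apply/ttyP; rewrite /= ?pmulDl.
- by move=> /ttyP[/= wf <- <-]; apply/ttyP; rewrite /= wf.
- move=> /ttyP[/= /and3P[wt ws /eqP e] <- <-].
  by apply: tty_comp (IHt _ _ _) (IHs _ _ _); apply/ttyP => //; rewrite e.
- move=> /ttyP[/= /andP[wt ws] <- <-]; rewrite !pmulDl.
  by apply: tty_sum; [apply: IHt | apply: IHs]; apply/ttyP.
Qed.

Lemma tty_L S' P Q t : tty P Q t -> tty (pmul S' P) (pmul S' Q) (tL S' t).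
Proof.
move=> ty; elim: S' => [|W S' IH] //.
rewrite (pmul_cons W S' P) (pmul_cons W S' Q).
by apply: tty_sum IH; apply: tty_Lm.
Qed.

Lemma tty_R S' P Q t : tty P Q t -> tty (pmul P S') (pmul Q S') (tR S' t).
Proof.
move=> ty; elim: S' => [|W S' IH]; first by rewrite !pmul0r.
case/ttyP: (ty) => _ eP eQ; rewrite /= eP eQ.
apply: tty_comp (tty_dli Q [:: W] S').
apply: tty_comp (tty_dl P [:: W] S') _.
by apply: tty_sum IH; apply: tty_Rm.
Qed.

Lemma tty_mul P Q P' Q' t s :
  tty P Q t -> tty P' Q' s -> tty (pmul P P') (pmul Q Q') (t ⊗ᵗ s).
Proof.
move=> tyt tys; case/ttyP: (tyt) => _ eP _; case/ttyP: (tys) => _ _ eQ'.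
by rewrite /tmul eP eQ'; apply: tty_comp (tty_L _ tys) (tty_R _ tyt).
Qed.

Lemma tty_syms P V : tty (pmul P [:: V]) (pmul [:: V] P) (tsyms P V).
Proof.
elim: P => [|U P IH] //; rewrite pmul_cons.
have -> : pmul [:: V] (U :: P) = [:: V + U] ++ pmul [:: V] P by [].
by apply: tty_sum IH; apply/ttyP.
Qed.

Lemma tty_symt P Q : tty (pmul P Q) (pmul Q P) (tsymt P Q).
Proof.
elim: Q => [|V Q IH]; first by rewrite pmul0r.
rewrite (pmul_cons V Q); apply: tty_comp (tty_dl P [:: V] Q) _.
exact: tty_sum (tty_syms P V) IH.
Qed.

Definition cty (m n : nat) (f : circ) : Prop :=
  [/\ cwf f, cdom f = m & ccod f = n].

Lemma cty_copy n : cty n (n + n) (ccopy n).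
Proof.
elim: n => [|n [w dm cd]] //; split=> /=; rewrite ?w ?dm ?cd //.
- by apply/eqP; rewrite !addnA.
- by rewrite -!addnA.
Qed.

Lemma cty_disc n : cty n 0 (cdisc n).
Proof. by elim: n => [|n [w dm cd]] //; split=> /=; rewrite ?w ?dm ?cd. Qed.

Lemma cty_merge n : cty (n + n) n (cmerge n).
Proof.
elim: n => [|n [w dm cd]] //; split=> /=; rewrite ?w ?dm ?cd //.
- by apply/eqP; rewrite !addnA.
- by rewrite -!addnA.
Qed.

Lemma cty_unit n : cty 0 n (cunit n).
Proof. by elim: n => [|n [w dm cd]] //; split=> /=; rewrite ?w ?dm ?cd. Qed.

Lemma tty_lift m n f : cty m n f -> tty [:: m] [:: n] (TLift f).
Proof. by case=> w <- <-; apply/ttyP. Qed.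

Lemma tty_ccopy P : tty P (pmul P P) (tccopy P).
Proof.
elim: P => [|U P IH] //; rewrite (pmul_cons U P).
apply: (@tty_comp _ ((pmul [:: U] [:: U] ++ pmul [:: U] P)
                     ++ (pmul P [:: U] ++ pmul P P))); last first.
  exact: tty_sum (tty_dli _ [:: U] P) (tty_dli _ [:: U] P).
rewrite -catA.
apply: (tty_sum (tty_lift (cty_copy U))).
apply: (@tty_sum [::] _ P); first by apply/ttyP.
by apply: (@tty_sum [::] _ P) => //; apply/ttyP.
Qed.

Lemma tty_cmerge P : tty (pmul P P) P (tcmerge P).
Proof.
elim: P => [|U P IH] //; rewrite (pmul_cons U P).
apply: (@tty_comp _ ((pmul [:: U] [:: U] ++ pmul [:: U] P)
                     ++ (pmul P [:: U] ++ pmul P P))).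
  exact: tty_sum (tty_dl _ [:: U] P) (tty_dl _ [:: U] P).
rewrite -catA.
apply: (tty_sum (tty_lift (cty_merge U))).
apply: (@tty_sum _ [::] _ P); first by apply/ttyP.
by apply: (@tty_sum _ [::] _ P) => //; apply/ttyP.
Qed.

Lemma tty_cdisc P : tty P [:: 0] (tcdisc P).
Proof.
elim: P => [|U P IH] //.
apply: (@tty_comp _ ([:: 0] ++ [:: 0])); last by apply/ttyP.
exact: tty_sum (tty_lift (cty_disc U)) IH.
Qed.

Lemma tty_cunit P : tty [:: 0] P (tcunit P).
Proof.
elim: P => [|U P IH] //.
apply: (@tty_comp _ ([:: 0] ++ [:: 0])); first by apply/ttyP.
exact: tty_sum (tty_lift (cty_unit U)) IH.
Qed.

Definition csame (f g : circ) : Prop :=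
  [/\ cwf f = cwf g, cdom f = cdom g & ccod f = ccod g].

Definition tsame (t s : tape) : Prop :=
  [/\ twf t = twf s, tdom t = tdom s & tcod t = tcod s].

Lemma ceq_same f g : ceq f g -> csame f g.
Proof.
elim=> {f g}; rewrite /csame /=.
- by [].
- by move=> f g _ [-> -> ->].
- by move=> f g h _ [-> -> ->] _ [-> -> ->].
- by move=> f f' g g' _ [-> -> ->] _ [-> -> ->].
- by move=> f f' g g' _ [-> -> ->] _ [-> -> ->].
- move=> f g h; split=> //; do 3!case: cwf => //=; rewrite ?andbT ?andbF //.
  by rewrite andbC.
- by move=> f; rewrite eqxx andbT.
- by move=> f; rewrite eqxx !andbT.
- by move=> f g h; rewrite andbA !addnA.
- by [].
- by move=> f; rewrite andbT !addn0.
- by [].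
- move=> f g f' g' -> ->; rewrite !eqxx !andbT; split=> //.
  by do 4!case: cwf.
- by move=> f g; rewrite !eqxx !andbT /= andbC.
- by move=> m n; rewrite eqxx.
- by move=> m n p; rewrite !addnA eqxx.
Qed.

Lemma cb_ax_eq_same f g : cb_ax_eq f g -> csame f g.
Proof.
case=> n; have [w1 d1 c1] := cty_copy n; have [w2 d2 c2] := cty_disc n;
  have [w3 d3 c3] := cty_merge n; have [w4 d4 c4] := cty_unit n;
  rewrite /csame /= ?w1 ?w2 ?w3 ?w4 ?d1 ?d2 ?d3 ?d4 ?c1 ?c2 ?c3 ?c4;
  by rewrite ?addn0 ?addnA ?eqxx.
Qed.

Lemma cb_ax_le_same f g : cb_ax_le f g -> csame f g.
Proof.
case=> [{}f wf|{}f wf|n|n|n|n]; last 4 first;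
  [ have [w1 d1 c1] := cty_unit n; have [w2 d2 c2] := cty_disc n
  | have [w1 d1 c1] := cty_merge n; have [w2 d2 c2] := cty_copy n
  | have [w1 d1 c1] := cty_disc n; have [w2 d2 c2] := cty_unit n
  | have [w1 d1 c1] := cty_copy n; have [w2 d2 c2] := cty_merge n
  | have [w1 d1 c1] := cty_copy (ccod f); have [w2 d2 c2] := cty_copy (cdom f)
  | have [w1 d1 c1] := cty_disc (ccod f); have [w2 d2 c2] := cty_disc (cdom f)
  ]; by rewrite /csame /= ?wf w1 w2 d1 d2 c1 c2 ?eqxx.
Qed.

Lemma cle_same f g : cle f g -> csame f g.
Proof.
elim=> {f g}; rewrite /csame.
- exact: ceq_same.
- by move=> f g h _ [-> -> ->] _ [-> -> ->].
- by move=> f f' g g' _ [/= -> -> ->] _ [-> -> ->].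
- by move=> f f' g g' _ [/= -> -> ->] _ [-> -> ->].
- exact: cb_ax_eq_same.
- by move=> f g /cb_ax_eq_same[].
- exact: cb_ax_le_same.
Qed.

Lemma teq_same t s : teq t s -> tsame t s.
Proof.
elim=> {t s}; rewrite /tsame /=; try by move=> *; rewrite ?eqxx ?catA ?eqxx.
- by move=> t s _ [-> -> ->].
- by move=> t s r _ [-> -> ->] _ [-> -> ->].
- by move=> t t' s s' _ [-> -> ->] _ [-> -> ->].
- by move=> t t' s s' _ [-> -> ->] _ [-> -> ->].
- move=> t s r; split=> //; do 3!case: twf => //=; rewrite ?andbT ?andbF //.
  by rewrite andbC.
- by move=> t; rewrite eqxx andbT.
- by move=> t; rewrite eqxx !andbT.
- by move=> t s r; rewrite andbA !catA.
- by move=> t; rewrite andbT !cats0.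
- move=> t s t' s' -> ->; rewrite !eqxx !andbT; split=> //.
  by do 4!case: twf.
- by move=> t s; rewrite !eqxx !andbT /= andbC.
- by move=> f g /ceq_same[-> -> ->].
- by move=> f g; rewrite eqseq_cons andbT.
- by move=> P; rewrite cats0 eqxx.
- by move=> P; rewrite cats0 eqxx.
- by move=> t ->; rewrite !eqxx.
- by move=> t ->; rewrite !eqxx.
- by move=> t ->; rewrite !eqxx.
- by move=> t ->; rewrite !eqxx.
Qed.

Lemma tle_same t s : tle t s -> tsame t s.
Proof.
elim=> {t s}; rewrite /tsame; try by [].
- exact: teq_same.
- by move=> t s r _ [-> -> ->] _ [-> -> ->].
- by move=> t t' s s' _ [/= -> -> ->] _ [-> -> ->].
- by move=> t t' s s' _ [/= -> -> ->] _ [-> -> ->].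
- move=> t t' s s' wt ws _ [wt' dt ct] _ [ws' ds cs].
  have /ttyP[-> -> ->] := tty_mul (introT (ttyP _ _ t) (And3 wt erefl erefl))
                                  (introT (ttyP _ _ s) (And3 ws erefl erefl)).
  rewrite dt ds ct cs; rewrite wt in wt'; rewrite ws in ws'.
  by have /ttyP[-> -> ->] :=
    tty_mul (introT (ttyP _ _ t') (And3 (esym wt') erefl erefl))
            (introT (ttyP _ _ s') (And3 (esym ws') erefl erefl)).
- by move=> f g /cle_same[/= -> -> ->].
- by move=> U; rewrite /= eqxx.
- by move=> U; rewrite /= eqxx.
- by move=> U; rewrite /= eqxx.
Qed.

Record thom (P Q : poly) : Type := THom { tval :> tape; thomP : tty P Q tval }.

Definition tid P : thom P P := THom (tty_id (erefl P)).

(* The identity, typed along a (strictness) equation between polynomials. *)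
Definition tcast P Q (e : P = Q) : thom P Q := THom (tty_id e).

(* The quotient by ≤ ∩ ≥ is the choice of [heq]. *)
Definition TCB_cat : poset_cat_data := {|
  ob := poly;
  hom := thom;
  heq := fun P Q (t s : thom P Q) => tle t s /\ tle s t;
  hle := fun P Q (t s : thom P Q) => tle t s;
  idm := tid;
  hcomp := fun P Q R (t : thom P Q) (s : thom Q R) =>
    THom (tty_comp (thomP t) (thomP s))
|}.

Definition thom_sym P Q : thom (P ++ Q) (Q ++ P) :=
  THom (introT (ttyP _ _ (TSym P Q)) (And3 isT erefl erefl)).

Definition TCB_add : monoidal_data TCB_cat :=
  @MonoidalData TCB_cat
    (fun P Q : poly => P ++ Q)
    ([::] : poly)
    (fun _ _ _ _ t s => THom (tty_sum (thomP t) (thomP s)))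
    (fun P Q R => tcast (esym (catA P Q R)))
    (fun P Q R => tcast (catA P Q R))
    (fun P => tcast (cat0s P))
    (fun P => tcast (esym (cat0s P)))
    (fun P => tcast (cats0 P))
    (fun P => tcast (esym (cats0 P)))
    thom_sym.

Definition TCB_mul : monoidal_data TCB_cat :=
  @MonoidalData TCB_cat
    pmul
    ([:: 0] : poly)
    (fun _ _ _ _ t s => THom (tty_mul (thomP t) (thomP s)))
    (fun P Q R => tcast (pmulA P Q R))
    (fun P Q R => tcast (esym (pmulA P Q R)))
    (fun P => tcast (pmulI1 P))
    (fun P => tcast (esym (pmulI1 P)))
    (fun P => tcast (pmulI2 P))
    (fun P => tcast (esym (pmulI2 P)))
    (fun P Q => THom (tty_symt P Q)).

Definition TCB_rig : rig_data :=
  @RigData TCB_cat TCB_add TCB_mul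
    (fun P Q R => THom (tty_dl P Q R))
    (fun P Q R => THom (tty_dli P Q R))
    (fun P Q R => tcast (pmulDl P Q R))
    (fun P Q R => tcast (esym (pmulDl P Q R)))
    (fun P => tid [::])
    (fun P => tid [::])
    (fun P => tcast (pmul0r P))
    (fun P => tcast (esym (pmul0r P))).

Definition TCB_fb_ops : bimonoid_data TCB_add :=
  @BimonoidData TCB_cat TCB_add
    (fun P => THom (introT (ttyP _ _ (TCopy P)) (And3 isT erefl erefl)))
    (fun P => THom (introT (ttyP _ _ (TDisc P)) (And3 isT erefl erefl)))
    (fun P => THom (introT (ttyP _ _ (TMerge P)) (And3 isT erefl erefl)))
    (fun P => THom (introT (ttyP _ _ (TUnit P)) (And3 isT erefl erefl))).

Definition TCB_cb_ops : bimonoid_data TCB_mul :=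
  @BimonoidData TCB_cat TCB_mul
    (fun P => THom (tty_ccopy P))
    (fun P => THom (tty_cdisc P))
    (fun P => THom (tty_cmerge P))
    (fun P => THom (tty_cunit P)).

Definition TCB : fbcb_data := @FbcbData TCB_rig TCB_fb_ops TCB_cb_ops.

End Circuits.

(* Main.v *)
(** A tape is a matrix whose [(i, j)] entry is a finite sum of circuits.  In the
    order of T_CB these sums are joins, since zero arrows are least and addition
    is idempotent.  Consequently [t ≤ s] as soon as every circuit in an entry of
    [t] lies below some circuit in the same entry of [s] ([den_le]), and all
    laws can be checked entrywise: ⊗ is the Kronecker product, the structural
    isomorphisms are permutation matrices whose entries are identities or
    symmetries of circuits, and the ⊗-(co)monoids are supported on the diagonal,
    where the laws are those of CB_Σ. *)

From Stdlib Require Import Setoid Morphisms.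
From mathcomp Require Import all_boot zify.
Require Import Defs.
Set Implicit Arguments.
Unset Strict Implicit.
Unset Printing Implicit Defensive.

Local Notation "f ;ᶜ g" := (CComp f g) (at level 50, left associativity).
Local Notation "f ⊗ᶜ g" := (CTens f g) (at level 40, left associativity).
Local Notation "t ;ᵗ s" := (TComp t s) (at level 50, left associativity).
Local Notation "t ⊕ᵗ s" := (TSum t s) (at level 43, right associativity).

Section Tapes.
Variable S : signature.
Local Notation circ := (circ S).
Local Notation tape := (tape S).
Local Notation CId := (@CId S).
Local Notation CSym := (@CSym S).
Local Notation TId := (@TId S).
Local Notation TSym := (@TSym S).
Local Notation TCopy := (@TCopy S).
Local Notation TDisc := (@TDisc S).
Local Notation TMerge := (@TMerge S).
Local Notation TUnit := (@TUnit S).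
Implicit Types (f g h : circ) (t s r u v : tape) (P Q R : poly).

(** The matrix is read off raw syntax by [ent]. Two facts tie it to the order: each summand, placed
    as an elementary matrix, lies below the tape ([elem_le]), and the tape lies below every common
    upper bound of these ([ent_elim]). Both rest on [Δ;∇ ≤ id] and [!;i ≤ id]. The obstacle is
    strictness: [tmul] composes whiskerings conjugated by distributors, and the associators and
    unitors of ⊗ are identities along equations of polynomials that are not definitional. Entries
    are therefore indexed by natural numbers, with pairs in row-major order; such a cast is then an
    identity matrix, and its laws become equations between indices. Most structural arrows have a
    single entry per row, so a composite is computed by following an index ([row], [rids]). The
    ⊗-merge has zero rows off the diagonal, while [TCopy] and [tcunit] have several entries in a row
    and are handled through [den]. *)

Definition ceqv f g := cle f g /\ cle g f.
Local Infix "≡" := ceqv (at level 70, no associativity).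
Local Infix "≼" := (@cle S) (at level 70, no associativity).

#[export] Instance cle_preorder : PreOrder (@cle S).
Proof.
by split=> [f|f g h]; [apply/cle_ceq/ceq_refl | apply: cle_trans].
Qed.

#[export] Instance cle_rewrite : RewriteRelation (@cle S) := {}.

#[export] Instance ceqv_equiv : Equivalence ceqv.
Proof.
split=> [f|f g []|f g h [fg gf] [gh hg]] //; first by split; reflexivity.
by split; [transitivity g | transitivity g].
Qed.

#[export] Instance CComp_ceqv : Proper (ceqv ==> ceqv ==> ceqv) (@CComp S).
Proof. by move=> f f' [? ?] g g' [? ?]; split; apply: cle_comp. Qed.

#[export] Instance CTens_ceqv : Proper (ceqv ==> ceqv ==> ceqv) (@CTens S).
Proof. by move=> f f' [? ?] g g' [? ?]; split; apply: cle_tens. Qed.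

#[export] Instance CComp_cle :
  Proper (@cle S ==> @cle S ==> @cle S) (@CComp S).
Proof. by move=> f f' ? g g' ?; apply: cle_comp. Qed.

#[export] Instance CTens_cle :
  Proper (@cle S ==> @cle S ==> @cle S) (@CTens S).
Proof. by move=> f f' ? g g' ?; apply: cle_tens. Qed.

#[export] Instance cle_ceqv : Proper (ceqv ==> ceqv ==> iff) (@cle S).
Proof.
move=> f f' [ff' f'f] g g' [gg' g'g]; split=> h.
  by transitivity f => //; transitivity g.
by transitivity f' => //; transitivity g'.
Qed.

#[local] Hint Extern 0 (_ ≡ _) => reflexivity : core.
#[local] Hint Extern 0 (_ ≼ _) => reflexivity : core.

Lemma ceq_ceqv f g : ceq f g -> f ≡ g.
Proof. by split; apply/cle_ceq => //; apply/ceq_sym. Qed.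

Lemma ax_ceqv f g : cb_ax_eq f g -> f ≡ g.
Proof. by split; [apply: cle_ax_eql | apply: cle_ax_eqr]. Qed.

Lemma cle_cty f g m n : f ≼ g -> cty m n f <-> cty m n g.
Proof. by move/cle_same=> [w d c]; rewrite /cty w d c. Qed.

Lemma cty_sym m n : cty (m + n) (n + m) (CSym m n).
Proof. by []. Qed.

Lemma cty_comp m n p f g : cty m n f -> cty n p g -> cty m p (f ;ᶜ g).
Proof.
by move=> [wf df cf] [wg dg cg]; split=> //=; rewrite wf wg cf dg /=.
Qed.

(** * Symmetric monoidal calculus of circuits and coherence of the word (co)monoids *)

Lemma ccompA f g h : f ;ᶜ (g ;ᶜ h) ≡ (f ;ᶜ g) ;ᶜ h.
Proof. exact/ceq_ceqv/ceq_compA. Qed.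

Lemma ctensA f g h : (f ⊗ᶜ g) ⊗ᶜ h ≡ f ⊗ᶜ (g ⊗ᶜ h).
Proof. exact/ceq_ceqv/ceq_tensA. Qed.

Lemma ccomp1l m f : cdom f = m -> CId m ;ᶜ f ≡ f.
Proof. by move=> <-; apply/ceq_ceqv/ceq_idl. Qed.

Lemma ccomp1r n f : ccod f = n -> f ;ᶜ CId n ≡ f.
Proof. by move=> <-; apply/ceq_ceqv/ceq_idr. Qed.

Lemma tens0l f : CId 0 ⊗ᶜ f ≡ f.
Proof. exact/ceq_ceqv/ceq_tens1l. Qed.

Lemma tens0r f : f ⊗ᶜ CId 0 ≡ f.
Proof. exact/ceq_ceqv/ceq_tens1r. Qed.

Lemma ctens_id m n : CId m ⊗ᶜ CId n ≡ CId (m + n).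
Proof. exact/ceq_ceqv/ceq_tens_id. Qed.

Lemma ctens_comp f g f' g' : ccod f = cdom g -> ccod f' = cdom g' ->
  (f ;ᶜ g) ⊗ᶜ (f' ;ᶜ g') ≡ (f ⊗ᶜ f') ;ᶜ (g ⊗ᶜ g').
Proof. by move=> *; apply/ceq_ceqv/ceq_tens_comp. Qed.

Lemma csym_nat m n p q f g : cty m n f -> cty p q g ->
  (f ⊗ᶜ g) ;ᶜ CSym n q ≡ CSym m p ;ᶜ (g ⊗ᶜ f).
Proof. by move=> [_ <- <-] [_ <- <-]; apply/ceq_ceqv/ceq_sym_nat. Qed.

Lemma csymK m n : CSym m n ;ᶜ CSym n m ≡ CId (m + n).
Proof. exact/ceq_ceqv/ceq_symK. Qed.

Lemma csym_addr m n p :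
  CSym m (n + p) ≡ (CSym m n ⊗ᶜ CId p) ;ᶜ (CId n ⊗ᶜ CSym m p).
Proof. exact/ceq_ceqv/ceq_hexagon. Qed.

Lemma tens_idl_comp n f g : ccod f = cdom g ->
  CId n ⊗ᶜ (f ;ᶜ g) ≡ (CId n ⊗ᶜ f) ;ᶜ (CId n ⊗ᶜ g).
Proof. by move=> fg; rewrite -ctens_comp // ccomp1l. Qed.

Lemma tens_idr_comp n f g : ccod f = cdom g ->
  (f ;ᶜ g) ⊗ᶜ CId n ≡ (f ⊗ᶜ CId n) ;ᶜ (g ⊗ᶜ CId n).
Proof. by move=> fg; rewrite -ctens_comp // ccomp1l. Qed.

Lemma tens_rl f g : (CId (cdom f) ⊗ᶜ g) ;ᶜ (f ⊗ᶜ CId (ccod g)) ≡ f ⊗ᶜ g.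
Proof. by rewrite -ctens_comp // ccomp1l // ccomp1r. Qed.

(** The hexagon at two empty words makes [CSym m 0] idempotent; being invertible by [csymK], it is
    the identity. *)
Lemma csym0r m : CSym m 0 ≡ CId m.
Proof.
have idem : CSym m 0 ≡ CSym m 0 ;ᶜ CSym m 0.
  by have := csym_addr m 0 0; rewrite tens0r tens0l.
have inv : CSym m 0 ;ᶜ CSym 0 m ≡ CId m by rewrite csymK addn0.
have : CSym m 0 ;ᶜ (CSym m 0 ;ᶜ CSym 0 m) ≡ CId m by rewrite ccompA -idem.
by rewrite inv ccomp1r //= addn0.
Qed.

Lemma csym0l m : CSym 0 m ≡ CId m.
Proof.
by have := csymK m 0; rewrite csym0r ccomp1l // addn0.
Qed.

(** The generators of [ceq] contain the other hexagon. The right-hand side is a right inverse of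
    [CSym p (m + n)], whose two-sided inverse is the left-hand side, so the two agree. *)
Lemma csym_addl m n p :
  CSym (m + n) p ≡ (CId m ⊗ᶜ CSym n p) ;ᶜ (CSym m p ⊗ᶜ CId n).
Proof.
set r := (X in _ ≡ X).
have inv : CSym p (m + n) ;ᶜ r ≡ CId (p + (m + n)).
  rewrite csym_addr /r ccompA -(ccompA (_ ⊗ᶜ _)) -tens_idl_comp //.
  rewrite csymK ctens_id ccomp1r; last by rewrite /=; lia.
  by rewrite -tens_idr_comp // csymK ctens_id addnA.
rewrite -(ccomp1r (f := CSym _ _) (n := p + (m + n))) // -inv ccompA csymK
  ccomp1l //=.
by lia.
Qed.

Lemma tens_compl f g h : ccod g = cdom h ->
  f ⊗ᶜ (g ;ᶜ h) ≡ (f ⊗ᶜ g) ;ᶜ (CId (ccod f) ⊗ᶜ h).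
Proof. by move=> gh; rewrite -ctens_comp // ccomp1r. Qed.

Lemma tens_compr f g h : ccod g = cdom h ->
  (g ;ᶜ h) ⊗ᶜ f ≡ (g ⊗ᶜ f) ;ᶜ (h ⊗ᶜ CId (ccod f)).
Proof. by move=> gh; rewrite -ctens_comp // ccomp1r. Qed.

Lemma comp_tensl f g h : ccod g = cdom h ->
  f ⊗ᶜ (g ;ᶜ h) ≡ (CId (cdom f) ⊗ᶜ g) ;ᶜ (f ⊗ᶜ h).
Proof. by move=> gh; rewrite -ctens_comp // ccomp1l. Qed.

Lemma comp_tensr f g h : ccod g = cdom h ->
  (g ;ᶜ h) ⊗ᶜ f ≡ (g ⊗ᶜ CId (cdom f)) ;ᶜ (h ⊗ᶜ f).
Proof. by move=> gh; rewrite -ctens_comp // ccomp1l. Qed.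

Lemma tens_idr2 f m n : f ⊗ᶜ CId m ⊗ᶜ CId n ≡ f ⊗ᶜ CId (m + n).
Proof. by rewrite ctensA ctens_id. Qed.

Definition whisk (p : nat) f (q : nat) := CId p ⊗ᶜ f ⊗ᶜ CId q.

(** Bifunctoriality for two boxes separated by [r] wires: they slide past each other. The widths of
    the identities are variables constrained by equations, so that sums bracketed differently at the
    point of use are matched by arithmetic. *)
Lemma whisk_exchange (r m n m' n' p q a b c d : nat) f g :
    cty m n f -> cty m' n' g ->
    a = r + m' + q -> b = p + n + r -> c = p + m + r -> d = r + n' + q ->
  whisk p f a ;ᶜ whisk b g q ≡ whisk c g q ;ᶜ whisk p f d.
Proof.
move=> [_ df cf] [_ dg cg] -> -> -> ->; rewrite /whisk -!ctens_id.
rewrite (ctensA _ (CId r)) -!(ctensA _ _ (CId q)) -!(ctensA _ (CId r)).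
rewrite -!tens_idr_comp //=; try lia.
apply: CTens_ceqv => //.
rewrite -!ctens_comp //= ?ccomp1l //=; try lia.
by rewrite !ccomp1r.
Qed.

(** [ccopy] peels off one wire at a time, whereas coherence splits a word anywhere. Once the
    symmetries are split by both hexagons, the two sides differ only in the order of two disjoint
    symmetries. *)
Lemma ccopy_add m n :
  ccopy S (m + n)
  ≡ (ccopy S m ⊗ᶜ ccopy S n) ;ᶜ (CId m ⊗ᶜ CSym m n ⊗ᶜ CId n).
Proof.
have dc k := cty_copy S k.
elim: m => [|m IH] /=.
  by rewrite !tens0l csym0l ctens_id ccomp1r //; case: (dc n).
have [w1 d1 c1] := dc m; have [w2 d2 c2] := dc n.
rewrite IH csym_addr -[m.+1]/(1 + m) csym_addl.
rewrite tens_compl /= ?c1 ?c2; last lia.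
rewrite tens_compr /= ?c1 ?c2; last lia.
rewrite -!ccompA !ctensA; apply: CComp_ceqv => //.
rewrite !(tens_idl_comp, tens_idr_comp) //=; try lia.
rewrite -!ctensA !ctens_id !tens_idr2.
rewrite !ccompA; apply: CComp_ceqv => //.
(* The two symmetries act on adjacent blocks of wires, hence the gap 0. *)
by symmetry;
  apply: (@whisk_exchange 0 _ _ _ _ _ _ _ _ _ _ _ _ (cty_sym 1 m)
    (cty_sym m n)); lia.
Qed.

Lemma cmerge_add m n :
  cmerge S (m + n)
  ≡ (CId m ⊗ᶜ CSym n m ⊗ᶜ CId n) ;ᶜ (cmerge S m ⊗ᶜ cmerge S n).
Proof.
have dc k := cty_merge S k.
elim: m => [|m IH] /=.
  by rewrite !tens0l csym0r ctens_id ccomp1l //; case: (dc n).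
have [w1 d1 c1] := dc m; have [w2 d2 c2] := dc n.
rewrite IH csym_addl -[m.+1]/(1 + m) csym_addr.
rewrite (comp_tensl (CGen _)) /= ?d1 ?d2; last lia.
rewrite (comp_tensr (cmerge S n)) /= ?d1 ?d2; last lia.
rewrite !ccompA !ctensA; apply: CComp_ceqv => //.
rewrite !(tens_idl_comp, tens_idr_comp) //=; try lia.
rewrite -!ctensA !ctens_id !tens_idr2.
rewrite -!ccompA; apply: CComp_ceqv => //.
by apply: (@whisk_exchange 0 _ _ _ _ _ _ _ _ _ _ _ _ (cty_sym m 1)
  (cty_sym n m)); lia.
Qed.

Lemma cdisc_add m n : cdisc S (m + n) ≡ cdisc S m ⊗ᶜ cdisc S n.
Proof. by elim: m => [|m IH] /=; rewrite ?tens0l // IH ctensA. Qed.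

Lemma cunit_add m n : cunit S (m + n) ≡ cunit S m ⊗ᶜ cunit S n.
Proof. by elim: m => [|m IH] /=; rewrite ?tens0l // IH ctensA. Qed.

(** * Joins and biproducts of tapes *)

Definition teqv t s := tle t s /\ tle s t.
Local Infix "≃" := teqv (at level 70, no associativity).
Local Infix "≤" := (@tle S) (at level 70, no associativity).

#[export] Instance tle_preorder : PreOrder (@tle S).
Proof.
by split=> [t|t s r]; [apply/tle_teq/teq_refl | apply: tle_trans].
Qed.

#[export] Instance tle_rewrite : RewriteRelation (@tle S) := {}.

#[export] Instance teqv_equiv : Equivalence teqv.
Proof.
split=> [t|t s []|t s r [ts st] [sr rs]] //; first by split; reflexivity.
by split; [transitivity s | transitivity s].
Qed.

#[export] Instance TComp_teqv : Proper (teqv ==> teqv ==> teqv) (@TComp S).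
Proof. by move=> t t' [? ?] s s' [? ?]; split; apply: tle_comp. Qed.

#[export] Instance TSum_teqv : Proper (teqv ==> teqv ==> teqv) (@TSum S).
Proof. by move=> t t' [? ?] s s' [? ?]; split; apply: tle_sum. Qed.

#[export] Instance TComp_tle :
  Proper (@tle S ==> @tle S ==> @tle S) (@TComp S).
Proof. by move=> t t' ? s s' ?; apply: tle_comp. Qed.

#[export] Instance TSum_tle :
  Proper (@tle S ==> @tle S ==> @tle S) (@TSum S).
Proof. by move=> t t' ? s s' ?; apply: tle_sum. Qed.

#[export] Instance tle_teqv : Proper (teqv ==> teqv ==> iff) (@tle S).
Proof.
move=> t t' [tt' t't] s s' [ss' s's]; split=> h.
  by transitivity t => //; transitivity s.
by transitivity t' => //; transitivity s'.
Qed.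

#[local] Hint Extern 0 (_ ≃ _) => reflexivity : core.
#[local] Hint Extern 0 (_ ≤ _) => reflexivity : core.

Lemma teq_teqv t s : teq t s -> t ≃ s.
Proof. by split; apply/tle_teq => //; apply/teq_sym. Qed.

Lemma tcompA t s r : t ;ᵗ (s ;ᵗ r) ≃ (t ;ᵗ s) ;ᵗ r.
Proof. exact/teq_teqv/teq_compA. Qed.

Lemma tsumA t s r : (t ⊕ᵗ s) ⊕ᵗ r ≃ t ⊕ᵗ (s ⊕ᵗ r).
Proof. exact/teq_teqv/teq_sumA. Qed.

Lemma tcomp1l P t : tdom t = P -> TId P ;ᵗ t ≃ t.
Proof. by move=> <-; apply/teq_teqv/teq_idl. Qed.

Lemma tcomp1r P t : tcod t = P -> t ;ᵗ TId P ≃ t.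
Proof. by move=> <-; apply/teq_teqv/teq_idr. Qed.

Lemma tsum0l t : TId [::] ⊕ᵗ t ≃ t.
Proof. exact/teq_teqv/teq_sum0l. Qed.

Lemma tsum0r t : t ⊕ᵗ TId [::] ≃ t.
Proof. exact/teq_teqv/teq_sum0r. Qed.

Lemma tsum_id P Q : TId P ⊕ᵗ TId Q ≃ TId (P ++ Q).
Proof. exact/teq_teqv/teq_sum_id. Qed.

Lemma tsum_comp t s t' s' : tcod t = tdom s -> tcod t' = tdom s' ->
  (t ;ᵗ s) ⊕ᵗ (t' ;ᵗ s') ≃ (t ⊕ᵗ t') ;ᵗ (s ⊕ᵗ s').
Proof. by move=> *; apply/teq_teqv/teq_sum_comp. Qed.

Lemma tsym_nat P Q t s : tcod t = P -> tcod s = Q ->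
  (t ⊕ᵗ s) ;ᵗ TSym P Q ≃ TSym (tdom t) (tdom s) ;ᵗ (s ⊕ᵗ t).
Proof. by move=> <- <-; apply/teq_teqv/teq_sym_nat. Qed.

Lemma tsymK P Q : TSym P Q ;ᵗ TSym Q P ≃ TId (P ++ Q).
Proof. exact/teq_teqv/teq_symK. Qed.

Lemma thexagon P Q R :
  TSym P (Q ++ R) ≃ (TSym P Q ⊕ᵗ TId R) ;ᵗ (TId Q ⊕ᵗ TSym P R).
Proof. exact/teq_teqv/teq_hexagon. Qed.

Lemma tsym0r P : TSym P [::] ≃ TId P.
Proof.
have idem : TSym P [::] ≃ TSym P [::] ;ᵗ TSym P [::].
  by have := thexagon P [::] [::]; rewrite tsum0r tsum0l.
have inv : TSym P [::] ;ᵗ TSym [::] P ≃ TId P by rewrite tsymK cats0.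
have : TSym P [::] ;ᵗ (TSym P [::] ;ᵗ TSym [::] P) ≃ TId P.
  by rewrite tcompA -idem.
by rewrite inv tcomp1r.
Qed.

Lemma tsym0l P : TSym [::] P ≃ TId P.
Proof. by have := tsymK P [::]; rewrite tsym0r tcomp1l ?cats0. Qed.

Lemma tcopy_nat P Q t : tty P Q t -> t ;ᵗ TCopy Q ≃ TCopy P ;ᵗ (t ⊕ᵗ t).
Proof. by case/ttyP=> w <- <-; apply/teq_teqv/teq_copy_nat. Qed.

Lemma tdisc_nat P Q t : tty P Q t -> t ;ᵗ TDisc Q ≃ TDisc P.
Proof. by case/ttyP=> w <- <-; apply/teq_teqv/teq_disc_nat. Qed.

Lemma tmerge_nat P Q t : tty P Q t -> TMerge P ;ᵗ t ≃ (t ⊕ᵗ t) ;ᵗ TMerge Q.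
Proof. by case/ttyP=> w <- <-; apply/teq_teqv/teq_merge_nat. Qed.

Lemma tunit_nat P Q t : tty P Q t -> TUnit P ;ᵗ t ≃ TUnit Q.
Proof. by case/ttyP=> w <- <-; apply/teq_teqv/teq_unit_nat. Qed.

Lemma tunit_disc P : TUnit P ;ᵗ TDisc P ≃ TId [::].
Proof.
rewrite (@tunit_nat _ [::] (TDisc P)); first exact/teq_teqv/teq_unit0.
exact/ttyP.
Qed.

Lemma tdiscD P Q : TDisc (P ++ Q) ≃ TDisc P ⊕ᵗ TDisc Q.
Proof. exact/teq_teqv/teq_discD. Qed.

Lemma tunitD P Q : TUnit (P ++ Q) ≃ TUnit P ⊕ᵗ TUnit Q.
Proof. exact/teq_teqv/teq_unitD. Qed.

Lemma tdisc0 : TDisc [::] ≃ TId [::].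
Proof. exact/teq_teqv/teq_disc0. Qed.

Lemma tunit0 : TUnit [::] ≃ TId [::].
Proof. exact/teq_teqv/teq_unit0. Qed.

Lemma tcopyD P Q : TCopy (P ++ Q)
  ≃ (TCopy P ⊕ᵗ TCopy Q) ;ᵗ (TId P ⊕ᵗ TSym P Q ⊕ᵗ TId Q).
Proof. exact/teq_teqv/teq_copyD. Qed.

Lemma tmergeD P Q : TMerge (P ++ Q)
  ≃ (TId P ⊕ᵗ TSym Q P ⊕ᵗ TId Q) ;ᵗ (TMerge P ⊕ᵗ TMerge Q).
Proof. exact/teq_teqv/teq_mergeD. Qed.

Lemma tlift_comp f g : TLift (f ;ᶜ g) ≃ TLift f ;ᵗ TLift g.
Proof. exact/teq_teqv/teq_lift_comp. Qed.

Lemma tlift_id n : TLift (CId n) ≃ TId [:: n].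
Proof. exact/teq_teqv/teq_lift_id. Qed.

(** The order has this axiom at monomials; as [TDisc] and [TUnit] split over ⊕, induction spreads it
    to polynomials. *)
Lemma tdisc_unit_le P : TDisc P ;ᵗ TUnit P ≤ TId P.
Proof.
elim: P => [|U P IH]; first by rewrite tdisc0 tunit0 tcomp1l.
rewrite -[U :: P]/([:: U] ++ P) tdiscD tunitD -tsum_comp // -tsum_id.
by apply: tle_sum => //; apply: tle_disc_unit.
Qed.

Lemma tcopy_merge_le P : TCopy P ;ᵗ TMerge P ≤ TId P.
Proof.
elim: P => [|U P IH].
  by rewrite (teq_teqv (teq_copy0 _)) (teq_teqv (teq_merge0 _)) tcomp1l.
rewrite -[U :: P]/([:: U] ++ P) tcopyD tmergeD.
rewrite -tcompA (tcompA (_ ⊕ᵗ _ ⊕ᵗ _)).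
(* The shuffle that ends the copy and the one that starts the merge are mutually inverse. *)
have -> : (TId [:: U] ⊕ᵗ TSym [:: U] P ⊕ᵗ TId P)
    ;ᵗ (TId [:: U] ⊕ᵗ TSym P [:: U] ⊕ᵗ TId P) ≃ TId ([:: U; U] ++ (P ++ P)).
  by rewrite -!tsum_comp //= tsymK !tcomp1l // !tsum_id.
rewrite tcomp1l // -tsum_comp // -(tsum_id [:: U]).
by apply: tle_sum => //; apply: tle_copy_merge.
Qed.

(** Naturality of the unit turns [TUnit Q] into [TUnit P ;ᵗ t], and the leading [TDisc P ;ᵗ TUnit P]
    is below the identity. Zero arrows are thus the empty joins. *)
Lemma zero_le P Q t : tty P Q t -> TDisc P ;ᵗ TUnit Q ≤ t.
Proof.
move=> ty; rewrite -(tunit_nat ty) tcompA tdisc_unit_le tcomp1l //.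
by case/ttyP: ty.
Qed.

Lemma tcopy_proj1 P : TCopy P ;ᵗ (TId P ⊕ᵗ TDisc P) ≃ TId P.
Proof. exact/teq_teqv/teq_copy_discr. Qed.

Lemma tcopy_proj2 P : TCopy P ;ᵗ (TDisc P ⊕ᵗ TId P) ≃ TId P.
Proof. exact/teq_teqv/teq_copy_discl. Qed.

Lemma tmerge_inj1 P : (TId P ⊕ᵗ TUnit P) ;ᵗ TMerge P ≃ TId P.
Proof. exact/teq_teqv/teq_merge_unitr. Qed.

Lemma tmerge_inj2 P : (TUnit P ⊕ᵗ TId P) ;ᵗ TMerge P ≃ TId P.
Proof. exact/teq_teqv/teq_merge_unitl. Qed.

Lemma tcopy_proj P Q :
  TCopy (P ++ Q) ;ᵗ ((TId P ⊕ᵗ TDisc Q) ⊕ᵗ (TDisc P ⊕ᵗ TId Q)) ≃ TId (P ++ Q).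
Proof.
have mid : (TId P ⊕ᵗ TSym P Q ⊕ᵗ TId Q)
    ;ᵗ ((TId P ⊕ᵗ TDisc Q) ⊕ᵗ (TDisc P ⊕ᵗ TId Q))
    ≃ (TId P ⊕ᵗ TDisc P) ⊕ᵗ (TDisc Q ⊕ᵗ TId Q).
  (* Two discards absorb the symmetry in front of them. *)
  have sw := @tsym_nat [::] [::] (TDisc P) (TDisc Q) erefl erefl.
  rewrite /= tsym0r tcomp1r // in sw.
  by rewrite !tsumA -!(tsumA (TDisc _)) -!tsum_comp //= -sw !tcomp1l.
rewrite tcopyD -tcompA mid -tsum_comp //.
by rewrite tcopy_proj1 tcopy_proj2 tsum_id.
Qed.

Lemma tinj_merge P Q :
  ((TId P ⊕ᵗ TUnit Q) ⊕ᵗ (TUnit P ⊕ᵗ TId Q)) ;ᵗ TMerge (P ++ Q) ≃ TId (P ++ Q).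
Proof.
have mid : ((TId P ⊕ᵗ TUnit Q) ⊕ᵗ (TUnit P ⊕ᵗ TId Q))
    ;ᵗ (TId P ⊕ᵗ TSym Q P ⊕ᵗ TId Q)
    ≃ (TId P ⊕ᵗ TUnit P) ⊕ᵗ (TUnit Q ⊕ᵗ TId Q).
  have sw := @tsym_nat _ _ (TUnit Q) (TUnit P) erefl erefl.
  rewrite /= tsym0r tcomp1l // in sw.
  by rewrite !tsumA -!(tsumA (TUnit _)) -!tsum_comp //= sw !tcomp1l.
rewrite tmergeD tcompA mid -tsum_comp //.
by rewrite tmerge_inj1 tmerge_inj2 tsum_id.
Qed.

(* By [Δ;∇ ≤ id], the sum of two parallel arrows is their join. *)
Lemma tle_join P Q t s r : tty P Q r -> t ≤ r -> s ≤ r ->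
  TCopy P ;ᵗ ((t ⊕ᵗ s) ;ᵗ TMerge Q) ≤ r.
Proof.
move=> ty tr sr;
  rewrite tr sr -(tmerge_nat ty) tcompA tcopy_merge_le tcomp1l //.
by case/ttyP: ty.
Qed.

(** Naturality of [TCopy] and [TMerge] distributes the contexts [u] and [v] over the sum, so
    composition preserves joins on both sides. *)
Lemma tle_join_ctx X Y P Q u v t s r :
    tty X P u -> tty Q Y v -> tty P Q t -> tty P Q s -> tty X Y r ->
    u ;ᵗ (t ;ᵗ v) ≤ r -> u ;ᵗ (s ;ᵗ v) ≤ r ->
  u ;ᵗ ((TCopy P ;ᵗ ((t ⊕ᵗ s) ;ᵗ TMerge Q)) ;ᵗ v) ≤ r.
Proof.
move=> yu yv /ttyP[_ dt ct] /ttyP[_ ds cs] yr h1 h2.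
have -> : u ;ᵗ ((TCopy P ;ᵗ ((t ⊕ᵗ s) ;ᵗ TMerge Q)) ;ᵗ v)
    ≃ TCopy X ;ᵗ (((u ;ᵗ (t ;ᵗ v)) ⊕ᵗ (u ;ᵗ (s ;ᵗ v))) ;ᵗ TMerge Y).
  case/ttyP: (yu) => _ _ cu; case/ttyP: (yv) => _ dv _.
  rewrite -!tcompA (tmerge_nat yv) !tcompA (tcopy_nat yu).
  rewrite tsum_comp /= ?ct ?cs ?dv // tsum_comp /= ?cu ?dt ?ds //.
  by rewrite !tcompA.
exact: tle_join.
Qed.

Definition tproj1 P Q := TId P ⊕ᵗ TDisc Q.
Definition tproj2 P Q := TDisc P ⊕ᵗ TId Q.
Definition tinj1 P Q := TId P ⊕ᵗ TUnit Q.
Definition tinj2 P Q := TUnit P ⊕ᵗ TId Q.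

Lemma tty_proj1 P Q : tty (P ++ Q) P (tproj1 P Q).
Proof. by apply/ttyP; rewrite /= cats0. Qed.

Lemma tty_proj2 P Q : tty (P ++ Q) Q (tproj2 P Q).
Proof. by apply/ttyP. Qed.

Lemma tty_inj1 P Q : tty P (P ++ Q) (tinj1 P Q).
Proof. by apply/ttyP; rewrite /= cats0. Qed.

Lemma tty_inj2 P Q : tty Q (P ++ Q) (tinj2 P Q).
Proof. by apply/ttyP. Qed.

(** A direct sum is the sum of its two diagonal blocks. This form exhibits ⊕ as a join of parallel
    arrows, to which [tle_join_ctx] applies. *)
Lemma tsum_proj_inj P Q P' Q' t s : tty P Q t -> tty P' Q' s ->
  t ⊕ᵗ s ≃ TCopy (P ++ P')
    ;ᵗ (((tproj1 P P' ;ᵗ (t ;ᵗ tinj1 Q Q'))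
      ⊕ᵗ (tproj2 P P' ;ᵗ (s ;ᵗ tinj2 Q Q')))
        ;ᵗ TMerge (Q ++ Q')).
Proof.
move=> /ttyP[_ dt ct] /ttyP[_ ds cs].
rewrite tsum_comp /= ?cats0 // tsum_comp /= ?cats0 // -tcompA -tcompA
  tinj_merge.
by rewrite tcompA tcopy_proj tcomp1l ?tcomp1r /= ?dt ?ds ?ct ?cs.
Qed.

Lemma tle_sum_elim X Y P Q P' Q' u v t s r :
    tty X (P ++ P') u -> tty (Q ++ Q') Y v -> tty P Q t -> tty P' Q' s ->
    tty X Y r ->
    (u ;ᵗ tproj1 P P') ;ᵗ (t ;ᵗ (tinj1 Q Q' ;ᵗ v)) ≤ r ->
    (u ;ᵗ tproj2 P P') ;ᵗ (s ;ᵗ (tinj2 Q Q' ;ᵗ v)) ≤ r ->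
  u ;ᵗ ((t ⊕ᵗ s) ;ᵗ v) ≤ r.
Proof.
move=> yu yv yt ys yr h1 h2; rewrite (tsum_proj_inj yt ys).
apply: (tle_join_ctx yu yv) yr _ _.
- exact: tty_comp (tty_proj1 P P') (tty_comp yt (tty_inj1 Q Q')).
- exact: tty_comp (tty_proj2 P P') (tty_comp ys (tty_inj2 Q Q')).
- by move: h1; rewrite -!tcompA.
- by move: h2; rewrite -!tcompA.
Qed.

(** * Tapes as matrices of circuits *)

Fixpoint tproj P i : tape :=
  match P, i with
  | [::], _ => TId [::]
  | U :: P', 0 => tproj1 [:: U] P'
  | U :: P', i'.+1 => TDisc [:: U] ⊕ᵗ tproj P' i'
  end.

Fixpoint tinj P i : tape :=
  match P, i with
  | [::], _ => TId [::]
  | U :: P', 0 => tinj1 [:: U] P'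
  | U :: P', i'.+1 => TUnit [:: U] ⊕ᵗ tinj P' i'
  end.

Local Notation mon := (nth 0).

Lemma tty_proj P i : i < size P -> tty P [:: mon P i] (tproj P i).
Proof.
elim: P i => [|U P IH] [|i] //= lt; first exact: tty_proj1.
by apply: (@tty_sum _ [:: U] [::]); [apply/ttyP | apply: IH].
Qed.

Lemma tty_inj P i : i < size P -> tty [:: mon P i] P (tinj P i).
Proof.
elim: P i => [|U P IH] [|i] //= lt; first exact: tty_inj1.
by apply: (@tty_sum _ [::] [:: U]); [apply/ttyP | apply: IH].
Qed.

Lemma proj_cat1 P Q i : i < size P ->
  tproj (P ++ Q) i ≃ tproj1 P Q ;ᵗ tproj P i.
Proof.
have split1 U P' : tproj1 (U :: P') Q ≃ TId [:: U] ⊕ᵗ tproj1 P' Q.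
  by rewrite /tproj1 -(tsum_id [:: U]) tsumA.
elim: P i => [|U P IH] [|i] //= lt; rewrite split1.
  rewrite {2}/tproj1 -tsum_comp //= ?cats0 //.
  by rewrite tcomp1l // (tdisc_nat (tty_proj1 P Q)).
rewrite IH // -tsum_comp //= ?tcomp1l //.
by case/ttyP: (tty_proj lt) => _ ->; rewrite cats0.
Qed.

Lemma proj_cat2 P Q i : i < size Q ->
  tproj (P ++ Q) (size P + i) ≃ tproj2 P Q ;ᵗ tproj Q i.
Proof.
move=> lt; case/ttyP: (tty_proj lt) => _ dp _.
elim: P => [|U P IH] /=; first by rewrite /tproj2 tdisc0 tsum0l tcomp1l.
rewrite IH /tproj2 -[U :: P]/([:: U] ++ P) tdiscD tsumA.
rewrite -[X in _ ≃ _ ;ᵗ X]tsum0l -tsum_comp //.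
by rewrite tcomp1r.
Qed.

Lemma inj_cat1 P Q i : i < size P -> tinj (P ++ Q) i ≃ tinj P i ;ᵗ tinj1 P Q.
Proof.
have split1 U P' : tinj1 (U :: P') Q ≃ TId [:: U] ⊕ᵗ tinj1 P' Q.
  by rewrite /tinj1 -(tsum_id [:: U]) tsumA.
elim: P i => [|U P IH] [|i] //= lt; rewrite split1.
  rewrite {2}/tinj1 -tsum_comp //= ?cats0 //.
  by rewrite tcomp1l // (tunit_nat (tty_inj1 P Q)).
rewrite IH // -tsum_comp //= ?tcomp1r //.
by case/ttyP: (tty_inj lt) => _ _ ->; rewrite cats0.
Qed.

Lemma inj_cat2 P Q i : i < size Q ->
  tinj (P ++ Q) (size P + i) ≃ tinj Q i ;ᵗ tinj2 P Q.
Proof.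
move=> lt; case/ttyP: (tty_inj lt) => _ _ ci.
elim: P => [|U P IH] /=; first by rewrite /tinj2 tunit0 tsum0l tcomp1r.
rewrite IH /tinj2 -[U :: P]/([:: U] ++ P) tunitD tsumA.
rewrite -[X in _ ≃ X ;ᵗ _]tsum0l -tsum_comp //.
by rewrite tcomp1l.
Qed.

Lemma inj_proj P i : i < size P -> tinj P i ;ᵗ tproj P i ≃ TId [:: mon P i].
Proof.
elim: P i => [|U P IH] [|i] //= lt.
  rewrite /tproj1 /tinj1 -tsum_comp //= tcomp1l // tunit_disc.
  by rewrite tsum0r.
rewrite -tsum_comp //; last first.
  by case/ttyP: (tty_inj lt) => _ _ ->; case/ttyP: (tty_proj lt) => _ ->.
by rewrite IH // tunit_disc tsum0l.
Qed.

(** Orthogonality of distinct summands: the composite factors through 0, so it is the zero arrow. *)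
Lemma inj_proj_neq P i j : i < size P -> j < size P -> i <> j ->
  tinj P i ;ᵗ tproj P j ≃ TDisc [:: mon P i] ;ᵗ TUnit [:: mon P j].
Proof.
elim: P i j => [|U P IH] [|i] [|j] //= lti ltj ne.
- rewrite /tinj1 -tsum_comp //=; last by case/ttyP: (tty_proj ltj).
  rewrite tcomp1l // (tunit_nat (tty_proj ltj)).
  by rewrite -{2}[TUnit _]tsum0l -{2}[TDisc _]tsum0r -tsum_comp // tcomp1r //
    tcomp1l.
- rewrite /tproj1 -tsum_comp //=; last by case/ttyP: (tty_inj lti).
  rewrite tcomp1r // (tdisc_nat (tty_inj lti)).
  by rewrite -{2}[TUnit _]tsum0r -{2}[TDisc _]tsum0l -tsum_comp // tcomp1r //
    tcomp1l.
- rewrite -tsum_comp //; last first.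
    by case/ttyP: (tty_inj lti) => _ _ ->; case/ttyP: (tty_proj ltj).
  rewrite tunit_disc tsum0l IH //.
  by move=> e; apply: ne; rewrite e.
Qed.

Lemma proj_inj_le P i : i < size P -> tproj P i ;ᵗ tinj P i ≤ TId P.
Proof.
elim: P i => [|U P IH] [|i] //= lt.
  rewrite /tproj1 /tinj1 -tsum_comp // tdisc_unit_le tcomp1l // tsum_id //.
rewrite -tsum_comp //; last first.
  by case/ttyP: (tty_inj lt) => _ -> _; case/ttyP: (tty_proj lt).
by rewrite IH // tdisc_unit_le tsum_id.
Qed.

(* [ent t i j a]: the circuit [a] is a summand of the entry [(i, j)] of the
   matrix of [t]. *)
Fixpoint ent t (i j : nat) (a : circ) : Prop :=
  match t with
  | Defs.TId P => [/\ i < size P, j = i & a = CId (mon P i)]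
  | TLift f => [/\ i = 0, j = 0 & a = f]
  | Defs.TSym P Q =>
      [/\ i < size P, j = size Q + i & a = CId (mon P i)]
      \/ [/\ j < size Q, i = size P + j & a = CId (mon Q j)]
  | Defs.TCopy P => [/\ i < size P, j = i \/ j = size P + i & a = CId (mon P i)]
  | Defs.TDisc _ | Defs.TUnit _ => False
  | Defs.TMerge P => [/\ j < size P,
    i = j \/ i = size P + j & a = CId (mon P j)]
  | TComp t s => exists k b c, [/\ ent t i k b, ent s k j c & a = b ;ᶜ c]
  | TSum t s => ent t i j a \/
      exists i' j', [/\ i = size (tdom t) + i', j = size (tcod t) + j'
                      & ent s i' j' a]
  end.

Lemma mon_cat1 P Q i : i < size P -> mon (P ++ Q) i = mon P i.
Proof. by rewrite nth_cat => ->. Qed.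

Lemma mon_cat2 P Q i : mon (P ++ Q) (size P + i) = mon Q i.
Proof. by rewrite nth_cat ltnNge leq_addr /= addKn. Qed.

Lemma ent_ty P Q t i j a : tty P Q t -> ent t i j a ->
  [/\ i < size P, j < size Q & cty (mon P i) (mon Q j) a].
Proof.
move=> /ttyP[w <- <-] {P Q}.
elim: t i j a w => [P|f|P Q|P|P|P|P|t IHt s IHs|t IHt s IHs] i j a //=.
- by move=> _ [lt -> ->].
- by move=> w [-> -> ->].
- by move=> _ [] [lt -> ->]; rewrite !size_cat ?mon_cat2 ?mon_cat1 //;
    split=> //; lia.
- by move=> _ [lt [] -> ->]; rewrite size_cat ?mon_cat2 ?mon_cat1 //;
    split=> //; lia.
- by move=> _ [lt [] -> ->]; rewrite size_cat ?mon_cat2 ?mon_cat1 //;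
    split=> //; lia.
- case/and3P=> wt ws /eqP e [k [b [c [tb sc ->]]]].
  have [? ? yb] := IHt _ _ _ wt tb; have [? ? yc] := IHs _ _ _ ws sc.
  by split=> //; apply: cty_comp yb _; rewrite e.
- case/andP=> wt ws [tb|[i' [j' [-> -> sb]]]]; rewrite !size_cat.
    have [? ? yb] := IHt _ _ _ wt tb.
    by rewrite !mon_cat1 //; split=> //; lia.
  have [? ? yb] := IHs _ _ _ ws sb.
  by rewrite !mon_cat2; split=> //; lia.
Qed.

(** The elementary matrix with [f] at [(i, j)] and zero arrows elsewhere. *)
Definition elem P Q i j f : tape := tproj P i ;ᵗ (TLift f ;ᵗ tinj Q j).

Lemma elem_mono P Q i j f g : f ≼ g -> elem P Q i j f ≤ elem P Q i j g.
Proof.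
by move=> fg; rewrite /elem; apply/tle_comp/tle_comp => //; apply: tle_lift.
Qed.

Lemma elem_id P i : i < size P -> elem P P i i (CId (mon P i)) ≤ TId P.
Proof.
move=> lt; rewrite /elem tlift_id tcomp1l; last by case/ttyP: (tty_inj lt).
exact: proj_inj_le.
Qed.

Lemma elem_cat1 P Q P' Q' i j f :
    i < size P -> j < size Q -> cty (mon P i) (mon Q j) f ->
  elem (P ++ P') (Q ++ Q') i j f
  ≃ tproj1 P P' ;ᵗ (elem P Q i j f ;ᵗ tinj1 Q Q').
Proof.
by move=> li lj yf; rewrite /elem proj_cat1 // inj_cat1 // !tcompA.
Qed.

Lemma elem_cat2 P Q P' Q' i j f :
    i < size P' -> j < size Q' -> cty (mon P' i) (mon Q' j) f ->
  elem (P ++ P') (Q ++ Q') (size P + i) (size Q + j) f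
  ≃ tproj2 P P' ;ᵗ (elem P' Q' i j f ;ᵗ tinj2 Q Q').
Proof.
by move=> li lj yf; rewrite /elem proj_cat2 // inj_cat2 // !tcompA.
Qed.

Lemma le_sum1 P Q P' Q' t s : tty P Q t -> tty P' Q' s ->
  tproj1 P P' ;ᵗ (t ;ᵗ tinj1 Q Q') ≤ t ⊕ᵗ s.
Proof.
move=> yt ys; case/ttyP: (yt) => _ dt ct.
rewrite /tinj1 -{1}[t]tsum0r -tsum_comp //=.
rewrite -tsum_comp //= tcomp1l // tcomp1r // tcomp1l //.
by apply: tle_sum => //; apply: zero_le.
Qed.

Lemma le_sum2 P Q P' Q' t s : tty P Q t -> tty P' Q' s ->
  tproj2 P P' ;ᵗ (s ;ᵗ tinj2 Q Q') ≤ t ⊕ᵗ s.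
Proof.
move=> yt ys; case/ttyP: (ys) => _ ds cs.
rewrite /tinj2 -{1}[s]tsum0l -tsum_comp //=.
rewrite -tsum_comp //= tcomp1l // tcomp1r // tcomp1l //.
by apply: tle_sum => //; apply: zero_le.
Qed.

(** By the counit law the injection is the copy with its second output discarded and recreated, and
    [!;i ≤ id]. The next three lemmas use the same argument. *)
Lemma inj1_le_copy P : tinj1 P P ≤ TCopy P.
Proof.
rewrite /tinj1 /tinj2 /tproj1 /tproj2;
  apply: (@tle_trans _ _ (TCopy P
    ;ᵗ ((TId P ;ᵗ TId P) ⊕ᵗ (TDisc P ;ᵗ TUnit P)))).
  by rewrite tsum_comp // tcompA tcopy_proj1 tcomp1l //= cats0.
by rewrite tdisc_unit_le tcomp1l // tsum_id tcomp1r.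
Qed.

Lemma inj2_le_copy P : tinj2 P P ≤ TCopy P.
Proof.
rewrite /tinj1 /tinj2 /tproj1 /tproj2;
  apply: (@tle_trans _ _ (TCopy P
    ;ᵗ ((TDisc P ;ᵗ TUnit P) ⊕ᵗ (TId P ;ᵗ TId P)))).
  by rewrite tsum_comp // tcompA tcopy_proj2 tcomp1l.
by rewrite tdisc_unit_le tcomp1l // tsum_id tcomp1r.
Qed.

Lemma proj1_le_merge P : tproj1 P P ≤ TMerge P.
Proof.
rewrite /tinj1 /tinj2 /tproj1 /tproj2;
  apply: (@tle_trans _ _ (((TId P ;ᵗ TId P) ⊕ᵗ (TDisc P ;ᵗ TUnit P))
    ;ᵗ TMerge P)).
  by rewrite tsum_comp // -tcompA tmerge_inj1 tcomp1r //= cats0.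
by rewrite tdisc_unit_le tcomp1l // tsum_id tcomp1l.
Qed.

Lemma proj2_le_merge P : tproj2 P P ≤ TMerge P.
Proof.
rewrite /tinj1 /tinj2 /tproj1 /tproj2;
  apply: (@tle_trans _ _ (((TDisc P ;ᵗ TUnit P) ⊕ᵗ (TId P ;ᵗ TId P))
    ;ᵗ TMerge P)).
  by rewrite tsum_comp // -tcompA tmerge_inj2 tcomp1r.
by rewrite tdisc_unit_le tcomp1l // tsum_id tcomp1l.
Qed.

Lemma inj1_sym P Q : tinj1 P Q ;ᵗ TSym P Q ≃ tinj2 Q P.
Proof. by rewrite tsym_nat //= tsym0r tcomp1l. Qed.

Lemma inj2_sym P Q : tinj2 P Q ;ᵗ TSym P Q ≃ tinj1 Q P.
Proof. by rewrite tsym_nat //= tsym0l tcomp1l //= cats0. Qed.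

Lemma proj1_inj2_le_sym P Q : tproj1 P Q ;ᵗ tinj2 Q P ≤ TSym P Q.
Proof.
rewrite -inj1_sym tcompA -tsum_comp // tcomp1l //.
by rewrite tdisc_unit_le tsum_id tcomp1l.
Qed.

Lemma proj2_inj1_le_sym P Q : tproj2 P Q ;ᵗ tinj1 Q P ≤ TSym P Q.
Proof.
rewrite -inj2_sym tcompA -tsum_comp // tcomp1l //.
by rewrite tdisc_unit_le tsum_id tcomp1l.
Qed.

(** Induction on [t]: outside the chosen entry the tape is replaced by zero arrows, which are least.
    For a composite, the injection and the projection at the middle index cancel. *)
Lemma elem_le t i j f : twf t -> ent t i j f ->
  elem (tdom t) (tcod t) i j f ≤ t.
Proof.
have id_le P i' : i' < size P ->
  tproj P i' ;ᵗ (TLift (CId (mon P i')) ;ᵗ tinj P i') ≤ TId P.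
  by move=> lt; apply: elem_id.
elim: t i j f => [P|f|P Q|P|P|P|P|t IHt s IHs|t IHt s IHs] i j a //=.
- by move=> _ [lt -> ->]; apply: elem_id.
- move=> w [-> -> ->]; rewrite /elem /= /tproj1 /tinj1 tdisc0 tunit0 !tsum0r.
  by rewrite tcomp1r // tcomp1l.
- move=> _ [] [lt -> ->]; rewrite /elem.
    rewrite proj_cat1 // inj_cat2 // -tcompA (tcompA (TLift _))
      (tcompA (tproj _ _)) id_le //.
    by rewrite tcomp1l // proj1_inj2_le_sym.
  rewrite proj_cat2 // inj_cat1 // -tcompA (tcompA (TLift _))
    (tcompA (tproj _ _)) id_le //.
  by rewrite tcomp1l /= ?cats0 // proj2_inj1_le_sym.
- move=> _ [lt [] -> ->]; rewrite /elem.
    rewrite inj_cat1 // (tcompA (TLift _)) (tcompA (tproj _ _)) id_le //.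
    by rewrite tcomp1l /= ?cats0 // inj1_le_copy.
  rewrite inj_cat2 // (tcompA (TLift _)) (tcompA (tproj _ _)) id_le //.
  by rewrite tcomp1l // inj2_le_copy.
- move=> _ [lt [] -> ->]; rewrite /elem.
    rewrite proj_cat1 // -tcompA id_le //.
    by rewrite tcomp1r //= ?cats0 // proj1_le_merge.
  rewrite proj_cat2 // -tcompA id_le //.
  by rewrite tcomp1r //= proj2_le_merge.
- case/and3P=> wt ws /eqP e [k [b [c [tb sc ->]]]].
  have yt : tty (tdom t) (tcod t) t by apply/ttyP.
  have ys : tty (tdom s) (tcod s) s by apply/ttyP.
  have [li lk [wb db cb]] := ent_ty yt tb;
    have [_ lj [wc dc cc]] := ent_ty ys sc.
  rewrite -[X in _ ≤ X ;ᵗ _]IHt; [|done|exact: tb].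
  rewrite -[X in _ ≤ _ ;ᵗ X]IHs; [|done|exact: sc].
  rewrite /elem -!tcompA (tcompA (tinj _ _)) -e inj_proj // tcomp1l /=.
    by rewrite (tcompA (TLift b)) -tlift_comp.
  by rewrite dc e.
- case/andP=> wt ws.
  have yt : tty (tdom t) (tcod t) t by apply/ttyP.
  have ys : tty (tdom s) (tcod s) s by apply/ttyP.
  case=> [tb|[i' [j' [-> -> sb]]]].
    have [li lj ya] := ent_ty yt tb.
    by rewrite elem_cat1 // IHt // le_sum1.
  have [li lj ya] := ent_ty ys sb.
  by rewrite elem_cat2 // IHs // le_sum2.
Qed.

Lemma tty_from0 X u : tty X [::] u -> u ≃ TDisc X.
Proof.
move=> yu; rewrite -(tdisc_nat yu) tdisc0 tcomp1r //.
by case/ttyP: yu.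
Qed.

Lemma tty_to0 Y v : tty [::] Y v -> v ≃ TUnit Y.
Proof.
move=> yv; rewrite -(tunit_nat yv) tunit0 tcomp1l //.
by case/ttyP: yv.
Qed.

(** The identity of [P] is the join of the idempotents [tproj P i ;ᵗ tinj P i]. For empty [P] the
    composite factors through 0 and is the empty join. *)
Lemma id_elim X Y P u v r :
    tty X P u -> tty P Y v -> tty X Y r ->
    (forall i, i < size P -> (u ;ᵗ tproj P i) ;ᵗ (tinj P i ;ᵗ v) ≤ r) ->
  u ;ᵗ v ≤ r.
Proof.
elim: P u v => [|U P IH] u v yu yv yr le_r.
  by rewrite (tty_from0 yu) (tty_to0 yv); apply: zero_le.
have -> : u ;ᵗ v ≃ u ;ᵗ ((TId [:: U] ⊕ᵗ TId P) ;ᵗ v).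
  by rewrite tsum_id tcomp1l //; case/ttyP: yv.
have yid R : tty R R (TId R) by apply: tty_id.
apply: (@tle_sum_elim X Y [:: U] [:: U] P P u v _ _ r) => //.
  by rewrite tcomp1l ?(le_r 0).
rewrite tcomp1l //.
apply: (IH _ _ (tty_comp yu (tty_proj2 [:: U] P))
               (tty_comp (tty_inj2 [:: U] P) yv) yr) => i lt.
have := le_r i.+1 lt.
rewrite -[i.+1]/(size [:: U] + i) -[U :: P]/([:: U] ++ P).
by rewrite proj_cat2 // inj_cat2 // !tcompA.
Qed.

Lemma tty_elem P Q i j f : i < size P -> j < size Q ->
  cty (mon P i) (mon Q j) f -> tty P Q (elem P Q i j f).
Proof.
move=> li lj yf; apply: tty_comp (tty_proj li) (tty_comp _ (tty_inj lj)).
exact: tty_lift.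
Qed.

Lemma elem_struct P Q i j n : j < size Q -> mon Q j = n ->
  elem P Q i j (CId n) ≃ tproj P i ;ᵗ tinj Q j.
Proof.
move=> lt <-; rewrite /elem tlift_id tcomp1l //.
by case/ttyP: (tty_inj lt).
Qed.

Lemma inj_sym1 P Q i : i < size P ->
  tinj (P ++ Q) i ;ᵗ TSym P Q ≃ tinj (Q ++ P) (size Q + i).
Proof. by move=> lt; rewrite inj_cat1 // inj_cat2 // -tcompA inj1_sym. Qed.

Lemma inj_sym2 P Q i : i < size Q ->
  tinj (P ++ Q) (size P + i) ;ᵗ TSym P Q ≃ tinj (Q ++ P) i.
Proof. by move=> lt; rewrite inj_cat2 // inj_cat1 // -tcompA inj2_sym. Qed.

Lemma elem_comp P Q R i k j f g : k < size Q ->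
    cty (mon P i) (mon Q k) f -> cty (mon Q k) (mon R j) g ->
  elem P Q i k f ;ᵗ elem Q R k j g ≃ elem P R i j (f ;ᶜ g).
Proof.
move=> lk [_ _ cf] [_ dg _];
  rewrite /elem -!tcompA (tcompA (tinj _ _)) inj_proj //.
by rewrite tcomp1l ?(tcompA (TLift f)) ?tlift_comp //= dg.
Qed.

(** At distinct middle indices the composite factors through 0, so it is a zero arrow and lies below
    every [r]. *)
Lemma elem_comp_neq X Y P Q R i k k' j f g u v r :
    tty X P u -> tty R Y v -> tty X Y r ->
    i < size P -> k < size Q -> k' < size Q -> j < size R ->
    cty (mon P i) (mon Q k) f -> cty (mon Q k') (mon R j) g -> k <> k' ->
  (u ;ᵗ elem P Q i k f) ;ᵗ (elem Q R k' j g ;ᵗ v) ≤ r.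
Proof.
move=> yu yv yr li lk lk' lj yf yg ne.
have -> : (u ;ᵗ elem P Q i k f) ;ᵗ (elem Q R k' j g ;ᵗ v)
    ≃ ((u ;ᵗ (tproj P i ;ᵗ TLift f)) ;ᵗ TDisc [:: mon Q k])
      ;ᵗ (TUnit [:: mon Q k'] ;ᵗ ((TLift g ;ᵗ tinj R j) ;ᵗ v)).
  rewrite -(tcompA _ (TDisc _)) (tcompA (TDisc _)) -(inj_proj_neq lk lk' ne).
  by rewrite /elem -!tcompA.
have yd : tty [:: mon Q k] [::] (TDisc [:: mon Q k]) by apply/ttyP.
have yU : tty [::] [:: mon Q k'] (TUnit [:: mon Q k']) by apply/ttyP.
rewrite (tty_from0
  (tty_comp (tty_comp yu (tty_comp (tty_proj li) (tty_lift yf))) yd)).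
rewrite (tty_to0
  (tty_comp yU (tty_comp (tty_comp (tty_lift yg) (tty_inj lj)) yv))).
exact: zero_le.
Qed.

(* [t] is the join of its elementary matrices; the contexts [u] and [v] let the
   induction on [t] pass through compositions. *)
Lemma ent_elim X Y P Q u v t r :
    tty X P u -> tty Q Y v -> tty P Q t -> tty X Y r ->
    (forall i j f, ent t i j f -> u ;ᵗ (elem P Q i j f ;ᵗ v) ≤ r) ->
  u ;ᵗ (t ;ᵗ v) ≤ r.
Proof.
move=> yu yv yt; case/ttyP: (yt) => w eP eQ; subst P Q => {yt} yr.
have yid P : tty P P (TId P) by apply: tty_id.
elim: t X Y u v r w yu yv yr =>
  [P|f|P Q|P|P|P|P|t IHt s IHs|t IHt s IHs] X Y u v r w yu yv yr le_r;
  rewrite /= in yu yv le_r *.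
- rewrite tcomp1l; last by case/ttyP: yv.
  apply: (id_elim yu yv yr) => i lt.
  have := le_r i i _ (And3 lt erefl erefl).
  by rewrite elem_struct // !tcompA.
- have := le_r 0 0 f (And3 erefl erefl erefl).
  rewrite /elem /= /tproj1 /tinj1 tdisc0 tunit0 !tsum0r.
  by rewrite tcomp1l // tcomp1r.
- apply: (id_elim yu (tty_comp _ yv) yr); first exact/ttyP.
  move=> i; rewrite size_cat => lt; have [lt1|ge1] := ltnP i (size P).
    have := le_r _ _ _ (or_introl (And3 lt1 erefl erefl)).
    rewrite elem_struct ?mon_cat2 ?size_cat //; last lia.
    by rewrite -inj_sym1 // !tcompA.
  have [k ei] : exists k, i = size P + k by exists (i - size P); lia.
  have ltk : k < size Q by lia.
  have := le_r _ _ _ (or_intror (And3 ltk ei erefl)).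
  rewrite elem_struct ?mon_cat1 ?size_cat //; last lia.
  by rewrite -inj_sym2 // -ei !tcompA.
(* An identity inserted after the copy lets its two branches be bounded separately; the counit laws
   leave one injection in each. *)
- have -> : u ;ᵗ (TCopy P ;ᵗ v)
      ≃ (u ;ᵗ TCopy P) ;ᵗ ((TId P ⊕ᵗ TId P) ;ᵗ v).
    by rewrite tsum_id tcomp1l ?tcompA //; case/ttyP: yv.
  have yc : tty P (P ++ P) (TCopy P) by apply/ttyP.
  apply: (@tle_sum_elim X Y P P P P) => //; first exact: tty_comp yc.
    rewrite -(tcompA u) tcopy_proj1 tcomp1l /= ?cats0 //.
    rewrite tcomp1r; last by case/ttyP: yu.
    apply: (id_elim yu (tty_comp (tty_inj1 P P) yv) yr) => i lt.
    have := le_r _ _ _ (And3 lt (or_introl erefl) erefl).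
    rewrite elem_struct ?mon_cat1 ?size_cat //; last lia.
    by rewrite inj_cat1 // !tcompA.
  rewrite -(tcompA u) tcopy_proj2 tcomp1l /= ?cats0 //.
  rewrite tcomp1r; last by case/ttyP: yu.
  apply: (id_elim yu (tty_comp (tty_inj2 P P) yv) yr) => i lt.
  have := le_r _ _ _ (And3 lt (or_intror erefl) erefl).
  rewrite elem_struct ?mon_cat2 ?size_cat //; last lia.
  by rewrite inj_cat2 // !tcompA.
- rewrite (tty_to0 yv) tcompA (tdisc_nat yu); exact: zero_le.
- apply: (id_elim yu (tty_comp _ yv) yr); first exact/ttyP.
  move=> i; rewrite size_cat => lt; have [lt1|ge1] := ltnP i (size P).
    have := le_r _ _ _ (And3 lt1 (or_introl erefl) erefl).
    rewrite elem_struct // inj_cat1 // -!(tcompA (tinj _ _))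
      (tcompA (tinj1 _ _)).
    rewrite tmerge_inj1 tcomp1l ?tcompA //.
    by case/ttyP: yv.
  have [k ei] : exists k, i = size P + k by exists (i - size P); lia.
  have ltk : k < size P by lia.
  have := le_r _ _ _ (And3 ltk (or_intror ei) erefl).
  rewrite elem_struct // ei inj_cat2 // -!(tcompA (tinj _ _))
    (tcompA (tinj2 _ _)).
  rewrite tmerge_inj2 tcomp1l ?tcompA //.
  by case/ttyP: yv.
- rewrite (tty_from0 yu) (tunit_nat yv); exact: zero_le.
- case/and3P: w => wt ws /eqP e; rewrite -tcompA.
  have yt : tty (tdom t) (tcod t) t by apply/ttyP.
  have ys : tty (tcod t) (tcod s) s by apply/ttyP.
  (* While [t] is decomposed, [s] belongs to the right context; each elementary matrix of [t] then
     joins the left context while [s] is decomposed. *)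
  apply: (IHt X Y) => //; first exact: tty_comp ys yv.
  move=> i k f tf; have [li lk yf] := ent_ty yt tf.
  rewrite tcompA; apply: (IHs X Y) => //.
    by rewrite -e; apply: tty_comp yu (tty_elem li lk yf).
  move=> k' j g sg; have [lk' lj yg] := ent_ty ys sg.
  rewrite -e; case: (k =P k') => [ek|nek];
    last exact: (elem_comp_neq yu yv yr li lk lk' lj yf yg nek).
  subst k'; rewrite -tcompA (tcompA (elem _ _ _ _ _)) elem_comp //.
  by apply: le_r; exists k, f, g.
- case/andP: w => wt ws.
  have yt : tty (tdom t) (tcod t) t by apply/ttyP.
  have ys : tty (tdom s) (tcod s) s by apply/ttyP.
  apply: (@tle_sum_elim X Y (tdom t) (tcod t) (tdom s) (tcod s)) => //.
    apply: (IHt X Y) => //; first exact: tty_comp yu (tty_proj1 _ _).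
      exact: tty_comp (tty_inj1 _ _) yv.
    move=> i j f tf; have [li lj yf] := ent_ty yt tf.
    have := le_r _ _ _ (or_introl tf).
    by rewrite elem_cat1 // !tcompA.
  apply: (IHs X Y) => //; first exact: tty_comp yu (tty_proj2 _ _).
    exact: tty_comp (tty_inj2 _ _) yv.
  move=> i j f sf; have [li lj yf] := ent_ty ys sf.
  have := le_r _ _ _
    (or_intror (ex_intro _ i (ex_intro _ j (And3 erefl erefl sf)))).
  by rewrite elem_cat2 // !tcompA.
Qed.

(** The lower set generated by an entry. It depends on the circuits only up to [≡], so that a law of
    tapes becomes an equivalence of memberships. *)
Definition den t i j f := exists2 g, ent t i j g & f ≼ g.

Lemma den_ty P Q t i j f : tty P Q t -> den t i j f ->
  [/\ i < size P, j < size Q & cty (mon P i) (mon Q j) f].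
Proof.
move=> yt [g tg fg]; have [? ? ?] := ent_ty yt tg; split=> //.
exact/(cle_cty _ _ fg).
Qed.

(** With identity contexts, [ent_elim] leaves one elementary matrix of [t] at a time; [elem_mono]
    raises its circuit to one occurring in [s], and [elem_le] concludes. *)
Theorem den_le P Q t s : tty P Q t -> tty P Q s ->
  (forall i j f, den t i j f -> den s i j f) -> t ≤ s.
Proof.
move=> yt ys ts; have yid R : tty R R (TId R) by apply: tty_id.
have -> : t ≃ TId P ;ᵗ (t ;ᵗ TId Q).
  by case/ttyP: yt => _ dt ct; rewrite tcomp1r // tcomp1l.
apply: (ent_elim (yid P) (yid Q) yt ys) => i j f tf.
have [g sg fg] : den s i j f by apply: ts; exists f.
have [li lj yf] := ent_ty yt tf.
rewrite tcomp1r ?tcomp1l; last by case/ttyP: (tty_elem li lj yf).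
  rewrite (elem_mono _ _ _ _ fg).
  by case/ttyP: ys => ws ds cs; subst P Q; apply: elem_le.
by case/ttyP: (tty_elem li lj yf).
Qed.

(** * Calculus of entries and of rows with at most one entry *)

Lemma ent_den t i j f : ent t i j f -> den t i j f.
Proof. by exists f. Qed.

Lemma den_down t i j f g : f ≼ g -> den t i j g -> den t i j f.
Proof. by move=> fg [h th gh]; exists h => //; transitivity g. Qed.

Lemma den_comp t s i j f :
  den (t ;ᵗ s) i j f
  <-> exists k g h, [/\ den t i k g, den s k j h & f ≼ g ;ᶜ h].
Proof.
split=> [[_ [k [g [h [tg sh ->]]]] fgh]|[k
  [g [h [[g' tg gg'] [h' sh hh'] fgh]]]]].
  by exists k, g, h; split=> //; apply: ent_den.
exists (g' ;ᶜ h'); first by exists k, g', h'.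
by rewrite fgh gg' hh'.
Qed.

Lemma den_sum t s i j f :
  den (t ⊕ᵗ s) i j f
  <-> den t i j f \/ exists i' j',
        [/\ i = size (tdom t) + i', j = size (tcod t) + j' & den s i' j' f].
Proof.
split=> [[g [tg|[i' [j' [-> -> sg]]]] fg]|[[g tg fg]|[i' [j' [-> ->
  [g sg fg]]]]]].
- by left; exists g.
- by right; exists i', j'; split=> //; exists g.
- by exists g => //; left.
- by exists g => //; right; exists i', j'.
Qed.

(* Row [i] of the matrix of [t] has [f] in column [j], and zeros elsewhere. *)
Definition row t i j f := forall j' f', den t i j' f' <-> j' = j /\ f' ≼ f.
Definition zerorow t i := forall j f, ~ den t i j f.
Definition rowid P t i j := row t i j (CId (mon P i)).

Lemma row_den t i j f : row t i j f -> den t i j f.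
Proof. by move=> r; apply/r. Qed.

Lemma row_eqv t i j f g : f ≡ g -> row t i j f -> row t i j g.
Proof. by move=> fg r j' f'; rewrite r fg. Qed.

Lemma row_eq t i j f i' j' : row t i j f -> i' = i -> j' = j -> row t i' j' f.
Proof. by move=> r -> ->. Qed.

Lemma row_comp t s i k j f g : row t i k f -> row s k j g ->
  row (t ;ᵗ s) i j (f ;ᶜ g).
Proof.
move=> rt rs j' h; rewrite den_comp; split.
  by case=> k' [f' [g' [/rt[-> lf] /rs[-> lg] lh]]]; split=> //;
    rewrite lh lf lg.
by case=> -> lh; exists k, f, g; split=> //; [apply/rt | apply/rs].
Qed.

Lemma row_sum1 P Q t s i j f : tty P Q t -> i < size P ->
  row t i j f -> row (t ⊕ᵗ s) i j f.
Proof.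
move=> /ttyP[_ <- _] lt rt j' h; rewrite den_sum -rt; split; last by left.
by case=> // -[i' [? [e _ _]]]; lia.
Qed.

Lemma row_sum2 P Q t s i j f : tty P Q t ->
  row s i j f -> row (t ⊕ᵗ s) (size P + i) (size Q + j) f.
Proof.
move=> yt rs j' h; rewrite den_sum; split.
  case=> [/(den_ty yt)[lt _ _]|[i' [k [e -> ]]]]; first lia.
  case/ttyP: yt => _ dt ->; rewrite dt in e.
  have -> : i' = i by lia.
  by move=> /rs[-> lh].
case=> -> lh; right; exists i, j; case/ttyP: yt => _ -> ->.
by split=> //; apply/rs.
Qed.

Lemma zerorow_comp1 t s i : zerorow t i -> zerorow (t ;ᵗ s) i.
Proof. by move=> z j f /den_comp[k [g [h [/z]]]]. Qed.

Lemma zerorow_comp2 t s i k f : row t i k f -> zerorow s k ->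
  zerorow (t ;ᵗ s) i.
Proof. by move=> r z j g /den_comp[k' [g' [h [/r[-> _] /z]]]]. Qed.

Lemma zerorow_sum1 P Q t s i : tty P Q t -> i < size P ->
  zerorow t i -> zerorow (t ⊕ᵗ s) i.
Proof.
move=> /ttyP[_ <- _] lt z j f /den_sum[/z //|[i' [? [e _ _]]]]; lia.
Qed.

Lemma zerorow_sum2 P Q t s i : tty P Q t ->
  zerorow s i -> zerorow (t ⊕ᵗ s) (size P + i).
Proof.
move=> yt z j f /den_sum[/(den_ty yt)[lt _ _]|[i' [? [e _ s']]]]; first lia.
case/ttyP: yt => _ dt _; rewrite dt in e.
have ei : i' = i by lia.
by move: s'; rewrite ei => /z.
Qed.

Lemma row_id P i : i < size P -> rowid P (TId P) i i.
Proof.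
move=> lt j f; split=> [[g [_ -> ->]]|[-> lf]] //.
by exists (CId (mon P i)).
Qed.

Lemma row_lift f : row (TLift f) 0 0 f.
Proof. by move=> j g; split=> [[h [_ -> ->]]|[-> gf]] //; exists f. Qed.

Lemma row_sym1 P Q i : i < size P -> rowid (P ++ Q) (TSym P Q) i (size Q + i).
Proof.
move=> lt j f; rewrite mon_cat1 //;
  split=> [[g [[_ -> ->]|[ltj e]]]|[-> lf]] //.
  by lia.
by exists (CId (mon P i)) => //; left.
Qed.

Lemma row_sym2 P Q i : i < size Q -> rowid (P ++ Q) (TSym P Q) (size P + i) i.
Proof.
move=> lt j f; rewrite mon_cat2 //; split=> [[g [[?]|[ltj e ->]]]|[-> lf]] //.
- by lia.
- by have -> : j = i by lia.
by exists (CId (mon Q i)) => //; right.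
Qed.

Lemma row_merge1 P i : i < size P -> rowid (P ++ P) (TMerge P) i i.
Proof.
move=> lt j f; rewrite mon_cat1 //; split=> [[g [ltj [->|e] ->]]|[-> lf]] //.
  by lia.
by exists (CId (mon P i)) => //; split=> //; left.
Qed.

Lemma row_merge2 P i : i < size P -> rowid (P ++ P) (TMerge P) (size P + i) i.
Proof.
move=> lt j f; rewrite mon_cat2 //; split=> [[g [ltj [e|e] ->]]|[-> lf]] //.
- by lia.
- by have -> : j = i by lia.
by exists (CId (mon P i)) => //; split=> //; right.
Qed.

Lemma zerorow_disc P i : zerorow (TDisc P) i.
Proof. by move=> j f []. Qed.

Lemma den_copy P i j f : den (TCopy P) i j f
  <-> [/\ i < size P, j = i \/ j = size P + i & f ≼ CId (mon P i)].
Proof.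
split=> [[g [lt e ->] fg]|[lt e le_f]]; first by [].
by exists (CId (mon P i)).
Qed.

Lemma rowid_mon P Q t i j : tty P Q t -> rowid P t i j ->
  [/\ i < size P, j < size Q & mon P i = mon Q j].
Proof. by move=> yt /row_den/(den_ty yt)[? ? [_ _]]. Qed.

(** Typing forces the monomials at [i] and [k] to be equal, so the two identity circuits compose to
    one. *)
Lemma rowid_comp P Q R t s i k j : tty P Q t -> tty Q R s ->
  rowid P t i k -> rowid Q s k j -> rowid P (t ;ᵗ s) i j.
Proof.
move=> yt ys rt rs; have [_ _ e] := rowid_mon yt rt.
by apply: row_eqv (row_comp rt rs); rewrite e ccomp1l.
Qed.

Lemma rowid_sum1 P Q P' t s i j : tty P Q t ->
  rowid P t i j -> rowid (P ++ P') (t ⊕ᵗ s) i j.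
Proof.
move=> yt rt; have [lt _ _] := rowid_mon yt rt.
by rewrite /rowid mon_cat1 //; apply: row_sum1 yt lt rt.
Qed.

Lemma rowid_sum2 P Q P' t s i j : tty P Q t -> rowid P' s i j ->
  rowid (P ++ P') (t ⊕ᵗ s) (size P + i) (size Q + j).
Proof. by move=> yt rs; rewrite /rowid mon_cat2; apply: row_sum2 yt rs. Qed.

Arguments row_sum1 [P Q t s i j f].
Arguments rowid_sum1 [P Q P' t s i j].
Arguments zerorow_sum1 [P Q t s i].

(** * Positions in products and rows of the distributors *)

Lemma size_pmul P Q : size (pmul P Q) = size P * size Q.
Proof. by rewrite /pmul size_allpairs. Qed.

Lemma ltn_pair p q i k : i < p -> k < q -> i * q + k < p * q.
Proof. by move=> lti ltk; apply: leq_trans (leq_mul lti (leqnn q)); lia. Qed.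

Lemma mon_pmul P Q i k : i < size P -> k < size Q ->
  mon (pmul P Q) (i * size Q + k) = mon P i + mon Q k.
Proof.
elim: P i => [|U P IH] [|i] //= lti ltk; rewrite pmul_cons pmul1l.
  by rewrite nth_cat size_map ltk (nth_map 0).
rewrite nth_cat size_map; have -> : i.+1 * size Q + k < size Q = false by lia.
by rewrite -IH //; congr (mon _ _); lia.
Qed.

Lemma rowid_eq P t i j i' j' : rowid P t i j -> i' = i -> j' = j ->
  rowid P t i' j'.
Proof. by move=> r -> ->. Qed.

Lemma tty_tid P : tty P P (TId P).
Proof. exact: tty_id. Qed.

Lemma tty_tsym P Q : tty (P ++ Q) (Q ++ P) (TSym P Q).
Proof. exact/ttyP. Qed.

Lemma size_pmul1 U P : size (pmul [:: U] P) = size P.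
Proof. by rewrite size_pmul mul1n. Qed.

Lemma size_cons U P : size (U :: P) = (size P).+1.
Proof. by []. Qed.

Definition size_polyE := (size_cat, size_pmul1, size_pmul, size_cons).

Lemma pmul1Dr_cat U P Q X Y :
  pmul [:: U] P ++ ((pmul [:: U] Q ++ X) ++ Y)
  = pmul [:: U] (P ++ Q) ++ (X ++ Y).
Proof. by rewrite pmul1Dr -!catA. Qed.

Section Distributors.
Variables (U : nat) (P Q R : poly).
Local Notation mid1 :=
  (pmul [:: U] Q ++ ((pmul [:: U] R ++ pmul P Q) ++ pmul P R)).
Local Notation mid2 :=
  (pmul [:: U] Q ++ ((pmul P Q ++ pmul [:: U] R) ++ pmul P R)).

(** The two factors in the recursion of [tdl] type their middle polynomial with different
    bracketings. Each factor is retyped at one common bracketing, built around the block that [TSym]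
    exchanges, so that their rows can be composed. *)
Lemma tty_dl_step1 :
  tty (pmul [:: U] (Q ++ R) ++ pmul P (Q ++ R)) mid1
    (TId (pmul [:: U] (Q ++ R)) ⊕ᵗ tdl S P Q R).
Proof.
have := tty_sum (tty_tid (pmul [:: U] (Q ++ R))) (tty_dl S P Q R).
by rewrite !catA pmul1Dr !catA.
Qed.

Lemma tty_dli_step1 :
  tty mid1 (pmul [:: U] (Q ++ R) ++ pmul P (Q ++ R))
    (TId (pmul [:: U] (Q ++ R)) ⊕ᵗ tdli S P Q R).
Proof.
have := tty_sum (tty_tid (pmul [:: U] (Q ++ R))) (tty_dli S P Q R).
by rewrite !catA pmul1Dr !catA.
Qed.

Lemma tty_dl_step2 : tty mid1 mid2
  (TId (pmul [:: U] Q) ⊕ᵗ TSym (pmul [:: U] R) (pmul P Q) ⊕ᵗ TId (pmul P R)).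
Proof.
by apply: tty_sum (tty_tid _) (tty_sum (tty_tsym _ _) (tty_tid _)).
Qed.

Lemma tty_dli_step2 : tty mid2 mid1
  (TId (pmul [:: U] Q) ⊕ᵗ TSym (pmul P Q) (pmul [:: U] R) ⊕ᵗ TId (pmul P R)).
Proof.
by apply: tty_sum (tty_tid _) (tty_sum (tty_tsym _ _) (tty_tid _)).
Qed.

End Distributors.

(** In row-major order each [i] owns a block of [size Q + size R] positions in the source and a
    block of [size Q] positions in the left summand of the target. *)
Lemma row_dl1 P Q R i k : i < size P -> k < size Q ->
  rowid (pmul P (Q ++ R)) (tdl S P Q R)
    (i * (size Q + size R) + k) (i * size Q + k).
Proof.
elim: P i => [|U P IH] // i lti ltk; rewrite (pmul_cons U P).
have yid := tty_tid; have ysym := tty_tsym.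
case: i lti => [|i] lti.
  apply: (rowid_comp (tty_dl_step1 U P Q R) (tty_dl_step2 U P Q R)).
    by apply: (rowid_sum1 (yid _)); apply: row_id; rewrite size_pmul1 size_cat;
      lia.
  by apply: (rowid_sum1 (yid _)); apply: row_id; rewrite size_pmul1; lia.
apply: (rowid_comp (tty_dl_step1 U P Q R) (tty_dl_step2 U P Q R)).
  apply: rowid_eq (rowid_sum2 (yid _) (IH i lti ltk)) _ erefl.
  by rewrite !size_polyE; lia.
have r : rowid (pmul [:: U] R ++ pmul P Q) (TSym (pmul [:: U] R) (pmul P Q))
    (size (pmul [:: U] R) + (i * size Q + k)) (i * size Q + k).
  by apply: row_sym2; rewrite size_pmul; apply: ltn_pair.
apply: rowid_eq (rowid_sum2 (yid _) (rowid_sum1 (ysym _ _) r)) _ _;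
  by rewrite !size_polyE; lia.
Qed.

(** The right summand of the target starts after all of [pmul P Q], hence the offset
    [size P * size Q]. *)
Lemma row_dl2 P Q R i k : i < size P -> k < size R ->
  rowid (pmul P (Q ++ R)) (tdl S P Q R)
    (i * (size Q + size R) + (size Q + k))
    (size P * size Q + (i * size R + k)).
Proof.
elim: P i => [|U P IH] // i lti ltk; rewrite (pmul_cons U P).
have yid := tty_tid; have ysym := tty_tsym.
case: i lti => [|i] lti.
  apply: (rowid_comp (tty_dl_step1 U P Q R) (tty_dl_step2 U P Q R)).
    by apply: (rowid_sum1 (yid _)); apply: row_id; rewrite size_pmul1 size_cat;
      lia.
  have r : rowid (pmul [:: U] R ++ pmul P Q) (TSym (pmul [:: U] R) (pmul P Q))
      k (size (pmul P Q) + k) by apply: row_sym1; rewrite size_pmul1.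
  apply: rowid_eq (rowid_sum2 (yid _) (rowid_sum1 (ysym _ _) r)) _ _;
    by rewrite !size_polyE; lia.
apply: (rowid_comp (tty_dl_step1 U P Q R) (tty_dl_step2 U P Q R)).
  apply: rowid_eq (rowid_sum2 (yid _) (IH i lti ltk)) _ erefl.
  by rewrite !size_polyE; lia.
have r : rowid (pmul P R) (TId (pmul P R)) (i * size R + k) (i * size R + k).
  by apply: row_id; rewrite size_pmul; apply: ltn_pair.
apply: rowid_eq (rowid_sum2 (yid _) (rowid_sum2 (ysym _ _) r)) _ _;
  by rewrite !size_polyE; lia.
Qed.

Lemma row_dli1 P Q R i k : i < size P -> k < size Q ->
  rowid (pmul P Q ++ pmul P R) (tdli S P Q R)
    (i * size Q + k) (i * (size Q + size R) + k).
Proof.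
elim: P i => [|U P IH] // i lti ltk;
  rewrite (pmul_cons U P Q) (pmul_cons U P R).
have yid := tty_tid; have ysym := tty_tsym.
have -> : (pmul [:: U] Q ++ pmul P Q) ++ pmul [:: U] R ++ pmul P R =
  pmul [:: U] Q ++ ((pmul P Q ++ pmul [:: U] R) ++ pmul P R) by rewrite !catA.
case: i lti => [|i] lti.
  apply: (rowid_comp (tty_dli_step2 U P Q R) (tty_dli_step1 U P Q R)).
    by apply: (rowid_sum1 (yid _)); apply: row_id; rewrite size_pmul1; lia.
  rewrite pmul1Dr_cat.
  by apply: (rowid_sum1 (yid _)); apply: row_id; rewrite size_pmul1 size_cat;
    lia.
apply: (rowid_comp (tty_dli_step2 U P Q R) (tty_dli_step1 U P Q R)).
  have r : rowid (pmul P Q ++ pmul [:: U] R) (TSym (pmul P Q) (pmul [:: U] R))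
      (i * size Q + k) (size (pmul [:: U] R) + (i * size Q + k)).
    by apply: row_sym1; rewrite size_pmul; apply: ltn_pair.
  apply: rowid_eq (rowid_sum2 (yid _) (rowid_sum1 (ysym _ _) r)) _ erefl.
  by rewrite !size_polyE; lia.
rewrite pmul1Dr_cat.
apply: rowid_eq (rowid_sum2 (yid _) (IH i lti ltk)) _ _;
  by rewrite !size_polyE; lia.
Qed.

Lemma row_dli2 P Q R i k : i < size P -> k < size R ->
  rowid (pmul P Q ++ pmul P R) (tdli S P Q R)
    (size P * size Q + (i * size R + k))
    (i * (size Q + size R) + (size Q + k)).
Proof.
elim: P i => [|U P IH] // i lti ltk;
  rewrite (pmul_cons U P Q) (pmul_cons U P R).
have yid := tty_tid; have ysym := tty_tsym.
have -> : (pmul [:: U] Q ++ pmul P Q) ++ pmul [:: U] R ++ pmul P R =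
  pmul [:: U] Q ++ ((pmul P Q ++ pmul [:: U] R) ++ pmul P R) by rewrite !catA.
case: i lti => [|i] lti.
  have r : rowid (pmul P Q ++ pmul [:: U] R) (TSym (pmul P Q) (pmul [:: U] R))
      (size (pmul P Q) + k) k by apply: row_sym2; rewrite size_pmul1.
  apply: (rowid_comp (tty_dli_step2 U P Q R) (tty_dli_step1 U P Q R)).
    apply: rowid_eq (rowid_sum2 (yid _) (rowid_sum1 (ysym _ _) r)) _ erefl.
    by rewrite !size_polyE; lia.
  rewrite pmul1Dr_cat.
  apply: (rowid_sum1 (yid _)); rewrite size_pmul1.
  by apply: row_id; rewrite size_pmul1 size_cat; lia.
apply: (rowid_comp (tty_dli_step2 U P Q R) (tty_dli_step1 U P Q R)).
  have r : rowid (pmul P R) (TId (pmul P R)) (i * size R + k) (i * size R + k).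
    by apply: row_id; rewrite size_pmul; apply: ltn_pair.
  apply: rowid_eq (rowid_sum2 (yid _) (rowid_sum2 (ysym _ _) r)) _ erefl.
  by rewrite !size_polyE; lia.
rewrite pmul1Dr_cat.
apply: rowid_eq (rowid_sum2 (yid _) (IH i lti ltk)) _ _.
  by rewrite !size_polyE; lia.
by rewrite !size_polyE; lia.
Qed.

(** * Entries under whiskering by a monomial *)

Lemma mon_pmul1l U P i : i < size P -> mon (pmul [:: U] P) i = U + mon P i.
Proof. by move=> lt; rewrite pmul1l (nth_map 0). Qed.

Lemma mon_pmul1r U P i : i < size P -> mon (pmul P [:: U]) i = mon P i + U.
Proof. by move=> lt; rewrite pmul1r (nth_map 0). Qed.

Lemma size_pmulr1 U P : size (pmul P [:: U]) = size P.
Proof. by rewrite size_pmul muln1. Qed.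

(** Identity entries come out as [CId (U + n)] rather than [CId U ⊗ᶜ CId n], so the entries of
    [tLm U t] and the whiskered entries of [t] match only up to [≡]. This is why the correspondence
    is stated as two implications. *)
Lemma ent_Lm P Q U t : tty P Q t ->
  (forall i j f, ent (tLm U t) i j f ->
     exists2 g, ent t i j g & f ≡ CId U ⊗ᶜ g)
  /\ (forall i j g, ent t i j g ->
     exists2 f, ent (tLm U t) i j f & f ≡ CId U ⊗ᶜ g).
Proof.
have idU n : CId (U + n) ≡ CId U ⊗ᶜ CId n by rewrite ctens_id.
have sz := size_pmul1 U.
elim: t P Q => [T|h|T T'|T|T|T|T|t IHt s IHs|t IHt s IHs] P Q /ttyP[/= w dt ct].
- split=> i j f [lt -> ->]; rewrite ?sz in lt *.
    by exists (CId (mon T i)); rewrite ?mon_pmul1l.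
  by exists (CId (U + mon T i)); rewrite ?mon_pmul1l.
- split=> i j f [-> -> ->]; first by exists h.
  by exists (CId U ⊗ᶜ h).
- split=> i j f; rewrite /= !sz.
    case=> [[lt -> ->]|[lt -> ->]].
      by exists (CId (mon T i)); rewrite ?(mon_pmul1l _ lt) //; left.
    by exists (CId (mon T' j)); rewrite ?(mon_pmul1l _ lt) //; right.
  case=> [[lt -> ->]|[lt -> ->]].
    by exists (CId (U + mon T i)); rewrite ?(mon_pmul1l _ lt) //; left.
  by exists (CId (U + mon T' j)); rewrite ?(mon_pmul1l _ lt) //; right.
- split=> i j f; rewrite /= !sz => -[lt e ->].
    by exists (CId (mon T i)); rewrite ?mon_pmul1l.
  by exists (CId (U + mon T i)); rewrite ?mon_pmul1l.
- by [].
- split=> i j f; rewrite /= !sz => -[lt e ->].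
    by exists (CId (mon T j)); rewrite ?mon_pmul1l.
  by exists (CId (U + mon T j)); rewrite ?mon_pmul1l.
- by [].
- case/and3P: w => wt ws /eqP e.
  have yt : tty (tdom t) (tcod t) t by apply/ttyP.
  have ys : tty (tcod t) (tcod s) s by apply/ttyP.
  have [IHt1 IHt2] := IHt _ _ yt; have [IHs1 IHs2] := IHs _ _ ys.
  split=> i j f.
    case=> k [b [c [/IHt1[b' tb eb] /IHs1[c' sc ec] ->]]].
    exists (b' ;ᶜ c'); first by exists k, b', c'.
    have [_ _ [_ _ cb]] := ent_ty yt tb; have [_ _ [_ dc _]] := ent_ty ys sc.
    by rewrite eb ec -tens_idl_comp // cb dc.
  case=> k [b [c [tb sc ->]]].
  have [_ _ [_ _ cb]] := ent_ty yt tb; have [_ _ [_ dc _]] := ent_ty ys sc.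
  have [b' tb' eb] := IHt2 _ _ _ tb; have [c' sc' ec] := IHs2 _ _ _ sc.
  exists (b' ;ᶜ c'); first by exists k, b', c'.
  by rewrite eb ec -tens_idl_comp // cb dc.
- case/andP: w => wt ws.
  have yt : tty (tdom t) (tcod t) t by apply/ttyP.
  have ys : tty (tdom s) (tcod s) s by apply/ttyP.
  have [IHt1 IHt2] := IHt _ _ yt; have [IHs1 IHs2] := IHs _ _ ys.
  case/ttyP: (tty_Lm U yt) => _ -> ->; rewrite !sz.
  split=> i j f [].
  + by case/IHt1=> g tg e; exists g => //; left.
  + case=> i' [j' [-> -> /IHs1[g sg e]]]; exists g => //.
    by right; exists i', j'.
  + by case/IHt2=> g tg e; exists g => //; left.
  + case=> i' [j' [-> -> /IHs2[g sg e]]]; exists g => //.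
    by right; exists i', j'.
Qed.

Lemma ent_Rm P Q U t : tty P Q t ->
  (forall i j f, ent (tRm U t) i j f ->
     exists2 g, ent t i j g & f ≡ g ⊗ᶜ CId U)
  /\ (forall i j g, ent t i j g ->
     exists2 f, ent (tRm U t) i j f & f ≡ g ⊗ᶜ CId U).
Proof.
have idU n : CId (n + U) ≡ CId n ⊗ᶜ CId U by rewrite ctens_id.
have sz := size_pmulr1 U.
elim: t P Q => [T|h|T T'|T|T|T|T|t IHt s IHs|t IHt s IHs] P Q /ttyP[/= w dt ct].
- split=> i j f [lt -> ->]; rewrite ?sz in lt *.
    by exists (CId (mon T i)); rewrite ?mon_pmul1r.
  by exists (CId (mon T i + U)); rewrite ?mon_pmul1r.
- split=> i j f [-> -> ->]; first by exists h.
  by exists (h ⊗ᶜ CId U).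
- split=> i j f; rewrite /= !sz.
    case=> [[lt -> ->]|[lt -> ->]].
      by exists (CId (mon T i)); rewrite ?(mon_pmul1r _ lt) //; left.
    by exists (CId (mon T' j)); rewrite ?(mon_pmul1r _ lt) //; right.
  case=> [[lt -> ->]|[lt -> ->]].
    by exists (CId (mon T i + U)); rewrite ?(mon_pmul1r _ lt) //; left.
  by exists (CId (mon T' j + U)); rewrite ?(mon_pmul1r _ lt) //; right.
- split=> i j f; rewrite /= !sz => -[lt e ->].
    by exists (CId (mon T i)); rewrite ?mon_pmul1r.
  by exists (CId (mon T i + U)); rewrite ?mon_pmul1r.
- by [].
- split=> i j f; rewrite /= !sz => -[lt e ->].
    by exists (CId (mon T j)); rewrite ?mon_pmul1r.
  by exists (CId (mon T j + U)); rewrite ?mon_pmul1r.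
- by [].
- case/and3P: w => wt ws /eqP e.
  have yt : tty (tdom t) (tcod t) t by apply/ttyP.
  have ys : tty (tcod t) (tcod s) s by apply/ttyP.
  have [IHt1 IHt2] := IHt _ _ yt; have [IHs1 IHs2] := IHs _ _ ys.
  split=> i j f.
    case=> k [b [c [/IHt1[b' tb eb] /IHs1[c' sc ec] ->]]].
    exists (b' ;ᶜ c'); first by exists k, b', c'.
    have [_ _ [_ _ cb]] := ent_ty yt tb; have [_ _ [_ dc _]] := ent_ty ys sc.
    by rewrite eb ec -tens_idr_comp // cb dc.
  case=> k [b [c [tb sc ->]]].
  have [_ _ [_ _ cb]] := ent_ty yt tb; have [_ _ [_ dc _]] := ent_ty ys sc.
  have [b' tb' eb] := IHt2 _ _ _ tb; have [c' sc' ec] := IHs2 _ _ _ sc.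
  exists (b' ;ᶜ c'); first by exists k, b', c'.
  by rewrite eb ec -tens_idr_comp // cb dc.
- case/andP: w => wt ws.
  have yt : tty (tdom t) (tcod t) t by apply/ttyP.
  have ys : tty (tdom s) (tcod s) s by apply/ttyP.
  have [IHt1 IHt2] := IHt _ _ yt; have [IHs1 IHs2] := IHs _ _ ys.
  case/ttyP: (tty_Rm U yt) => _ -> ->; rewrite !sz.
  split=> i j f [].
  + by case/IHt1=> g tg e; exists g => //; left.
  + case=> i' [j' [-> -> /IHs1[g sg e]]]; exists g => //.
    by right; exists i', j'.
  + by case/IHt2=> g tg e; exists g => //; left.
  + case=> i' [j' [-> -> /IHs2[g sg e]]]; exists g => //.
    by right; exists i', j'.
Qed.

(** * Kronecker products and diagonal matrices *)

Lemma den_Lm P Q U t i j f : tty P Q t ->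
  den (tLm U t) i j f <-> exists2 g, den t i j g & f ≼ CId U ⊗ᶜ g.
Proof.
move=> yt; have [e1 e2] := ent_Lm U yt; split.
  by case=> f' /e1[g tg eg] ff'; exists g; [apply: ent_den | rewrite -eg].
case=> g [g' tg gg'] fg; have [f' tf' ef'] := e2 _ _ _ tg.
by exists f' => //; rewrite fg gg' ef'.
Qed.

Lemma den_Rm P Q U t i j f : tty P Q t ->
  den (tRm U t) i j f <-> exists2 g, den t i j g & f ≼ g ⊗ᶜ CId U.
Proof.
move=> yt; have [e1 e2] := ent_Rm U yt; split.
  by case=> f' /e1[g tg eg] ff'; exists g; [apply: ent_den | rewrite -eg].
case=> g [g' tg gg'] fg; have [f' tf' ef'] := e2 _ _ _ tg.
by exists f' => //; rewrite fg gg' ef'.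
Qed.

(** [tL T t] is block diagonal, with one copy of [t] per monomial of [T], whiskered by it; the index
    of [T] is the slow one of the pair. *)
Lemma den_L P Q T t i j f : tty P Q t ->
  den (tL T t) i j f <-> exists i1 i2 j2 g,
    [/\ i1 < size T, i = i1 * size P + i2, j = i1 * size Q + j2
      & den t i2 j2 g /\ f ≼ CId (mon T i1) ⊗ᶜ g].
Proof.
move=> yt; elim: T i j => [|W T IH] i j.
  by split=> [[g []]|[i1 [i2 [j2 [g []]]]]]; rewrite ?ltn0;
    case: i j => [|i] [|j].
rewrite /= den_sum (den_Lm _ _ _ _ yt); case/ttyP: (tty_Lm W yt) => _ -> ->.
rewrite !size_pmul1; split.
  case=> [[g tg le]|[i' [j' [-> -> /IH[i1 [i2 [j2 [g [lt -> -> [tg le]]]]]]]]]].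
    by exists 0, i, j, g; split=> //; rewrite mul0n.
  by exists i1.+1, i2, j2, g; split=> //; lia.
case=> [[|i1] [i2 [j2 [g [lt -> -> [tg le]]]]]]; first by left; exists g.
right; exists (i1 * size P + i2), (i1 * size Q + j2); split; [lia|lia|].
by apply/IH; exists i1, i2, j2, g.
Qed.

Lemma row_inj t i j j' f f' : row t i j f -> row t i j' f' -> j = j'.
Proof. by move=> r r'; case/r': (row_den r). Qed.

Lemma row_den_comp t s i k j f g : row t i k g ->
  den (t ;ᵗ s) i j f <-> exists2 h, den s k j h & f ≼ g ;ᶜ h.
Proof.
move=> r; rewrite den_comp; split.
  by case=> k' [g' [h [/r[-> lg] sh lf]]]; exists h => //; rewrite lf lg.
by case=> h sh lf; exists k, g, h; split=> //; apply: row_den.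
Qed.

Lemma rowid_den_comp P Q R t s i k j f : tty P Q t -> tty Q R s ->
  rowid P t i k -> den (t ;ᵗ s) i j f <-> den s k j f.
Proof.
move=> yt ys r; have [_ _ e] := rowid_mon yt r.
rewrite (row_den_comp _ _ _ r) e; split.
  case=> h sh le; apply: (den_down _ sh); rewrite le ccomp1l //.
  by have [_ _ []] := den_ty ys sh.
move=> sf; exists f => //; rewrite ccomp1l //.
by have [_ _ []] := den_ty ys sf.
Qed.

(** Post-composition with a map of positions relabels the columns; totality provides an image for
    every column that [t] can reach. *)
Lemma den_comp_rowid P Q R t s i j f : tty P Q t -> tty Q R s ->
    (forall k, k < size Q -> exists j', rowid Q s k j') ->
  den (t ;ᵗ s) i j f <-> exists2 k, den t i k f & rowid Q s k j.
Proof.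
move=> yt ys tot; rewrite den_comp; split.
  case=> k [g [h [tg sh le]]]; have [_ lt [_ _ cg]] := den_ty yt tg.
  have [j' r] := tot _ lt; case/r: sh => -> lh.
  by exists k => //; apply: den_down tg; rewrite le lh ccomp1r.
case=> k tf r; have [_ lt [_ _ cf]] := den_ty yt tf.
by exists k, f, (CId (mon Q k)); split=> //; [apply: row_den | rewrite ccomp1r].
Qed.

Lemma pair_split p q i : i < p * q ->
  exists i1 i2, [/\ i1 < p, i2 < q & i = i1 * q + i2].
Proof.
case: q => [|q]; first by rewrite muln0.
by exists (i %/ q.+1), (i %% q.+1); rewrite ltn_divLR // ltn_mod -divn_eq.
Qed.

Lemma pair_inj q i1 i2 j1 j2 : i2 < q -> j2 < q ->
  i1 * q + i2 = j1 * q + j2 -> i1 = j1 /\ i2 = j2.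
Proof.
by move=> lti ltj /(congr1 (edivn ^~ q)); rewrite !edivn_eq // => -[-> ->].
Qed.

Lemma dli_total P Q R k : k < size (pmul P Q ++ pmul P R) ->
  exists j, rowid (pmul P Q ++ pmul P R) (tdli S P Q R) k j.
Proof.
rewrite size_cat !size_pmul => lt; have [lt1|ge] := ltnP k (size P * size Q).
  have [i1 [i2 [l1 l2 ->]]] := pair_split lt1.
  by eexists; apply: row_dli1.
have [|i1 [i2 [l1 l2 e]]] :=
  @pair_split (size P) (size R) (k - size P * size Q); first lia.
have -> : k = size P * size Q + (i1 * size R + i2) by lia.
by eexists; apply: row_dli2.
Qed.

(** Here the index of [T] is the fast one of the pair. The distributors conjugate to the order in
    which the head of [T] forms a block of its own; induction treats the remaining monomials. *)
Lemma den_R P Q T t i j f : tty P Q t ->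
  den (tR T t) i j f <-> exists i1 j1 i2 g,
    [/\ i2 < size T, i = i1 * size T + i2, j = j1 * size T + i2
      & den t i1 j1 g /\ f ≼ g ⊗ᶜ CId (mon T i2)].
Proof.
move=> yt; elim: T i j f => [|W T IH] i j f.
  by split=> [[g []]|[i1 [i2 [j2 [g []]]]]]; rewrite ?ltn0;
    case: i j => [|i] [|j].
case/ttyP: (yt) => _ /= -> ->.
have yR := tty_Rm W yt; have yRT := tty_R T yt.
have ydl := tty_dl S P [:: W] T; have ydli := tty_dli S Q [:: W] T.
have ymid := tty_sum yR yRT.
(* The [+ 0] keeps the shape of a flattened pair, column 0 being that of the head monomial [W]. *)
have dl0 i1 : i1 < size P ->
    rowid (pmul P ([:: W] ++ T)) (tdl S P [:: W] T) (i1 * (size T).+1 + 0) i1.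
  by move=> lt; apply: rowid_eq (@row_dl1 P [:: W] T i1 0 lt erefl) _ _ => /=;
    lia.
have dl1 i1 i2 : i1 < size P -> i2 < size T ->
    rowid (pmul P ([:: W] ++ T)) (tdl S P [:: W] T)
      (i1 * (size T).+1 + i2.+1) (size P + (i1 * size T + i2)).
  by move=> lt lt2;
    apply: rowid_eq (@row_dl2 P [:: W] T i1 i2 lt lt2) _ _ => /=; lia.
have dli0 j1 : j1 < size Q ->
    rowid (pmul Q [:: W] ++ pmul Q T) (tdli S Q [:: W] T) j1
      (j1 * (size T).+1 + 0).
  by move=> lt; apply: rowid_eq (@row_dli1 Q [:: W] T j1 0 lt erefl) _ _ => /=;
    lia.
have dli1 j1 i2 : j1 < size Q -> i2 < size T ->
    rowid (pmul Q [:: W] ++ pmul Q T) (tdli S Q [:: W] T)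
      (size Q + (j1 * size T + i2)) (j1 * (size T).+1 + i2.+1).
  by move=> lt lt2;
    apply: rowid_eq (@row_dli2 Q [:: W] T j1 i2 lt lt2) _ _ => /=; lia.
rewrite (den_comp_rowid _ _ _ (tty_comp ydl ymid) ydli (@dli_total _ _ _)).
have mid k z : den (tRm W t ⊕ᵗ tR T t) k z f <-> den (tRm W t) k z f \/
   exists k' z', [/\ k = size P + k', z = size Q + z' & den (tR T t) k' z' f].
  by rewrite den_sum; case/ttyP: yR => _ -> ->; rewrite !size_pmulr1.
split.
  case=> k tk rk; have [lti _ _] := den_ty (tty_comp ydl ymid) tk.
  rewrite size_pmul /= in lti; have [i1 [[|i2] [lt1 lt2 ei]]] := pair_split lti.
    move: tk; rewrite ei (rowid_den_comp _ _ ydl ymid (dl0 _ lt1)) mid.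
    case=> [|[k' [z' [e _ _]]]]; last lia.
    case/(den_Rm _ _ _ _ yt)=> g tg le; have [_ ltk _] := den_ty yt tg.
    exists i1, k, 0, g; split=> //.
    exact: row_inj rk (dli0 _ ltk).
  move: tk; rewrite ei (rowid_den_comp _ _ ydl ymid (dl1 _ _ lt1 lt2)) mid.
  case=> [/(den_ty yR)[]|[k'
    [z' [e ez /IH[a1 [b1 [a2 [g [lta ek ez' [tg le]]]]]]]]]].
    by rewrite size_pmulr1; lia.
  have [lta1 ltb1 _] := den_ty yt tg.
  exists a1, b1, a2.+1, g; split=> //.
    have e1 : i1 * size T + i2 = a1 * size T + a2 by lia.
    by have [-> ->] := @pair_inj (size T) _ _ _ _ lt2 lta e1.
  by apply: row_inj rk _; rewrite ez ez'; apply: dli1.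
case=> i1 [j1 [[|i2] [g [lt -> -> [tg le]]]]]; have [lt1 ltj _] := den_ty yt tg.
  exists j1; last exact: dli0.
  rewrite (rowid_den_comp _ _ ydl ymid (dl0 _ lt1)) mid; left.
  by apply/(den_Rm _ _ _ _ yt); exists g.
exists (size Q + (j1 * size T + i2)); last exact: dli1.
rewrite (rowid_den_comp _ _ ydl ymid (dl1 _ _ lt1 lt)) mid; right.
exists (i1 * size T + i2), (j1 * size T + i2); split=> //.
by apply/IH; exists i1, j1, i2, g.
Qed.

(** The middle index is a column of [tL] and a row of [tR]; uniqueness of Euclidean division
    ([pair_inj]) makes the two readings the same pair. Then [tens_rl] fuses the two whiskered
    circuits into [g ⊗ᶜ h]. *)
Lemma den_mul P Q P' Q' t s i j f : tty P Q t -> tty P' Q' s ->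
  den (tmul t s) i j f <-> exists i1 i2 j1 j2 g h,
    [/\ i = i1 * size P' + i2, j = j1 * size Q' + j2, den t i1 j1 g,
        den s i2 j2 h & f ≼ g ⊗ᶜ h].
Proof.
move=> yt ys; rewrite /tmul; case/ttyP: (yt) => _ -> _;
  case/ttyP: (ys) => _ _ ->.
rewrite den_comp; split.
  case=> k [g
    [h [/(den_L _ _ _ _ ys)[i1 [i2 [j2 [s' [lt1 -> ek [ss' lg]]]]]]]]].
  case/(den_R _ _ _ _ yt)=> [a1 [j1 [a2 [t' [lta ek' -> [tt' lh]]]]]] lf.
  have [_ ltj2 [_ ds cs]] := den_ty ys ss';
    have [_ _ [_ dt ct]] := den_ty yt tt'.
  rewrite ek in ek'; have [ea eb] := pair_inj ltj2 lta ek'; subst a1 a2.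
  exists i1, i2, j1, j2, t', s'; split=> //.
  by rewrite lf lg lh -dt -cs tens_rl.
case=> i1 [i2 [j1 [j2 [g [h [-> -> tg sh lf]]]]]].
have [lt1 _ [_ dt ct]] := den_ty yt tg; have [_ lt2 [_ ds cs]] := den_ty ys sh.
exists (i1 * size Q' + j2), (CId (mon P i1) ⊗ᶜ h), (g ⊗ᶜ CId (mon Q' j2));
  split.
- by apply/(den_L _ _ _ _ ys); exists i1, i2, j2, h.
- by apply/(den_R _ _ _ _ yt); exists i1, j1, j2, g.
- by rewrite lf -dt -cs tens_rl.
Qed.

Lemma row_mul P Q P' Q' t s i k j l f g : tty P Q t -> tty P' Q' s ->
    k < size P' -> row t i j f -> row s k l g ->
  row (tmul t s) (i * size P' + k) (j * size Q' + l) (f ⊗ᶜ g).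
Proof.
move=> yt ys ltk rt rs z h; rewrite (den_mul _ _ _ yt ys); split.
  case=> i1 [i2 [j1 [j2 [f' [g' [ei -> tf sg lh]]]]]].
  have [lti2 _ _] := den_ty ys sg.
  have [? ?] := pair_inj ltk lti2 ei; subst i1 i2.
  by case/rt: tf => -> lf; case/rs: sg => -> lg; split=> //; rewrite lh lf lg.
case=> -> lh; exists i, k, j, l, f, g; split=> //; exact: row_den.
Qed.

Lemma zerorow_mul P Q P' Q' t s i k : tty P Q t -> tty P' Q' s ->
    k < size P' -> zerorow t i \/ zerorow s k ->
  zerorow (tmul t s) (i * size P' + k).
Proof.
move=> yt ys ltk z j h; rewrite (den_mul _ _ _ yt ys).
case=> i1 [i2 [j1 [j2 [f' [g' [ei _ tf sg _]]]]]].
have [lti2 _ _] := den_ty ys sg.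
have [? ?] := pair_inj ltk lti2 ei; subst i1 i2.
by case: z => z; [case: (z _ _ tf) | case: (z _ _ sg)].
Qed.

(** * Rows of the ⊗-symmetry and of the ⊗-(co)monoids *)

Lemma row_syms P V i : i < size P -> row (tsyms S P V) i i (CSym (mon P i) V).
Proof.
elim: P i => [|U P IH] // [|i] lt.
  exact: (row_sum1 (s := tsyms S P V) (i := 0) (tty_lift (cty_sym U V)) isT
    (row_lift _)).
exact: (row_sum2 (tty_lift (cty_sym U V)) (IH i lt)).
Qed.

(** The distributor moves the positions over the head of [Q] to the front, where [tsyms] swaps the
    circuits; doing so for each monomial of [Q] transposes the pair of indices. *)
Lemma row_symt P Q i k : i < size P -> k < size Q ->
  row (tsymt S P Q) (i * size Q + k) (k * size P + i)
    (CSym (mon P i) (mon Q k)).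
Proof.
move=> lti; elim: Q k => [|V Q IH] // k ltk.
have ys := tty_syms S P V; have e := mon_pmul lti ltk.
case: k ltk e => [|k] ltk e.
  have r1 := @row_dl1 P [:: V] Q i 0 lti isT.
  have r2 : row (tsyms S P V ⊕ᵗ tsymt S P Q) (i * 1 + 0) i (CSym (mon P i) V).
    apply: row_eq (row_sum1 ys _ (row_syms V lti)) _ erefl; last lia.
    by rewrite size_pmulr1.
  apply: row_eq (row_eqv _ (row_comp r1 r2)) _ _ => //=.
  by rewrite -[_ + size Q]/(size (V :: Q)) e ccomp1l.
have r1 := @row_dl2 P [:: V] Q i k lti ltk.
have r2 := row_sum2 ys (IH k ltk).
rewrite size_pmulr1 size_pmul1 in r2; rewrite muln1 in r1.
apply: row_eq (row_eqv _ (row_comp r1 r2)) _ _ => //=.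
  by rewrite -[_ + (1 + k)]/(i * size (V :: Q) + k.+1) e ccomp1l.
by rewrite /=; lia.
Qed.

(** The off-diagonal blocks of [tccopy] are units, whose source is empty, so no row passes through
    them. *)
Lemma row_ccopy P i : i < size P ->
  row (tccopy S P) i (i * size P + i) (ccopy S (mon P i)).
Proof.
elim: P i => [|U P IH] // i lti.
have yl := tty_lift (cty_copy S U).
have yu Q : tty [::] Q (TUnit Q) by apply/ttyP.
have ydl1 := tty_dli S [:: U] [:: U] P; have ydl2 := tty_dli S P [:: U] P.
have typ : cty (mon (U :: P) i) (mon (U :: P) i + mon (U :: P) i)
  (ccopy S (mon (U :: P) i)) := cty_copy S _.
case: i lti typ => [|i] lti typ /=.
  have r1 : row (TLift (ccopy S U) ⊕ᵗ TUnit (pmul [:: U] P)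
      ⊕ᵗ TUnit (pmul P [:: U]) ⊕ᵗ tccopy S P) 0 0 (ccopy S U).
    by apply: (row_sum1 (i := 0) yl) => //; apply: row_lift.
  have r2 := rowid_sum1 (s := tdli S P [:: U] P)
    (P' := pmul P [:: U] ++ pmul P P)
    ydl1 (@row_dli1 [:: U] [:: U] P 0 0 isT isT).
  apply: row_eqv (row_comp r1 r2).
  by rewrite ccomp1r //=; case: typ.
have r1 := row_sum2 yl (row_sum2 (yu (pmul [:: U] P))
  (row_sum2 (yu (pmul P [:: U])) (IH i lti))).
have r2 := rowid_sum2 ydl1 (@row_dli2 P [:: U] P i i lti lti).
apply: row_eq (row_eqv _ (row_comp (row_eq r1 erefl _) r2)) _ _.
- rewrite mon_cat2 -(size_pmul P [:: U]) mon_cat2 mon_pmul // ccomp1r //.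
  by case: typ.
- by rewrite !size_polyE /=; lia.
- by rewrite /=; lia.
- by rewrite !size_polyE /=; lia.
Qed.

Lemma row_cdisc P i : i < size P -> row (tcdisc S P) i 0 (cdisc S (mon P i)).
Proof.
elim: P i => [|U P IH] // i lti.
have yl := tty_lift (cty_disc S U).
have [_ _ cd] : cty (mon (U :: P) i) 0 (cdisc S (mon (U :: P) i)) :=
  cty_disc S _.
case: i lti cd => [|i] lti cd /=.
  have r1 : row (TLift (cdisc S U) ⊕ᵗ tcdisc S P) 0 0 (cdisc S U).
    by apply: (row_sum1 (i := 0) yl) => //; apply: row_lift.
  by apply: row_eqv (row_comp r1 (@row_merge1 [:: 0] 0 isT)); rewrite ccomp1r.
apply: row_eqv (row_comp (row_sum2 yl (IH i lti)) (@row_merge2 [:: 0] 0 isT)).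
by rewrite ccomp1r.
Qed.

Lemma row_cmerge P i : i < size P ->
  row (tcmerge S P) (i * size P + i) i (cmerge S (mon P i)).
Proof.
elim: P i => [|U P IH] // i lti.
have yl := tty_lift (cty_merge S U).
have yu Q : tty Q [::] (TDisc Q) by apply/ttyP.
have ydl1 := tty_dl S [:: U] [:: U] P; have ydl2 := tty_dl S P [:: U] P.
have typ : cty (mon (U :: P) i + mon (U :: P) i) (mon (U :: P) i)
  (cmerge S (mon (U :: P) i)) := cty_merge S _.
case: i lti typ => [|i] lti typ /=.
  have r1 := rowid_sum1 (s := tdl S P [:: U] P) (P' := pmul P ([:: U] ++ P))
    ydl1 (@row_dl1 [:: U] [:: U] P 0 0 isT isT).
  have r2 : row (TLift (cmerge S U) ⊕ᵗ TDisc (pmul [:: U] P)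
      ⊕ᵗ TDisc (pmul P [:: U]) ⊕ᵗ tcmerge S P) 0 0 (cmerge S U).
    by apply: (row_sum1 (i := 0) yl) => //; apply: row_lift.
  apply: row_eqv (row_comp r1 r2).
  by rewrite ccomp1l //=; case: typ.
have r1 := rowid_sum2 ydl1 (@row_dl2 P [:: U] P i i lti lti).
have r2 := row_sum2 yl (row_sum2 (yu (pmul [:: U] P))
  (row_sum2 (yu (pmul P [:: U])) (IH i lti))).
apply: row_eq (row_eqv _ (row_comp r1 (row_eq r2 _ erefl))) _ _.
- rewrite mon_cat2 mon_pmul // ccomp1l //.
  by case: typ.
- by rewrite !size_polyE /=; lia.
- by rewrite !size_polyE /=; lia.
- by rewrite /=; lia.
Qed.

(** A pair with exactly one index at the head is sent by the distributors into a [TDisc] block; when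
    both indices are in the tail, induction applies. *)
Lemma zerorow_cmerge P i k : i < size P -> k < size P -> i <> k ->
  zerorow (tcmerge S P) (i * size P + k).
Proof.
elim: P i k => [|U P IH] // i k lti ltk ne.
have yl := tty_lift (cty_merge S U).
have yu Q : tty Q [::] (TDisc Q) by apply/ttyP.
have ydl1 := tty_dl S [:: U] [:: U] P.
case: i lti ne => [|i] lti; case: k ltk => [|k] ltk ne //=.
- have r1 := rowid_sum1 (s := tdl S P [:: U] P) (P' := pmul P ([:: U] ++ P))
    ydl1 (@row_dl2 [:: U] [:: U] P 0 k isT ltk).
  apply: zerorow_comp2 r1 _; apply: (zerorow_sum2 (i := k) yl).
  apply: (zerorow_sum1 (yu _)); last exact: zerorow_disc.
  by rewrite size_pmul1.
- have r1 := rowid_sum2 ydl1 (@row_dl1 P [:: U] P i 0 lti isT).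
  have z : zerorow (TDisc (pmul P [:: U]) ⊕ᵗ tcmerge S P) i.
    apply: (zerorow_sum1 (yu _)); last exact: zerorow_disc.
    by rewrite size_pmulr1.
  have z2 := zerorow_sum2 yl (zerorow_sum2 (yu (pmul [:: U] P)) z).
  rewrite (_ : i.+1 * _ + 0 = size (pmul [:: U] ([:: U] ++ P)) +
    (i * (size [:: U] + size P) + 0)); last by rewrite !size_polyE /=; lia.
  apply: zerorow_comp2 (row_eq r1 erefl _) z2.
  by rewrite !size_polyE /=; lia.
have r1 := rowid_sum2 ydl1 (@row_dl2 P [:: U] P i k lti ltk).
have ne' : i <> k by move=> e; apply: ne; rewrite e.
have z := zerorow_sum2 yl (zerorow_sum2 (yu (pmul [:: U] P))
  (zerorow_sum2 (yu (pmul P [:: U])) (IH i k lti ltk ne'))).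
rewrite (_ : i.+1 * _ + k.+1 = size (pmul [:: U] ([:: U] ++ P)) +
    (i * (size [:: U] + size P) + (size [:: U] + k)));
  last by rewrite !size_polyE /=; lia.
apply: zerorow_comp2 (row_eq r1 erefl _) z.
by rewrite !size_polyE /=; lia.
Qed.

(** The only row has an entry in every column, which [row] cannot express; hence the description
    through [den]. *)
Lemma den_cunit P j f :
  den (tcunit S P) 0 j f <-> j < size P /\ f ≼ cunit S (mon P j).
Proof.
have yl U := tty_lift (cty_unit S U).
elim: P j f => [|U P IH] j f /=; first by split=> [[g []]|[]].
rewrite den_comp; split.
  case=> k [g [h [/den_copy[_ ek lg] /den_sum[sh|[i' [j' [e -> sh]]]] le]]].
    have [ltk ltj yh] := den_ty (yl U) sh; case: j sh ltj yh => // sh _ yh.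
    case: sh => h' [_ _ ->] lh; split=> //; rewrite le lg lh ccomp1l //.
    by case: (cty_unit S U).
  have [] := den_ty (tty_cunit S P) sh; case: i' e sh => // e sh _ ltj' yh.
  move/IH: sh => [_ lh]; split=> //=; rewrite le lg lh ccomp1l //.
  by case: (cty_unit S (mon P j')).
case: j => [|j] [ltj le].
  exists 0, (CId 0), (cunit S U); split.
  - by apply/den_copy; split=> //; left.
  - by apply/den_sum; left; exists (cunit S U).
  - by rewrite le ccomp1l //; case: (cty_unit S U).
exists 1, (CId 0), (cunit S (mon P j)); split.
- by apply/den_copy; split=> //; right.
- by apply/den_sum; right; exists 0, j; split=> //; apply/IH.
- by rewrite le ccomp1l //; case: (cty_unit S (mon P j)).
Qed.

(** * Matrices of structural arrows *)

Local Notation ix P := 'I_(size P).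
Local Notation thom := (thom S).
Local Notation C := (TCB_cat S).

Lemma pair_subproof P Q (i : ix P) (k : ix Q) :
  i * size Q + k < size (pmul P Q).
Proof. by rewrite size_pmul; apply: ltn_pair. Qed.

Definition ipair P Q (i : ix P) (k : ix Q) : ix (pmul P Q) :=
  Ordinal (pair_subproof i k).

Lemma il_subproof P Q (i : ix P) : i < size (P ++ Q).
Proof. by rewrite size_cat; apply: ltn_addr. Qed.

Lemma ir_subproof P Q (i : ix Q) : size P + i < size (P ++ Q).
Proof. by rewrite size_cat ltn_add2l. Qed.

Definition il P Q (i : ix P) : ix (P ++ Q) := Ordinal (il_subproof Q i).
Definition ir P Q (i : ix Q) : ix (P ++ Q) := Ordinal (ir_subproof P i).

(** This view and [sum_spec] replace a position in a product or a sum by a symbolic [ipair], [il] or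
    [ir], the forms on which the tactics [rids] and [trows] dispatch. *)
Variant pair_spec P Q : ix (pmul P Q) -> Prop :=
  PairSpec (i : ix P) (k : ix Q) : pair_spec (ipair i k).

Lemma ipairP P Q (x : ix (pmul P Q)) : pair_spec x.
Proof.
have lt := ltn_ord x; rewrite {2}size_pmul in lt.
have [i [k [lti ltk e]]] := pair_split lt.
have -> : x = ipair (Ordinal lti) (Ordinal ltk) by apply: val_inj.
exact: PairSpec.
Qed.

Variant sum_spec P Q : ix (P ++ Q) -> Prop :=
  | SumL (i : ix P) : sum_spec (il Q i)
  | SumR (k : ix Q) : sum_spec (ir P k).

Lemma isumP P Q (x : ix (P ++ Q)) : sum_spec x.
Proof.
have lt := ltn_ord x; rewrite {2}size_cat in lt.
have [lt1|ge] := ltnP x (size P).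
  have -> : x = il Q (Ordinal lt1) by apply: val_inj.
  exact: SumL.
have lt2 : x - size P < size Q by lia.
have -> : x = ir P (Ordinal lt2) by apply: val_inj => /=; lia.
exact: SumR.
Qed.

Lemma hle_den P Q (t s : thom P Q) :
  (forall (i : ix P) (j : ix Q) f, den t i j f -> den s i j f) -> t ≤ s.
Proof.
move=> ts; apply: den_le (thomP t) (thomP s) _ => i j f tf.
have [li lj _] := den_ty (thomP t) tf.
exact: (ts (Ordinal li) (Ordinal lj)).
Qed.

Lemma heq_den P Q (t s : hom (p := C) P Q) :
  (forall (i : ix P) (j : ix Q) f, den (tval t) i j f
    <-> den (tval s) i j f) -> heq t s.
Proof. by move=> ts; split; apply: hle_den => i j f /ts. Qed.

Lemma heq_rows P Q (t s : hom (p := C) P Q) :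
    (forall i : ix P,
      (exists j f g, [/\ row (tval t) i j f, row (tval s) i j g & f ≡ g])
      \/ zerorow (tval t) i /\ zerorow (tval s) i) ->
  heq t s.
Proof.
move=> ts; apply: heq_den => i j f; case: (ts i).
  by case=> j' [g [h [rt rs gh]]]; rewrite rt rs gh.
by case=> zt zs; split=> [/zt|/zs].
Qed.

(** Typed versions of [row] and [rowid] that keep [hcomp], [marr], [dl] and the like visible in
    goals, so that tactics can recurse on the categorical structure instead of raw tapes. *)
Definition trow P Q (t : thom P Q) (i : ix P) (j : ix Q) f := row t i j f.
Definition rid P Q (t : thom P Q) (i : ix P) (j : ix Q) := rowid P t i j.

Lemma heq_rids P Q (t s : hom (p := C) P Q) :
  (forall i : ix P, exists2 j : ix Q, rid t i j & rid s i j) -> heq t s.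
Proof.
move=> ts; apply: heq_rows => i; left; have [j rt rs] := ts i.
by exists j, (CId (mon P i)), (CId (mon P i)); split.
Qed.

Lemma rid_comp P Q R (t : thom P Q) (s : thom Q R) i k j :
  rid t i k -> rid s k j -> @rid P R (hcomp (p := C) t s) i j.
Proof. exact: rowid_comp (thomP t) (thomP s). Qed.

(** A cast is an identity tape whatever the equation [e], so only the numerical values of the two
    positions have to agree. *)
Lemma rid_cast P Q (e : P = Q) (i : ix P) (j : ix Q) :
  i = j :> nat -> rid (tcast S e) i j.
Proof. by move=> ij; rewrite /rid -ij; apply: row_id. Qed.

Lemma rid_id P (i : ix P) : rid (tid S P) i i.
Proof. exact: rid_cast. Qed.

Lemma rid_sum1 P Q P' Q' (t : thom P Q) (s : thom P' Q') i j :
  rid t i j ->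
    @rid (P ++ P') (Q ++ Q') (marr (TCB_add S) t s) (il P' i) (il Q' j).
Proof. exact: rowid_sum1 (thomP t). Qed.

Lemma rid_sum2 P Q P' Q' (t : thom P Q) (s : thom P' Q') i j :
  rid s i j ->
    @rid (P ++ P') (Q ++ Q') (marr (TCB_add S) t s) (ir P i) (ir Q j).
Proof. exact: rowid_sum2 (thomP t). Qed.

Lemma trow_mul P Q P' Q' (t : thom P Q) (s : thom P' Q') i k j l f g :
  trow t i j f -> trow s k l g ->
  @trow (pmul P P') (pmul Q Q') (marr (TCB_mul S) t s) (ipair i k) (ipair j l)
    (f ⊗ᶜ g).
Proof. exact: row_mul (thomP t) (thomP s) (ltn_ord k). Qed.

Lemma mon_pair P Q (i : ix P) (k : ix Q) :
  mon (pmul P Q) (ipair i k) = mon P i + mon Q k.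
Proof. exact: mon_pmul. Qed.

Lemma rid_mul P Q P' Q' (t : thom P Q) (s : thom P' Q') i k j l :
  rid t i j -> rid s k l ->
  @rid (pmul P P') (pmul Q Q') (marr (TCB_mul S) t s) (ipair i k) (ipair j l).
Proof.
move=> rt rs; apply: row_eqv (trow_mul rt rs).
by rewrite mon_pair ctens_id.
Qed.

Lemma rid_alpha P Q R (i : ix P) (k : ix Q) (l : ix R) :
  rid (massoc (TCB_mul S) P Q R) (ipair (ipair i k) l) (ipair i (ipair k l)).
Proof. by apply: rid_cast => /=; rewrite size_pmul; lia. Qed.

Lemma rid_alphai P Q R (i : ix P) (k : ix Q) (l : ix R) :
  rid (massoci (TCB_mul S) P Q R) (ipair i (ipair k l)) (ipair (ipair i k) l).
Proof. by apply: rid_cast => /=; rewrite size_pmul; lia. Qed.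

Definition iunit : ix [:: 0] := ord0.

Lemma iunitP (x : ix [:: 0]) : x = iunit.
Proof. exact: ord1. Qed.

Lemma rid_lam P (i : ix P) : rid (mlam (TCB_mul S) P) (ipair iunit i) i.
Proof. by apply: rid_cast. Qed.

Lemma rid_lami P (i : ix P) : rid (mlami (TCB_mul S) P) i (ipair iunit i).
Proof. by apply: rid_cast. Qed.

Lemma rid_rho P (i : ix P) : rid (mrho (TCB_mul S) P) (ipair i iunit) i.
Proof. by apply: rid_cast => /=; lia. Qed.

Lemma rid_rhoi P (i : ix P) : rid (mrhoi (TCB_mul S) P) i (ipair i iunit).
Proof. by apply: rid_cast => /=; lia. Qed.

Lemma rid_dl1 P Q R (i : ix P) (k : ix Q) :
  rid (@dl (TCB_rig S) P Q R) (ipair i (il R k)) (il (pmul P R) (ipair i k)).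
Proof.
by apply: rowid_eq (@row_dl1 P Q R i k (ltn_ord i) (ltn_ord k)) _ _;
  rewrite //= size_cat.
Qed.

Lemma rid_dl2 P Q R (i : ix P) (k : ix R) :
  rid (@dl (TCB_rig S) P Q R) (ipair i (ir Q k)) (ir (pmul P Q) (ipair i k)).
Proof.
by apply: rowid_eq (@row_dl2 P Q R i k (ltn_ord i) (ltn_ord k)) _ _;
  rewrite //= ?size_cat ?size_pmul.
Qed.

Lemma rid_dli1 P Q R (i : ix P) (k : ix Q) :
  rid (@dli (TCB_rig S) P Q R) (il (pmul P R) (ipair i k)) (ipair i (il R k)).
Proof.
by apply: rowid_eq (@row_dli1 P Q R i k (ltn_ord i) (ltn_ord k)) _ _;
  rewrite //= size_cat.
Qed.

Lemma rid_dli2 P Q R (i : ix P) (k : ix R) :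
  rid (@dli (TCB_rig S) P Q R) (ir (pmul P Q) (ipair i k)) (ipair i (ir Q k)).
Proof.
by apply: rowid_eq (@row_dli2 P Q R i k (ltn_ord i) (ltn_ord k)) _ _;
  rewrite //= ?size_cat ?size_pmul.
Qed.

Lemma rid_dr1 P Q R (i : ix P) (k : ix R) :
  rid (@dr (TCB_rig S) P Q R) (ipair (il Q i) k) (il (pmul Q R) (ipair i k)).
Proof. exact: rid_cast. Qed.

Lemma rid_dr2 P Q R (i : ix Q) (k : ix R) :
  rid (@dr (TCB_rig S) P Q R) (ipair (ir P i) k) (ir (pmul P R) (ipair i k)).
Proof. by apply: rid_cast; rewrite /= size_pmul; lia. Qed.

Lemma rid_dri1 P Q R (i : ix P) (k : ix R) :
  rid (@dri (TCB_rig S) P Q R) (il (pmul Q R) (ipair i k)) (ipair (il Q i) k).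
Proof. exact: rid_cast. Qed.

Lemma rid_dri2 P Q R (i : ix Q) (k : ix R) :
  rid (@dri (TCB_rig S) P Q R) (ir (pmul P R) (ipair i k)) (ipair (ir P i) k).
Proof. by apply: rid_cast; rewrite /= size_pmul; lia. Qed.

Lemma rid_sym1 P Q (i : ix P) : rid (msym (TCB_add S) P Q) (il Q i) (ir Q i).
Proof. exact: (@row_sym1 P Q i (ltn_ord i)). Qed.

Lemma rid_sym2 P Q (i : ix Q) : rid (msym (TCB_add S) P Q) (ir P i) (il P i).
Proof. exact: (@row_sym2 P Q i (ltn_ord i)). Qed.

Lemma trow_symt P Q (i : ix P) (k : ix Q) :
  trow (msym (TCB_mul S) P Q) (ipair i k) (ipair k i)
    (CSym (mon P i) (mon Q k)).
Proof. exact: (@row_symt P Q i k (ltn_ord i) (ltn_ord k)). Qed.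

Lemma rid_aal P Q R (i : ix P) :
  rid (massoc (TCB_add S) P Q R) (il R (il Q i)) (il (Q ++ R) i).
Proof. exact: rid_cast. Qed.

Lemma rid_aam P Q R (i : ix Q) :
  rid (massoc (TCB_add S) P Q R) (il R (ir P i)) (ir P (il R i)).
Proof. exact: rid_cast. Qed.

Lemma rid_aar P Q R (i : ix R) :
  rid (massoc (TCB_add S) P Q R) (ir (P ++ Q) i) (ir P (ir Q i)).
Proof. by apply: rid_cast; rewrite /= size_cat addnA. Qed.

Lemma rid_aali P Q R (i : ix P) :
  rid (massoci (TCB_add S) P Q R) (il (Q ++ R) i) (il R (il Q i)).
Proof. exact: rid_cast. Qed.

Lemma rid_aami P Q R (i : ix Q) :
  rid (massoci (TCB_add S) P Q R) (ir P (il R i)) (il R (ir P i)).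
Proof. exact: rid_cast. Qed.

Lemma rid_aari P Q R (i : ix R) :
  rid (massoci (TCB_add S) P Q R) (ir P (ir Q i)) (ir (P ++ Q) i).
Proof. by apply: rid_cast; rewrite /= size_cat addnA. Qed.

Lemma rid_alam P (i : ix P) : rid (mlam (TCB_add S) P) (ir [::] i) i.
Proof. exact: rid_cast. Qed.

Lemma rid_alami P (i : ix P) : rid (mlami (TCB_add S) P) i (ir [::] i).
Proof. exact: rid_cast. Qed.

Lemma rid_arho P (i : ix P) : rid (mrho (TCB_add S) P) (il [::] i) i.
Proof. exact: rid_cast. Qed.

Lemma rid_arhoi P (i : ix P) : rid (mrhoi (TCB_add S) P) i (il [::] i).
Proof. exact: rid_cast. Qed.

Lemma mon_il P Q (i : ix P) : mon (P ++ Q) (il Q i) = mon P i.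
Proof. exact: (mon_cat1 Q (ltn_ord i)). Qed.

Lemma mon_ir P Q (i : ix Q) : mon (P ++ Q) (ir P i) = mon Q i.
Proof. exact: mon_cat2. Qed.

(** * The laws *)

Lemma TCB_poset_cat : is_poset_cat C.
Proof.
split=> /=.
- by move=> P Q t; split; apply/tle_teq/teq_refl.
- by move=> P Q t s [].
- by move=> P Q t s r [? ?] [? ?]; split; apply: tle_trans; eassumption.
- by move=> P Q t s [].
- by move=> P Q t s r; apply: tle_trans.
- by [].
- by move=> P Q R t t' s s'; apply: tle_comp.
- by move=> P Q R T t s r; apply: teq_teqv; apply: teq_compA.
- by move=> P Q [t] /= /ttyP[_ <- _]; apply: teq_teqv; apply: teq_idl.
- by move=> P Q [t] /= /ttyP[_ _ <-]; apply: teq_teqv; apply: teq_idr.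
Qed.

Lemma thom_dom P Q (t : thom P Q) : tdom t = P.
Proof. by case: t => t /= /ttyP[]. Qed.

Lemma thom_cod P Q (t : thom P Q) : tcod t = Q.
Proof. by case: t => t /= /ttyP[]. Qed.

Lemma teqv_heq P Q (t s : hom (p := C) P Q) : tval t ≃ tval s -> heq t s.
Proof. by []. Qed.

(** Strictness of ⊕ is built into [teq]: the casts are identity tapes, absorbed by the unit laws,
    and the remaining equations are generators of [teq] or follow from identities. *)
Lemma TCB_add_smc : is_symmetric_monoidal (TCB_add S).
Proof.
have D := thom_dom; have E := thom_cod.
split=> [X Y X' Y' f g f' g'|X Y|X Y Z X' Y' Z' f g f' g'
  |X Y Z X' Y' Z' f g h|X Y Z|X Y Z|X Y f|X|X|X Y f|X|X|X Y X' Y' f g|X Y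
  |X Y Z W|X Y|X Y Z] ; try apply: teqv_heq; rewrite /=.
- exact: tle_sum.
- exact: tsum_id.
- by rewrite tsum_comp // ?D ?E.
- by rewrite tcomp1r ?tcomp1l ?tsumA //= ?D ?E ?catA.
- by rewrite tcomp1l //= ?catA.
- by rewrite tcomp1l //= ?catA.
- by rewrite tsum0l tcomp1r ?tcomp1l ?D ?E.
- by rewrite tcomp1l.
- by rewrite tcomp1l.
- by rewrite tsum0r tcomp1r ?tcomp1l ?D ?E ?cats0.
- by rewrite tcomp1l //= cats0.
- by rewrite tcomp1l //= cats0.
- by rewrite tsym_nat ?D ?E.
- exact: tsymK.
- by rewrite !tsum_id !tcomp1l /= ?catA.
- by rewrite !tsum_id tcomp1l /= ?cats0 //.
- rewrite (tcomp1l (P := (X ++ Y) ++ Z)); last by rewrite /= ?catA.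
  rewrite tcomp1r; last by rewrite /= ?catA.
  by rewrite tcomp1r ?thexagon //= catA.
Qed.

Lemma add_mswap X Y Z W :
  tval (mswap (TCB_add S) X Y Z W) ≃ TId X ⊕ᵗ TSym Y Z ⊕ᵗ TId W.
Proof.
rewrite /= tcomp1r; last by rewrite /= ?catA.
rewrite tcomp1l; last by rewrite /= ?catA.
rewrite tcomp1r; last by rewrite /= ?catA.
by rewrite tcomp1l //= ?catA.
Qed.

Lemma TCB_fb : is_fb (TCB_fb_ops S).
Proof.
have D := thom_dom; have E := thom_cod.
split.
- exact: TCB_add_smc.
- split=> [X|X|X|X|||X Y|X Y] ; apply: teqv_heq; rewrite /=.
  + rewrite tcomp1r //= -?catA //; apply/teq_teqv/teq_copyA.
  + by rewrite tcomp1r // tcopy_proj2.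
  + by rewrite tcomp1r //= ?cats0 // tcopy_proj1.
  + exact/teq_teqv/teq_copyC.
  + exact/teq_teqv/teq_copy0.
  + exact/teq_teqv/teq_disc0.
  + by rewrite tcopyD; apply: TComp_teqv => //; symmetry; apply: add_mswap.
  + by rewrite tcomp1r // tdiscD.
- split=> [X|X|X|X|||X Y|X Y] ; apply: teqv_heq; rewrite /=.
  + rewrite tcomp1l //= -?catA //; apply/teq_teqv/teq_mergeA.
  + by rewrite tcomp1l // tmerge_inj2.
  + by rewrite tcomp1l //= ?cats0 // tmerge_inj1.
  + exact/teq_teqv/teq_mergeC.
  + exact/teq_teqv/teq_merge0.
  + exact/teq_teqv/teq_unit0.
  + by rewrite tmergeD; apply: TComp_teqv => //; symmetry; apply: add_mswap.
  + by rewrite tcomp1l // tunitD.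
- by move=> X Y [f yf]; apply: tcopy_nat.
- by move=> X Y [f yf]; apply: tdisc_nat.
- by move=> X Y [f yf]; apply: tmerge_nat.
- by move=> X Y [f yf]; apply: tunit_nat.
Qed.

(** * Entrywise criteria for equations and naturality squares *)

Lemma den_thom P Q (t : thom P Q) i j f : den t i j f ->
  [/\ i < size P, j < size Q & cty (mon P i) (mon Q j) f].
Proof. exact: den_ty (thomP t). Qed.

Lemma den_pair P Q P' Q' (t : thom P Q) (s : thom P' Q')
    (i : ix P) (k : ix P') (j : ix Q) (l : ix Q') f :
  den (tval (marr (TCB_mul S) t s)) (ipair i k) (ipair j l) f
  <-> exists g h, [/\ den t i j g, den s k l h & f ≼ g ⊗ᶜ h].
Proof.
rewrite /= (den_mul _ _ _ (thomP t) (thomP s)); split.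
  case=> i1 [i2 [j1 [j2 [g [h [ei ej tg sh le]]]]]].
  have [_ _ _] := den_thom tg; have [lt1 lt2 _] := den_thom sh.
  have [? ?] := pair_inj (ltn_ord k) lt1 ei.
  have [? ?] := pair_inj (ltn_ord l) lt2 ej.
  by subst i1 i2 j1 j2; exists g, h.
by case=> g [h [tg sh le]]; exists i, k, j, l, g, h.
Qed.

Lemma den_ll P Q P' Q' (t : thom P Q) (s : thom P' Q') (i : ix P) (j : ix Q) f :
  den (tval (marr (TCB_add S) t s)) (il P' i) (il Q' j) f <-> den t i j f.
Proof.
rewrite /= den_sum thom_dom thom_cod; split; last by left.
by case=> // -[i' [j' [/= e _ _]]]; have := ltn_ord i; lia.
Qed.

Lemma den_lr P Q P' Q' (t : thom P Q) (s : thom P' Q') (i : ix P) (j : ix Q') f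
  :
  den (tval (marr (TCB_add S) t s)) (il P' i) (ir Q j) f <-> False.
Proof.
rewrite /= den_sum thom_dom thom_cod; split=> //.
case=> [/den_thom[_ lt _]|[i' [j' [/= e _ _]]]]; first by move: lt => /=; lia.
by have := ltn_ord i; lia.
Qed.

Lemma den_rl P Q P' Q' (t : thom P Q) (s : thom P' Q') (i : ix P') (j : ix Q) f
  :
  den (tval (marr (TCB_add S) t s)) (ir P i) (il Q' j) f <-> False.
Proof.
rewrite /= den_sum thom_dom thom_cod; split=> //.
case=> [/den_thom[lt _ _]|[i' [j' [/= _ e _]]]]; first by move: lt => /=; lia.
by have := ltn_ord j; lia.
Qed.

Lemma den_rr P Q P' Q' (t : thom P Q) (s : thom P' Q') (i : ix P') (j : ix Q')
  f :
  den (tval (marr (TCB_add S) t s)) (ir P i) (ir Q j) f <-> den s i j f.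
Proof.
rewrite /= den_sum thom_dom thom_cod; split.
  case=> [/den_thom[lt _ _]|[i' [j' [/= ei ej]]]]; first by move: lt => /=; lia.
  have -> : i' = i by lia.
  by have -> : j' = j by lia.
by move=> sf; right; exists i, j.
Qed.

(** A naturality square is checked one entry at a time: the structural arrows send [i] to [i'] with
    label [a] and [j] to [j'] with label [b], and the entries on each side must be dominated by some
    on the other. The last premise makes every target column an image, so that no entry of [s] is
    missed. *)
Lemma nat_trow P Q P' Q' (t : hom (p := C) P Q) (u2 : hom (p := C) Q Q')
    (u1 : hom (p := C) P P') (s : hom (p := C) P' Q') :
    (forall (i : ix P) (j : ix Q), exists i' j' a b,
      [/\ trow u1 i i' a, trow u2 j j' b,
          forall f, den (tval t) i j f ->
            exists2 g, den (tval s) i' j' g & f ;ᶜ b ≼ a ;ᶜ g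
        & forall g, den (tval s) i' j' g ->
          exists2 f, den (tval t) i j f & a ;ᶜ g ≼ f ;ᶜ b]) ->
    (forall j' : ix Q', exists (j : ix Q) b, trow u2 j j' b) ->
  t ;; u2 ≈ u1 ;; s.
Proof.
move=> nat onto; apply: heq_den => i j0 f; rewrite /= !den_comp; split.
  case=> k [g [h [tg uh le]]]; have [_ ltk _] := den_thom tg.
  have [i' [j' [a [b [r1 r2 fwd _]]]]] := nat i (Ordinal ltk).
  have [g' sg' le'] := fwd _ tg; case/r2: uh => -> lh.
  exists i', a, g'; split=> //; first exact: row_den r1.
  by rewrite le lh.
case=> k [g [h [ug sh le]]]; have [j [b' r]] := onto j0.
have [i' [j' [a [b [r1 r2 _ bwd]]]]] := nat i j.
have ej : j' = j0 by apply: val_inj; apply: row_inj r2 r.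
subst j0; case/r1: ug => ek lg; subst k.
have [f' tf' le'] := bwd _ sh; exists j, f', b; split=> //;
  first exact: row_den r2.
by rewrite le lg.
Qed.

Lemma nat_rid P Q P' Q' (t : hom (p := C) P Q) (u2 : hom (p := C) Q Q')
    (u1 : hom (p := C) P P') (s : hom (p := C) P' Q') :
    (forall (i : ix P) (j : ix Q), exists i' j',
      [/\ rid u1 i i', rid u2 j j'
        & forall f, den (tval t) i j f <-> den (tval s) i' j' f]) ->
    (forall j' : ix Q', exists j : ix Q, rid u2 j j') ->
  t ;; u2 ≈ u1 ;; s.
Proof.
move=> nat onto; apply: nat_trow => [i j|j']; last first.
  by have [j r] := onto j'; exists j, (CId (mon Q j)).
have [i' [j' [r1 r2 ts]]] := nat i j.
exists i', j', (CId (mon P i)), (CId (mon Q j)).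
have e f : den (tval t) i j f -> f ;ᶜ CId (mon Q j) ≡ CId (mon P i) ;ᶜ f.
  by case/den_thom=> _ _ [_ df cf]; rewrite ccomp1r // ccomp1l.
split=> // f; first by move=> tf; exists f; [apply/ts | rewrite e].
by move/ts=> tf; exists f => //; rewrite e.
Qed.

Lemma den_hcomp P Q R (t : thom P Q) (s : thom Q R) i j f :
  den (tval (hcomp (p := C) t s)) i j f
  <-> exists (k : ix Q) g h, [/\ den t i k g, den s k j h & f ≼ g ;ᶜ h].
Proof.
rewrite /= den_comp; split=> [[k [g [h [tg sh le]]]]|[k [g [h ?]]]].
  by have [_ ltk _] := den_thom tg; exists (Ordinal ltk), g, h.
by exists k, g, h.
Qed.

Lemma trow_comp P Q R (t : thom P Q) (s : thom Q R) i k j f g :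
  trow t i k f -> trow s k j g ->
    trow (P := P) (Q := R) (hcomp (p := C) t s) i j (f ;ᶜ g).
Proof. exact: row_comp. Qed.

Lemma rid_trow P Q (t : thom P Q) i j : rid t i j -> trow t i j (CId (mon P i)).
Proof. by []. Qed.

Lemma heq_trows P Q (t s : hom (p := C) P Q) :
    (forall i : ix P, exists (j : ix Q) f g,
      [/\ trow t i j f, trow s i j g & f ≡ g]) ->
  heq t s.
Proof.
move=> ts; apply: heq_rows => i; left; have [j [f [g ?]]] := ts i.
by exists j, f, g.
Qed.

Lemma trow_sum1 P Q P' Q' (t : thom P Q) (s : thom P' Q') i j f :
  trow t i j f ->
  trow (P := P ++ P') (Q := Q ++ Q') (marr (TCB_add S) t s) (il P' i) (il Q' j)
    f.
Proof. exact: row_sum1 (thomP t) (ltn_ord i). Qed.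

Lemma trow_sum2 P Q P' Q' (t : thom P Q) (s : thom P' Q') i j f :
  trow s i j f ->
  trow (P := P ++ P') (Q := Q ++ Q') (marr (TCB_add S) t s) (ir P i) (ir Q j) f.
Proof. exact: row_sum2 (thomP t). Qed.

Local Notation B := (TCB_cb_ops S).

Lemma trow_copy P (i : ix P) :
  trow (copy B P) i (ipair i i) (ccopy S (mon P i)).
Proof. exact: row_ccopy (ltn_ord i). Qed.

Lemma trow_disc P (i : ix P) : trow (disc B P) i iunit (cdisc S (mon P i)).
Proof. exact: row_cdisc (ltn_ord i). Qed.

Lemma trow_merge P (i : ix P) :
  trow (merge B P) (ipair i i) i (cmerge S (mon P i)).
Proof. exact: row_cmerge (ltn_ord i). Qed.

Definition tzero P Q (t : thom P Q) (i : ix P) := zerorow t i.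

Local Notation A := (TCB_fb_ops S).

Lemma rid_merge1 P (i : ix P) : rid (merge A P) (il P i) i.
Proof. exact: row_merge1 (ltn_ord i). Qed.

Lemma rid_merge2 P (i : ix P) : rid (merge A P) (ir P i) i.
Proof. exact: row_merge2 (ltn_ord i). Qed.

Lemma tzero_bang P (i : ix P) : tzero (disc A P) i.
Proof. exact: zerorow_disc. Qed.

Lemma tzero_merge P (i k : ix P) : i <> k -> tzero (merge B P) (ipair i k).
Proof.
move=> ne; apply: zerorow_cmerge (ltn_ord i) (ltn_ord k) _ => e.
exact/ne/val_inj.
Qed.

Lemma tzero_comp1 P Q R (t : thom P Q) (s : thom Q R) i :
  tzero t i -> tzero (P := P) (Q := R) (hcomp (p := C) t s) i.
Proof. exact: zerorow_comp1. Qed.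

Lemma tzero_comp2 P Q R (t : thom P Q) (s : thom Q R) i k f :
  trow t i k f -> tzero s k -> tzero (P := P) (Q := R) (hcomp (p := C) t s) i.
Proof. exact: zerorow_comp2. Qed.

Lemma tzero_mul1 P Q P' Q' (t : thom P Q) (s : thom P' Q') i k :
  tzero t i ->
  tzero (P := pmul P P') (Q := pmul Q Q') (marr (TCB_mul S) t s) (ipair i k).
Proof.
by move=> z; apply: zerorow_mul (thomP t) (thomP s) (ltn_ord k) _; left.
Qed.

Lemma tzero_mul2 P Q P' Q' (t : thom P Q) (s : thom P' Q') i k :
  tzero s k ->
  tzero (P := pmul P P') (Q := pmul Q Q') (marr (TCB_mul S) t s) (ipair i k).
Proof.
by move=> z; apply: zerorow_mul (thomP t) (thomP s) (ltn_ord k) _; right.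
Qed.

Lemma tzero_sum1 P Q P' Q' (t : thom P Q) (s : thom P' Q') i : tzero t i ->
  tzero (P := P ++ P') (Q := Q ++ Q') (marr (TCB_add S) t s) (il P' i).
Proof. exact: zerorow_sum1 (thomP t) (ltn_ord i). Qed.

Lemma tzero_sum2 P Q P' Q' (t : thom P Q) (s : thom P' Q') i : tzero s i ->
  tzero (P := P ++ P') (Q := Q ++ Q') (marr (TCB_add S) t s) (ir P i).
Proof. exact: zerorow_sum2 (thomP t). Qed.

Lemma den_unit P (j : ix P) f :
  den (tval (unit B P)) iunit j f <-> f ≼ cunit S (mon P j).
Proof. by rewrite /= den_cunit ltn_ord; split=> [[]|]. Qed.

Lemma den_comp_row P Q R (t : thom P Q) (s : thom Q R) (i : ix P) k (j : ix R)
  g f :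
  trow t i k g ->
  den (tval (hcomp (p := C) t s)) i j f <-> exists2 h, den s k j h & f ≼ g ;ᶜ h.
Proof. exact: row_den_comp. Qed.

(** Off-diagonal rows of the merge vanish, so the middle index must be the pair of [j] with
    itself. *)
Lemma den_comp_merge P Q (t : thom P (pmul Q Q)) (i : ix P) (j : ix Q) f :
  den (tval (hcomp (p := C) t (merge B Q))) i j f
  <-> exists2 g, den t i (ipair j j) g & f ≼ g ;ᶜ cmerge S (mon Q j).
Proof.
rewrite den_hcomp; split.
  case=> k [g [h [tg mh le]]]; case: (ipairP k) tg mh => k1 k2 {k} tg.
  case: (k1 =P k2) tg => [<-|ne] tg; last by move/(tzero_merge ne).
  by case/trow_merge=> /val_inj -> lh; exists g => //; rewrite le lh.
case=> g tg le; exists (ipair j j), g, (cmerge S (mon Q j)); split=> //.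
exact: row_den (trow_merge j).
Qed.

(** Traces a position through a composite of relabellings, choosing the row lemma by the form of the
    position. The target is an existential variable: one side of an equation fixes it, and the other
    side must arrive there. *)
Ltac rids :=
  lazymatch goal with
  | |- rid (hcomp _ _) _ _ => eapply rid_comp; [rids | rids]
  | |- rid (idm _) _ _ => eapply rid_id
  | |- rid (marr (TCB_mul _) _ _) _ _ => eapply rid_mul; [rids | rids]
  | |- rid (marr (TCB_add _) _ _) (il _ _) _ => eapply rid_sum1; rids
  | |- rid (marr (TCB_add _) _ _) (ir _ _) _ => eapply rid_sum2; rids
  | |- rid (massoc (TCB_mul _) _ _ _) _ _ => eapply rid_alpha
  | |- rid (massoci (TCB_mul _) _ _ _) _ _ => eapply rid_alphai
  | |- rid (mlam (TCB_mul _) _) _ _ => eapply rid_lam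
  | |- rid (mlami (TCB_mul _) _) _ _ => eapply rid_lami
  | |- rid (mrho (TCB_mul _) _) _ _ => eapply rid_rho
  | |- rid (mrhoi (TCB_mul _) _) _ _ => eapply rid_rhoi
  | |- rid (dl _ _ _) (ipair _ (il _ _)) _ => eapply rid_dl1
  | |- rid (dl _ _ _) (ipair _ (ir _ _)) _ => eapply rid_dl2
  | |- rid (dli _ _ _) (il _ _) _ => eapply rid_dli1
  | |- rid (dli _ _ _) (ir _ _) _ => eapply rid_dli2
  | |- rid (dr _ _ _) (ipair (il _ _) _) _ => eapply rid_dr1
  | |- rid (dr _ _ _) (ipair (ir _ _) _) _ => eapply rid_dr2
  | |- rid (dri _ _ _) (il _ _) _ => eapply rid_dri1
  | |- rid (dri _ _ _) (ir _ _) _ => eapply rid_dri2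
  | |- rid (msym (TCB_add _) _ _) (il _ _) _ => eapply rid_sym1
  | |- rid (msym (TCB_add _) _ _) (ir _ _) _ => eapply rid_sym2
  | |- rid (massoc (TCB_add _) _ _ _) (il _ (il _ _)) _ => eapply rid_aal
  | |- rid (massoc (TCB_add _) _ _ _) (il _ (ir _ _)) _ => eapply rid_aam
  | |- rid (massoc (TCB_add _) _ _ _) (ir _ _) _ => eapply rid_aar
  | |- rid (massoci (TCB_add _) _ _ _) (il _ _) _ => eapply rid_aali
  | |- rid (massoci (TCB_add _) _ _ _) (ir _ (il _ _)) _ => eapply rid_aami
  | |- rid (massoci (TCB_add _) _ _ _) (ir _ (ir _ _)) _ => eapply rid_aari
  | |- rid (merge (TCB_fb_ops _) _) (il _ _) _ => eapply rid_merge1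
  | |- rid (merge (TCB_fb_ops _) _) (ir _ _) _ => eapply rid_merge2
  | |- rid (mlam (TCB_add _) _) _ _ => eapply rid_alam
  | |- rid (mlami (TCB_add _) _) _ _ => eapply rid_alami
  | |- rid (mrho (TCB_add _) _) _ _ => eapply rid_arho
  | |- rid (mrhoi (TCB_add _) _) _ _ => eapply rid_arhoi
  end.

(** As [rids], but the circuit met along the path is collected as well, which leaves an equivalence
    of two circuits to prove. *)
Ltac trows :=
  lazymatch goal with
  | |- trow (hcomp _ _) _ _ _ => eapply trow_comp; [trows | trows]
  | |- trow (marr (TCB_mul _) _ _) _ _ _ => eapply trow_mul; [trows | trows]
  | |- trow (marr (TCB_add _) _ _) (il _ _) _ _ => eapply trow_sum1; trows
  | |- trow (marr (TCB_add _) _ _) (ir _ _) _ _ => eapply trow_sum2; trows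
  | |- trow (msym (TCB_mul _) _ _) _ _ _ => eapply trow_symt
  | |- trow (copy (TCB_cb_ops _) _) _ _ _ => eapply trow_copy
  | |- trow (disc (TCB_cb_ops _) _) _ _ _ => eapply trow_disc
  | |- trow (merge (TCB_cb_ops _) _) _ _ _ => eapply trow_merge
  | |- trow _ _ _ _ => eapply rid_trow; rids
  end.

Lemma TCB_mul_smc : is_symmetric_monoidal (TCB_mul S).
Proof.
split=> [X Y X' Y' f g f' g'|X Y|X Y Z X' Y' Z' f g f' g'
  |X Y Z X' Y' Z' f g h|X Y Z|X Y Z|X Y f|X|X|X Y f|X|X|X Y X' Y' f g|X Y
  |X Y Z W|X Y|X Y Z].
(* Monotonicity of ⊗ is a closure rule of the order. *)
- case: f g f' g' => [f yf] [g yg] [f' yf'] [g' yg'] /= fg fg'.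
  by apply: tle_mul => //; [case/ttyP: yf | case/ttyP: yf'].
- apply: heq_rids => x; case: (ipairP x) => i k {x}.
  by eexists; rids.
(* Interchange concerns arbitrary arrows, so it is checked on entries: the middle index on one side
   is the pair of middle indices on the other. *)
- apply: heq_den => x y e.
  case: (ipairP x) => i i' {x}; case: (ipairP y) => k k' {y}.
  rewrite den_pair den_hcomp; split.
    case=> a [b
      [/den_hcomp[j [p [q [fp gq le]]]] /den_hcomp[j' [p' [q' [fp' gq' le']]]]
        l]].
    exists (ipair j j'), (p ⊗ᶜ p'), (q ⊗ᶜ q'); split.
    + by apply/den_pair; exists p, p'.
    + by apply/den_pair; exists q, q'.
    + have [_ _ [_ _ cp]] := den_thom fp; have [_ _ [_ _ cp']] := den_thom fp'.
      have [_ _ [_ dq _]] := den_thom gq; have [_ _ [_ dq' _]] := den_thom gq'.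
      by rewrite l le le' ctens_comp ?cp ?dq ?cp' ?dq'.
  case=> z [a [b [da db l]]]; case: (ipairP z) da db => j j' {z}.
  case/den_pair=> p [p' [fp fp' la]] /den_pair[q [q' [gq gq' lb]]].
  have [_ _ [_ _ cp]] := den_thom fp; have [_ _ [_ _ cp']] := den_thom fp'.
  have [_ _ [_ dq _]] := den_thom gq; have [_ _ [_ dq' _]] := den_thom gq'.
  exists (p ;ᶜ q), (p' ;ᶜ q'); split.
  + by apply/den_hcomp; exists j, p, q.
  + by apply/den_hcomp; exists j', p', q'.
  + by rewrite l la lb ctens_comp ?cp ?dq ?cp' ?dq'.
- apply: nat_rid => [x y|x].
    case: (ipairP x) => x' x3 {x}; case: (ipairP x') => x1 x2 {x'}.
    case: (ipairP y) => y' y3 {y}; case: (ipairP y') => y1 y2 {y'}.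
    eexists; eexists; split; [rids|rids|].
    move=> e; rewrite !den_pair; split.
      case=> p [p3 [/den_pair[p1 [p2 [d1 d2 l]]] d3 l']].
      exists p1, (p2 ⊗ᶜ p3); split=> //; last by rewrite l' l ctensA.
      by apply/den_pair; exists p2, p3.
    case=> p1 [p [d1 /den_pair[p2 [p3 [d2 d3 l]]] l']].
    exists (p1 ⊗ᶜ p2), p3; split=> //; last by rewrite l' l ctensA.
    by apply/den_pair; exists p1, p2.
  case: (ipairP x) => x1 x' {x}; case: (ipairP x') => x2 x3 {x'}.
  by eexists; rids.
- apply: heq_rids => x; case: (ipairP x) => x' x3 {x};
    case: (ipairP x') => x1 x2 {x'}.
  by eexists; rids.
- apply: heq_rids => x; case: (ipairP x) => x1 x' {x};
    case: (ipairP x') => x2 x3 {x'}.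
  by eexists; rids.
- apply: nat_rid => [x y|x]; last by eexists; rids.
  case: (ipairP x) => o x' {x}; case: (ipairP y) => o' y' {y}.
  rewrite (iunitP o) (iunitP o'); eexists; eexists; split; [rids|rids|].
  move=> e; rewrite den_pair; split.
    case=> p [q [[p' [_ _ ->] lp] dq l]]; apply: den_down dq.
    by rewrite l lp tens0l.
  move=> de; exists (CId 0), e; split=> //; last by rewrite tens0l.
  by exists (CId 0).
- apply: heq_rids => x; case: (ipairP x) => o x' {x}; rewrite (iunitP o).
  by eexists; rids.
- by apply: heq_rids => x; eexists; rids.
- apply: nat_rid => [x y|x]; last by eexists; rids.
  case: (ipairP x) => x' o {x}; case: (ipairP y) => y' o' {y}.
  rewrite (iunitP o) (iunitP o'); eexists; eexists; split; [rids|rids|].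
  move=> e; rewrite den_pair; split.
    case=> p [q [dp [q' [_ _ ->] lq] l]]; apply: den_down dp.
    by rewrite l lq tens0r.
  move=> de; exists e, (CId 0); split=> //; last by rewrite tens0r.
  by exists (CId 0).
- apply: heq_rids => x; case: (ipairP x) => x' o {x}; rewrite (iunitP o).
  by eexists; rids.
- by apply: heq_rids => x; eexists; rids.
- apply: nat_trow => [x y|x].
    case: (ipairP x) => x1 x2 {x}; case: (ipairP y) => y1 y2 {y}.
    eexists; eexists; eexists; eexists; split; [trows|trows| |].
      move=> e /den_pair[p [q [dp dq l]]]; exists (q ⊗ᶜ p).
        by apply/den_pair; exists q, p.
      have [_ _ yp] := den_thom dp; have [_ _ yq] := den_thom dq.
      by rewrite l (csym_nat yp yq).
    move=> e /den_pair[q [p [dq dp l]]]; exists (p ⊗ᶜ q).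
      by apply/den_pair; exists p, q.
    have [_ _ yp] := den_thom dp; have [_ _ yq] := den_thom dq.
    by rewrite l (csym_nat yp yq).
  case: (ipairP x) => x1 x2 {x}.
  by eexists; eexists; trows.
- apply: heq_trows => x; case: (ipairP x) => x1 x2 {x}.
  do 3!eexists; split; [trows|trows|].
  by rewrite csymK mon_pair.
- apply: heq_rids => x; case: (ipairP x) => x' x4 {x};
    case: (ipairP x') => x'' x3 {x'}.
  by case: (ipairP x'') => x1 x2 {x''}; eexists; rids.
- apply: heq_rids => x; case: (ipairP x) => x' x2 {x};
    case: (ipairP x') => x1 o {x'}.
  by rewrite (iunitP o); eexists; rids.
- apply: heq_trows => x; case: (ipairP x) => x' x3 {x};
    case: (ipairP x') => x1 x2 {x'}.
  do 3!eexists; split; [trows|trows|].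
  rewrite !mon_pair csym_addr ccomp1r ?ccomp1l ?ccomp1r //=; lia.
Qed.

(** * Distributors, annihilators and Laplaza coherence *)

Lemma heq_from0 P (t s : hom (p := C) [::] P) : heq t s.
Proof. by apply: heq_den => -[]. Qed.

Lemma heq_to0 P (t s : hom (p := C) P [::]) : heq t s.
Proof. by apply: heq_den => i []. Qed.

Lemma pmul0P P (x : ix (pmul P [::])) : False.
Proof. by case: (ipairP x) => ? []. Qed.

(** Conditions 10 to 18 end in 0, where parallel arrows agree by [heq_to0]. In the others both sides
    move each position to the same place with identity labels, except for condition 2, where the
    ⊗-symmetries contribute symmetry circuits. *)
Lemma TCB_laplaza : laplaza_coherence (TCB_rig S).
Proof.
split=> [A B D|A B D|A B D|A B D E|A B D E|A B D E|A B D E|A B D E|A B D E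
  ||A B|A B|||A|A B|A B|A B|A B|A B|A B|A B|A B|A B];
  try exact: heq_to0; cbn [add mul rig_cat TCB_rig mswap].
- apply: heq_rids => x; case: (ipairP x) => a y {x}.
  by case: (isumP y) => b; eexists; rids.
- apply: heq_trows => x; case: (ipairP x) => y d {x}.
  case: (isumP y) => b; do 3!eexists; (split; [trows|trows|]).
    by rewrite !(mon_pair, mon_il) ccomp1r ?ccomp1l //= addnC.
  by rewrite !(mon_pair, mon_ir) ccomp1r ?ccomp1l //= addnC.
- apply: heq_rids => x; case: (ipairP x) => y d {x}.
  by case: (isumP y) => b; eexists; rids.
- apply: heq_rids => x; case: (ipairP x) => y d {x}.
  case: (isumP y) => [z|b]; last by eexists; rids.
  by case: (isumP z) => b; eexists; rids.
- apply: heq_rids => x; case: (ipairP x) => a y {x}.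
  case: (isumP y) => [z|b]; last by eexists; rids.
  by case: (isumP z) => b; eexists; rids.
- apply: heq_rids => x; case: (ipairP x) => y z {x};
    case: (ipairP y) => a b {y}.
  by case: (isumP z) => d; eexists; rids.
- apply: heq_rids => x; case: (ipairP x) => y e {x};
    case: (ipairP y) => z d {y}.
  by case: (isumP z) => b; eexists; rids.
- apply: heq_rids => x; case: (ipairP x) => y e {x};
    case: (ipairP y) => a z {y}.
  by case: (isumP z) => b; eexists; rids.
- rewrite /mswap; apply: heq_rids => x; case: (ipairP x) => y z {x}.
  by case: (isumP y) => a; case: (isumP z) => d; eexists; rids.
- apply: heq_rids => x; case: (ipairP x) => a y {x}.
  by case: (isumP y) => [[]|b] //; eexists; rids.
- apply: heq_rids => x; case: (ipairP x) => y a {x}.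
  by case: (isumP y) => [[]|b] //; eexists; rids.
- apply: heq_rids => x; case: (ipairP x) => a y {x}.
  by case: (isumP y) => [b|[]] //; eexists; rids.
- apply: heq_rids => x; case: (ipairP x) => y b {x}.
  by case: (isumP y) => [a|[]] //; eexists; rids.
- apply: heq_rids => x; case: (ipairP x) => o y {x}; rewrite (iunitP o).
  by case: (isumP y) => b; eexists; rids.
- apply: heq_rids => x; case: (ipairP x) => y o {x}; rewrite (iunitP o).
  by case: (isumP y) => b; eexists; rids.
Qed.

Lemma TCB_is_rig : is_rig (TCB_rig S).
Proof.
split.
- exact: TCB_poset_cat.
- exact: TCB_add_smc.
- exact: TCB_mul_smc.
- move=> X Y Z X' Y' Z' f g h; cbn [add mul rig_cat TCB_rig].
  apply: nat_rid => [x y|x].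
    case: (ipairP x) => x1 x' {x}; case: (ipairP y) => y1 y' {y}.
    case: (isumP x') => x2; case: (isumP y') => y2;
      eexists; eexists; (split; [rids|rids|]) => e.
    + rewrite den_ll !den_pair.
      by split=> -[p [q [dp /den_ll dq l]]]; exists p, q; split=> //;
        apply/den_ll.
    + by rewrite den_lr den_pair; split=> // -[p [q [_ /den_lr]]].
    + by rewrite den_rl den_pair; split=> // -[p [q [_ /den_rl]]].
    + rewrite den_rr !den_pair.
      by split=> -[p [q [dp /den_rr dq l]]]; exists p, q; split=> //;
        apply/den_rr.
  case: (isumP x) => z; case: (ipairP z) => x1 x2 {z}.
    by exists (ipair x1 (il Z' x2)); rids.
  by exists (ipair x1 (ir Y' x2)); rids.
- move=> X Y Z; cbn [add mul rig_cat TCB_rig].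
  apply: heq_rids => x; case: (ipairP x) => a y {x}.
  by case: (isumP y) => b; eexists; rids.
- move=> X Y Z; cbn [add mul rig_cat TCB_rig].
  apply: heq_rids => x; case: (isumP x) => y {x}; case: (ipairP y) => a b;
  by eexists; rids.
- move=> X Y Z X' Y' Z' f g h; cbn [add mul rig_cat TCB_rig].
  apply: nat_rid => [x y|x].
    case: (ipairP x) => x' x2 {x}; case: (ipairP y) => y' y2 {y}.
    case: (isumP x') => x1; case: (isumP y') => y1;
      eexists; eexists; (split; [rids|rids|]) => e.
    + rewrite den_ll !den_pair.
      by split=> -[p [q [/den_ll dp dq l]]]; exists p, q; split=> //;
        apply/den_ll.
    + by rewrite den_lr den_pair; split=> // -[p [q [/den_lr]]].
    + by rewrite den_rl den_pair; split=> // -[p [q [/den_rl]]].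
    + rewrite den_rr !den_pair.
      by split=> -[p [q [/den_rr dp dq l]]]; exists p, q; split=> //;
        apply/den_rr.
  case: (isumP x) => z; case: (ipairP z) => x1 x2 {z}.
    by exists (ipair (il Y' x1) x2); rids.
  by exists (ipair (ir X' x1) x2); rids.
- move=> X Y Z; cbn [add mul rig_cat TCB_rig].
  apply: heq_rids => x; case: (ipairP x) => y a {x}.
  by case: (isumP y) => b; eexists; rids.
- move=> X Y Z; cbn [add mul rig_cat TCB_rig].
  apply: heq_rids => x; case: (isumP x) => y {x}; case: (ipairP y) => a b;
  by eexists; rids.
- by move=> X Y f; apply: heq_to0.
- by move=> X; apply: heq_from0.
- by move=> X; apply: heq_to0.
- by move=> X Y f; apply: heq_to0.
- by move=> X; apply: heq_rids => x; case: (pmul0P x).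
- by move=> X; apply: heq_to0.
- exact: TCB_laplaza.
Qed.

(** * The cartesian bicategory structure *)

Lemma cdom_copy n : cdom (ccopy S n) = n. Proof. by case: (cty_copy S n). Qed.
Lemma ccod_copy n :
  ccod (ccopy S n) = n + n. Proof. by case: (cty_copy S n). Qed.
Lemma cdom_disc n : cdom (cdisc S n) = n. Proof. by case: (cty_disc S n). Qed.
Lemma ccod_disc n : ccod (cdisc S n) = 0. Proof. by case: (cty_disc S n). Qed.
Lemma cdom_merge n :
  cdom (cmerge S n) = n + n. Proof. by case: (cty_merge S n). Qed.
Lemma ccod_merge n :
  ccod (cmerge S n) = n. Proof. by case: (cty_merge S n). Qed.
Lemma cdom_unit n : cdom (cunit S n) = 0. Proof. by case: (cty_unit S n). Qed.
Lemma ccod_unit n : ccod (cunit S n) = n. Proof. by case: (cty_unit S n). Qed.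

Definition ctyE := (cdom_copy, ccod_copy, cdom_disc, ccod_disc, cdom_merge,
  ccod_merge, cdom_unit, ccod_unit).
Definition monE := (mon_pair, mon_il, mon_ir).

Ltac cty_tac := by rewrite /= ?ctyE; lia.

(** The left-hand side is the circuit that [trows] collects along [mswap], each cast contributing an
    identity. *)
Lemma mswap_label a b c d :
  CId (a + b + (c + d)) ;ᶜ CId a
    ⊗ᶜ (CId (b + (c + d)) ;ᶜ CSym b c ⊗ᶜ CId d ;ᶜ CId (c + b + d))
    ;ᶜ CId (a + (c + (b + d)))
  ≡ CId a ⊗ᶜ CSym b c ⊗ᶜ CId d.
Proof.
rewrite ccomp1r; last by rewrite /=; lia.
rewrite ccomp1l; last by rewrite /=; lia.
rewrite ccomp1r; last by rewrite /=; lia.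
by rewrite ccomp1l ?ctensA //=; lia.
Qed.

Lemma trow_eqv P Q (t : thom P Q) i j f g : trow t i j f -> f ≡ g ->
  trow t i j g.
Proof. by move=> r fg; apply: row_eqv r. Qed.

Lemma trow_mswap X Y Z W (x : ix X) (y : ix Y) (z : ix Z) (w : ix W) :
  trow (mswap (TCB_mul S) X Y Z W) (ipair (ipair x y) (ipair z w))
    (ipair (ipair x z) (ipair y w))
    (CId (mon X x) ⊗ᶜ CSym (mon Y y) (mon Z z) ⊗ᶜ CId (mon W w)).
Proof.
eapply trow_eqv; first by rewrite /mswap; trows.
by rewrite !monE mswap_label.
Qed.

(** All arrows involved have exactly one entry per row, so the laws reduce to statements about
    words; for [copy_mob] and [disc_mob] these are [ccopy_add] and [cdisc_add]. *)
Lemma TCB_comonoids : are_coherent_comonoids B.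
Proof.
split=> [X|X|X|X|||X Y|X Y]; apply: heq_trows => x.
- do 3!eexists; split; [trows|trows|].
  rewrite !monE ccomp1r; last cty_tac.
  exact/ax_ceqv/cbe_copyA.
- do 3!eexists; split; [trows|trows|].
  rewrite !monE ccomp1r; last cty_tac.
  exact/ax_ceqv/cbe_copy_discl.
- do 3!eexists; split; [trows|trows|].
  rewrite !monE ccomp1r; last cty_tac.
  exact/ax_ceqv/cbe_copy_discr.
- do 3!eexists; split; [trows|trows|].
  exact/ax_ceqv/cbe_copyC.
- rewrite (iunitP x); do 3!eexists; split; [trows|trows|]; by [].
- rewrite (iunitP x); do 3!eexists; split; [trows|trows|]; by [].
- case: (ipairP x) => a b {x}.
  do 3!eexists; split; [trows| |].
    by eapply trow_comp; [trows | exact: trow_mswap].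
  by rewrite !monE ccopy_add.
- case: (ipairP x) => a b {x}.
  do 3!eexists; split; [trows|trows|].
  by rewrite !monE cdisc_add ccomp1r //= !ctyE.
Qed.

(** Searches for the factor at which a row becomes zero, following nonzero rows through the factors
    before it. *)
Ltac tzeros :=
  lazymatch goal with
  | |- tzero (hcomp _ _) _ =>
      first [eapply tzero_comp1; tzeros | eapply tzero_comp2; [trows | tzeros]]
  | |- tzero (marr (TCB_mul _) _ _) _ =>
      first [eapply tzero_mul1; tzeros | eapply tzero_mul2; tzeros]
  | |- tzero (marr (TCB_add _) _ _) (il _ _) => eapply tzero_sum1; tzeros
  | |- tzero (marr (TCB_add _) _ _) (ir _ _) => eapply tzero_sum2; tzeros
  | |- tzero (merge (TCB_cb_ops _) _) _ => eapply tzero_merge; eassumption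
  | |- tzero (disc (TCB_fb_ops _) _) _ => eapply tzero_bang
  end.

Lemma heq_partial P Q (t s : hom (p := C) P Q) :
    (forall i : ix P, (exists (j : ix Q) f g,
      [/\ trow t i j f, trow s i j g & f ≡ g]) \/ tzero t i /\ tzero s i) ->
  heq t s.
Proof.
move=> ts; apply: heq_rows => i.
by case: (ts i) => [[j [f [g ?]]]|]; [left; exists j, f, g | right].
Qed.

Lemma pair_ord_inj P Q (i i' : ix P) (k k' : ix Q) :
  ipair i k = ipair i' k' -> i = i' /\ k = k'.
Proof.
move/(congr1 val)/(pair_inj (ltn_ord k) (ltn_ord k')) => [ei ek].
by split; apply: val_inj.
Qed.

Lemma TCB_monoids : are_coherent_monoids B.
Proof.
split=> [X|X|X|X|||X Y|X Y].
- apply: heq_partial => x; case: (ipairP x) => y c {x};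
    case: (ipairP y) => a b {y}.
  (* When [a] and [b] differ, the left side vanishes at its first merge; the right side vanishes at
     the inner merge or, if [b] equals [c], at the outer one. *)
  case: (a =P b) => [<-|ne]; last by case: (b =P c) => [<-|ne']; right; split;
    tzeros.
  case: (a =P c) => [<-|ne]; last by right; split; tzeros.
  left; do 3!eexists; split; [trows|trows|].
  rewrite !monE ccomp1l; last cty_tac.
  exact/ax_ceqv/cbe_mergeA.
(* The unit has an entry in every column, but the identity factor pins the second index to [x], so
   the merge only meets the pair of [x] with itself. *)
- apply: heq_den => x y f; rewrite den_comp_merge.
  have r : rid (mlami (TCB_mul S) X) x (ipair iunit x) by exact: rid_lami.
  have ri : rid (idm (p := C) X) x x by exact: rid_id.
  have ax : cunit S (mon X y) ⊗ᶜ CId (mon X y) ;ᶜ cmerge S (mon X y)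
    ≡ CId (mon X y).
    exact/ax_ceqv/cbe_merge_unitl.
  rewrite (ri y f); split.
    case=> g /(den_comp_row _ _ _ r)[h
      /den_pair[p [q [/den_unit lp /ri[ey lq] lh]]] lg] l.
    have exy : y = x by apply: val_inj.
    subst y; split=> //; rewrite l lg lh lp lq ccomp1l ?ax //; cty_tac.
  case=> e l; have exy : x = y by apply: val_inj.
  subst y; exists (cunit S (mon X x) ⊗ᶜ CId (mon X x)); last by rewrite l ax.
  apply/(den_comp_row _ _ _ r); eexists; last by rewrite ccomp1l // /= ctyE.
  apply/den_pair; exists (cunit S (mon X x)), (CId (mon X x)).
  by split=> //; [apply/den_unit | apply/ri].
- apply: heq_den => x y f; rewrite den_comp_merge.
  have r : rid (mrhoi (TCB_mul S) X) x (ipair x iunit) by exact: rid_rhoi.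
  have ri : rid (idm (p := C) X) x x by exact: rid_id.
  have ax : CId (mon X y) ⊗ᶜ cunit S (mon X y) ;ᶜ cmerge S (mon X y)
    ≡ CId (mon X y).
    exact/ax_ceqv/cbe_merge_unitr.
  rewrite (ri y f); split.
    case=> g /(den_comp_row _ _ _ r)[h
      /den_pair[p [q [/ri[ey lp] /den_unit lq lh]]] lg] l.
    have exy : y = x by apply: val_inj.
    subst y; rewrite l lg lh lp lq ccomp1l ?ax //; cty_tac.
  case=> e l; have exy : x = y by apply: val_inj.
  subst y; exists (CId (mon X x) ⊗ᶜ cunit S (mon X x)); last by rewrite l ax.
  apply/(den_comp_row _ _ _ r); eexists;
    last by rewrite ccomp1l // /= ctyE addn0.
  apply/den_pair; exists (CId (mon X x)), (cunit S (mon X x)).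
  by split=> //; [apply/ri | apply/den_unit].
- apply: heq_partial => x; case: (ipairP x) => a b {x}.
  case: (a =P b) => [<-|ne].
    left; do 3!eexists; split; [trows|trows|].
    exact/ax_ceqv/cbe_mergeC.
  have ne' : b <> a by move=> e; apply: ne.
  by right; split; tzeros.
- apply: heq_trows => x; case: (ipairP x) => a b {x};
    rewrite (iunitP a) (iunitP b).
  by do 3!eexists; split; [trows|trows|].
- apply: heq_den => x y f; rewrite (iunitP x) (iunitP y) den_unit.
  have r : rid (idm (p := C) [:: 0]) iunit iunit by exact: rid_id.
  by rewrite (r iunit f); split=> [|[]].
- apply: heq_partial => x; case: (ipairP x) => y z {x}.
  case: (ipairP y) => a b {y}; case: (ipairP z) => c d {z}.
  have swap := trow_mswap a b c d.
  case: (a =P c) swap => [<-|ne] swap; last first.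
    right; split; last by eapply tzero_comp2; [exact: swap | tzeros].
    by apply: tzero_merge => /pair_ord_inj[].
  case: (b =P d) swap => [<-|ne] swap; last first.
    right; split; last by eapply tzero_comp2; [exact: swap | tzeros].
    by apply: tzero_merge => /pair_ord_inj[].
  left; do 3!eexists; split; [trows| |].
    by eapply trow_comp; [exact: swap | trows].
  by rewrite !monE cmerge_add.
- apply: heq_den => x y f; rewrite (iunitP x); case: (ipairP y) => a b {x y}.
  have r : rid (mlami (TCB_mul S) [:: 0]) iunit (ipair iunit iunit)
    by exact: rid_lami.
  rewrite den_unit (den_comp_row _ _ _ r) !monE cunit_add; split.
    move=> l; exists (cunit S (mon X a) ⊗ᶜ cunit S (mon Y b)).
      by apply/den_pair; do 2!eexists; split; [apply/den_unit|apply/den_unit|].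
    by rewrite l ccomp1l //= !ctyE.
  case=> h /den_pair[p [q [/den_unit lp /den_unit lq lh]]] l.
  by rewrite l lh lp lq ccomp1l //= !ctyE.
Qed.

Lemma hle_heq P Q (t s : hom (p := C) P Q) : heq t s -> hle t s.
Proof. by case. Qed.

Lemma TCB_cartesian_bicat : is_cartesian_bicat B.
Proof.
have special X : copy B X ;; merge B X ≈ idm X.
  apply: heq_trows => x; do 3!eexists; split; [trows|trows|].
  exact/ax_ceqv/cbe_special.
split.
- exact: TCB_mul_smc.
- exact: TCB_comonoids.
- exact: TCB_monoids.
(* Each entry [p] of [f] yields [p ⊗ᶜ p] among the entries of the product, and the lax law of CB_Σ
   compares with it. Products of entries from different columns appear on the right side only, so
   the law is an inequality. *)
- move=> X Y f; apply: hle_den => x y e /den_hcomp[j [p [q [fp cq l]]]].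
  have [eq lq] := iffLR (trow_copy j _ _) cq.
  have [_ _ [wp dp cp]] := den_thom fp.
  apply/(den_comp_row _ _ _ (trow_copy x)).
  have ey : y = ipair j j by apply: val_inj.
  exists (p ⊗ᶜ p); first by subst y; apply/den_pair; exists p, p.
  by rewrite l lq -dp -cp; apply/cle_ax_le/cbl_copy_lax.
- move=> X Y f; apply: hle_den => x y e /den_hcomp[j [p [q [fp cq l]]]].
  have [eq lq] := iffLR (trow_disc j _ _) cq.
  have [_ _ [wp dp cp]] := den_thom fp.
  apply/(trow_disc x); split=> //.
  by rewrite l lq -dp -cp; apply/cle_ax_le/cbl_disc_lax.
- exact: special.
- move=> X; apply: heq_partial => x; case: (ipairP x) => a b {x}.
  case: (a =P b) => [<-|ne]; last by right; split; tzeros.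
  left; do 3!eexists; split; [trows|trows|].
  rewrite !monE ccomp1r; last cty_tac.
  exact/ax_ceqv/cbe_frobenius.
- move=> X; apply: hle_den => x y e; rewrite (iunitP x) (iunitP y).
  case/den_hcomp=> [j [p [q [/den_unit lp dq l]]]].
  have [eq lq] := iffLR (trow_disc j _ _) dq.
  have r : rid (idm (p := C) [:: 0]) iunit iunit by exact: rid_id.
  apply/(r iunit e); split=> //.
  by rewrite l lp lq; apply/cle_ax_le/cbl_unit_disc.
(* Off the diagonal the left side has zero rows; on it the inequality is the one of CB_Σ. *)
- move=> X; apply: hle_den => x y e; case: (ipairP x) => a b {x}.
  have r : rid (idm (p := C) (pmul X X)) (ipair a b) (ipair a b)
    by exact: rid_id.
  case/den_hcomp=> [j [p [q [mp cq l]]]].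
  case: (a =P b) r mp => [<-|ne] r mp; last by case: (tzero_merge ne mp).
  have [ej lp] := iffLR (trow_merge a _ _) mp.
  have [ey lq] := iffLR (trow_copy j _ _) cq.
  have eja : j = a by apply: val_inj.
  subst j; apply/(r y e); split=> //.
  by rewrite l lp lq monE; apply/cle_ax_le/cbl_merge_copy.
- move=> X; apply: hle_den => x y e.
  have r : rid (idm (p := C) X) x x by exact: rid_id.
  case/(r y e)=> ey l; apply/(den_comp_row _ _ _ (trow_disc x)).
  have eyx : y = x by apply: val_inj.
  subst y; exists (cunit S (mon X x)); first exact/den_unit.
  by rewrite l; apply/cle_ax_le/cbl_disc_unit.
- by move=> X; apply: hle_heq; case: (special X).
Qed.

(** The recursive definitions impose the last four conditions when [X] is a monomial. For an
    arbitrary [X] both sides are compared position by position; for the merge, off-diagonal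
    positions give zero rows on both sides. *)
Lemma TCB_fbcb : is_fbcb_rig (TCB S).
Proof.
split; cbn [add mul rig_cat TCB_rig fbcb_rig fb_ops cb_ops TCB].
- exact: TCB_is_rig.
- exact: TCB_fb.
- exact: TCB_cartesian_bicat.
(* The source is 0, which has no row to compare. *)
- by move=> X; apply: hle_den => -[].
(* All four blocks of [∇;Δ] are identities, and [id ⊕ id] has only the two diagonal ones. *)
- move=> X; apply: hle_den => x y e; case: (isumP x) => i; case: (isumP y) => j.
  + rewrite den_ll => /(rid_id i _ _)[ij l].
    apply/(den_comp_row _ _ _ (rid_merge1 i)).
    exists (CId (mon X i)); first by apply/den_copy; split=> //; left.
    by rewrite l monE ccomp1l.
  + by rewrite den_lr.
  + by rewrite den_rl.
  + rewrite den_rr => /(rid_id i _ _)[ij l].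
    apply/(den_comp_row _ _ _ (rid_merge2 i)).
    exists (CId (mon X i)); first by apply/den_copy; split=> //; right;
      rewrite -ij.
    by rewrite l monE ccomp1l.
- by move=> X; apply: tdisc_unit_le.
- by move=> X; apply: tcopy_merge_le.
- move=> X Y; apply: heq_trows => x; case: (isumP x) => i {x};
    do 3!eexists; (split; [trows|trows|]).
    rewrite !monE ccomp1r ?ccomp1r ?ccomp1l //; cty_tac.
  rewrite !monE ccomp1r ?ccomp1r ?ccomp1l //; cty_tac.
- move=> X Y; apply: heq_trows => x; case: (isumP x) => i {x};
    do 3!eexists; (split; [trows|trows|]).
    rewrite !monE ccomp1r //; cty_tac.
  rewrite !monE ccomp1r //; cty_tac.
- move=> X Y; apply: heq_partial => x; case: (ipairP x) => a b {x}.
  case: (isumP a) => i {a}; case: (isumP b) => k {b}.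
  + case: (i =P k) => [<-|ne].
      left; do 3!eexists; split; [trows|trows|].
      rewrite !monE !(ccomp1l, ccomp1r) //; cty_tac.
    right; split; last by tzeros.
    by apply: tzero_merge => /(congr1 val) /= e; apply/ne/val_inj.
  + right; split; last by tzeros.
    by apply: tzero_merge => /(congr1 val) /= e; have := ltn_ord i; lia.
  + right; split; last by tzeros.
    by apply: tzero_merge => /(congr1 val) /= e; have := ltn_ord k; lia.
  + case: (i =P k) => [<-|ne].
      left; do 3!eexists; split; [trows|trows|].
      rewrite !monE !(ccomp1l, ccomp1r) //; cty_tac.
    right; split; last by tzeros.
    by apply: tzero_merge => /(congr1 val) /= e; apply/ne/val_inj => /=; lia.
- move=> X Y; apply: heq_den => x y e; rewrite (iunitP x) den_unit {x}.
  rewrite den_hcomp; case: (isumP y) => j; rewrite monE; split.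
  + move=> l; exists (il [:: 0] iunit), (CId 0), (cunit S (mon X j)); split.
    * by apply/den_copy; split=> //; left.
    * by apply/den_ll/den_unit.
    * by rewrite l ccomp1l //= ctyE.
  + case=> k [g [h [/den_copy[_ _ lg] dh l]]]; case: (isumP k) dh => o;
      rewrite (iunitP o).
      by move/den_ll/den_unit=> lh; rewrite l lg lh ccomp1l //= ctyE.
    by move/den_rl.
  + move=> l; exists (ir [:: 0] iunit), (CId 0), (cunit S (mon Y j)); split.
    * by apply/den_copy; split=> //; right.
    * by apply/den_rr/den_unit.
    * by rewrite l ccomp1l //= ctyE.
  + case=> k [g [h [/den_copy[_ _ lg] dh l]]]; case: (isumP k) dh => o;
      rewrite (iunitP o).
      by move/den_lr.
    by move/den_rr/den_unit=> lh; rewrite l lg lh ccomp1l //= ctyE.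
Qed.

End Tapes.

Theorem theorem7p3 (Sigma : signature) : is_fbcb_rig (TCB Sigma).
Proof. exact: TCB_fbcb. Qed.
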